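(* Let $(\mathcal G,\mathcal Y)$ be a developable complex of groups over a finite connected simplicial complex $\mathcal Y$, with development $B$ and $G=\pi_1(\mathcal G,\mathcal Y)$. Suppose $G$ is hyperbolic and all the face groups (local groups) are quasiconvex in $G$. Let $\mathcal Y_1$ be a connected subcomplex of $\mathcal Y$ and $(\mathcal G,\mathcal Y_1)$ the (developable) complex of groups obtained by restricting $(\mathcal G,\mathcal Y)$ to $\mathcal Y_1$, with $G_1=\pi_1(\mathcal G,\mathcal Y_1)$ and development $B_1$. Suppose the natural homomorphism $G_1\to G$ is injective and that $G_1$ is hyperbolic. Then: (1) The spaces $B$, $B_1$ are hyperbolic. (2) If the natural map $B_1\to B$ satisfies Mitra's criterion, then there exists a Cannon-Thurston (CT) map for the inclusion $G_1\to G$. Moreover, $G_1$ is quasiconvex in $G$ if and only if the Cannon-Thurston map for $B_1\to B$ is injective.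
   Context: Complexes of groups. Directed edges of $\mathcal Y$ are pairs $e=(\sigma,\tau)$ of simplices with $\tau\subsetneq\sigma$; $o(e)=\sigma$, $t(e)=\tau$. If $o(e)=t(e')$, put $e*e'=(o(e'),t(e))$. A complex of groups $(\mathcal G,\mathcal Y)$ consists of a group $G_\sigma$ (local group) for each simplex, an injective homomorphism (local map) $\psi_e:G_{o(e)}\to G_{t(e)}$ for each $e$, and elements $g_{e,e'}\in G_{t(e)}$ for composable $e,e'$ with $\mathrm{Ad}(g_{e,e'})\psi_{e*e'}=\psi_e\psi_{e'}$ and $\psi_e(g_{e',e''})g_{e,e'*e''}=g_{e,e'}g_{e*e',e''}$. Its fundamental group $\pi_1(\mathcal G,\mathcal Y)$ is generated by the groups $G_\sigma$ and symbols $k_e$, subject to the relations of the $G_\sigma$, $k_egk_e^{-1}=\psi_e(g)$ for $g\in G_{o(e)}$, $k_ek_{e'}=g_{e,e'}k_{e*e'}$, and $k_e=1$ for $e$ in a fixed maximal tree of the graph with vertices the simplices and edges the $e$'s. It is developable if the natural maps $G_\sigma\to G$ are all injective. The development (universal cover) is $B=(G\times\bigsqcup_\sigma\sigma)/\sim$ with $(gg',x)\sim(g,x)$ for $g'\in G_\sigma$, $x\in\sigma$, and, for $e=(\sigma,\sigma')$ and $x\in\sigma'\subset\sigma$, the pair $(g,x)$ with $x$ viewed in $\sigma$ is identified with $(gk_e^{-1},x)$ with $x$ viewed in $\sigma'$. It carries the quotient metric obtained by gluing standard Euclidean simplices. The natural map $B_1\to B$ is $[h,x]\mapsto[h,x]$.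 $\partial X$ is the (sequential) Gromov boundary of a hyperbolic geodesic space $X$; for a hyperbolic group use a Cayley graph. A map $f:Y\to X$ of hyperbolic spaces admits the CT map if for every $\xi\in\partial Y$ and every $y_n\to\xi$ in $Y$, $\{f(y_n)\}$ converges to a point of $\partial X$ depending only on $\xi$, and the resulting map $\partial f:\partial Y\to\partial X$ is continuous. Mitra's criterion for $f:Y\to X$: given $y_0\in Y$ there is a non-negative function $M(N)\to\infty$ as $N\to\infty$ such that for every geodesic segment $\lambda$ of $Y$ outside $B(y_0,N)$, any geodesic segment in $X$ joining the endpoints of $f(\lambda)$ lies outside $B(f(y_0),M(N))$. *)

(* Defs.v *)
From HB Require Import structures.
From mathcomp Require Import all_boot all_order all_algebra.
From mathcomp Require Import all_classical all_reals all_analysis.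

Set Implicit Arguments.
Unset Strict Implicit.
Unset Printing Implicit Defensive.

Import Order.TTheory GRing.Theory Num.Theory.
Import numFieldNormedType.Exports.

Local Open Scope classical_set_scope.
Local Open Scope ring_scope.
Local Open Scope quotient_scope.

Section GeneratedQuotient.
Variables (T : Type) (r : T -> T -> Prop).

Inductive eqv_gen : T -> T -> Prop :=
| eqv_base x y : r x y -> eqv_gen x y
| eqv_refl x : eqv_gen x x
| eqv_sym x y : eqv_gen x y -> eqv_gen y x
| eqv_trans x y z : eqv_gen x y -> eqv_gen y z -> eqv_gen x z.

Definition eqv_rel : rel {classic T} := fun x y => `[< eqv_gen x y >].

Lemma eqv_rel_refl : reflexive eqv_rel.
Proof. by move=> x; apply/asboolP; exact: eqv_refl. Qed.

Lemma eqv_rel_sym : symmetric eqv_rel.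
Proof. by move=> x y; apply/asboolP/asboolP; exact: eqv_sym. Qed.

Lemma eqv_rel_trans : transitive eqv_rel.
Proof.
move=> y x z /asboolP xy /asboolP yz; apply/asboolP; exact: eqv_trans xy yz.
Qed.

Canonical eqv_equiv := EquivRel eqv_rel eqv_rel_refl eqv_rel_sym eqv_rel_trans.

Definition quot := {eq_quot eqv_equiv}.
HB.instance Definition _ := Choice.on quot.
HB.instance Definition _ := EqQuotient.on quot.

Definition to_quot (x : T) : quot := \pi_quot (x : {classic T}).
Definition of_quot (a : quot) : T := repr a.

Lemma of_quotK : cancel of_quot to_quot.
Proof. exact: reprK. Qed.

Lemma to_quotP x y : to_quot x = to_quot y <-> eqv_gen x y.
Proof.
by split=> [/eqmodP/asboolP//|xy]; apply/eqmodP/asboolP.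
Qed.

Lemma eqv_of_quot x : eqv_gen (of_quot (to_quot x)) x.
Proof. by apply/to_quotP; rewrite of_quotK. Qed.

End GeneratedQuotient.

Definition quot_map (T T' : Type) (r : T -> T -> Prop) (r' : T' -> T' -> Prop)
  (f : T -> T') (a : quot r) : quot r' := to_quot r' (f (of_quot a)).

Lemma quot_mapE (T T' : Type) (r : T -> T -> Prop) (r' : T' -> T' -> Prop)
    (f : T -> T') :
  (forall x y, r x y -> eqv_gen r' (f x) (f y)) ->
  forall x, quot_map r' f (to_quot r x) = to_quot r' (f x).
Proof.
move=> fr x; apply/to_quotP.
have {}fr y z : eqv_gen r y z -> eqv_gen r' (f y) (f z).
  elim=> {y z} [y z /fr //|y|y z _ ?|y z t _ yz _ zt].
  - exact: eqv_refl.
  - exact: eqv_sym.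
  - exact: eqv_trans yz zt.
exact/fr/eqv_of_quot.
Qed.

(* The letter (a, true) is the generator a, (a, false) its formal inverse. *)
Definition word (A : Type) := seq (A * bool).

Section Presentation.
Variables (A : Type) (rels : word A -> word A -> Prop).
Local Notation word := (word A).

Inductive pres_step : word -> word -> Prop :=
| pres_cancel u v a b : pres_step (u ++ [:: (a, b); (a, ~~ b)] ++ v) (u ++ v)
| pres_rel u v l r : rels l r -> pres_step (u ++ l ++ v) (u ++ r ++ v).

Definition presented := quot pres_step.
HB.instance Definition _ := Choice.on presented.

Definition winv (w : word) : word := rev [seq (a.1, ~~ a.2) | a <- w].

Local Notation "u =w v" := (eqv_gen pres_step u v) (at level 70).

Lemma pres_catr u u' v : u =w u' -> u ++ v =w u' ++ v.
Proof.
elim=> [_ _ [p q a b|p q l r lr]|p|p q _|p q t _ + _].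
- by rewrite -!catA; apply: eqv_base; exact: (pres_cancel _ _ a b).
- by rewrite -!catA; apply: eqv_base; exact: pres_rel.
- exact: eqv_refl.
- exact: eqv_sym.
- exact: eqv_trans.
Qed.

Lemma pres_catl u v v' : v =w v' -> u ++ v =w u ++ v'.
Proof.
elim=> [_ _ [p q a b|p q l r lr]|p|p q _|p q t _ + _].
- rewrite !(catA u); apply: eqv_base; exact: (pres_cancel _ _ a b).
- rewrite !(catA u); apply: eqv_base; exact: pres_rel.
- exact: eqv_refl.
- exact: eqv_sym.
- exact: eqv_trans.
Qed.

Lemma pres_cat u u' v v' : u =w u' -> v =w v' -> u ++ v =w u' ++ v'.
Proof. by move=> uu' vv'; apply: eqv_trans (pres_catl _ vv'); exact: pres_catr. Qed.

Lemma winvK : involutive winv.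
Proof.
move=> w; rewrite /winv map_rev revK -map_comp -[RHS]map_id.
by apply: eq_map => -[a b]; rewrite /= negbK.
Qed.

Lemma winv_cat u v : winv (u ++ v) = winv v ++ winv u.
Proof. by rewrite /winv map_cat rev_cat. Qed.

Lemma cat_winv w : w ++ winv w =w [::].
Proof.
elim/last_ind: w => [|w [a b] IH]; first exact: eqv_refl.
apply: eqv_trans IH; apply: eqv_base.
rewrite /winv map_rcons rev_rcons -cats1 -catA.
exact: (pres_cancel _ _ a b).
Qed.

Lemma winv_catK w : winv w ++ w =w [::].
Proof. by rewrite -{2}[w]winvK; exact: cat_winv. Qed.

Lemma winv_eqv u v : u =w v -> winv u =w winv v.
Proof.
move=> uv; apply: (@eqv_trans _ _ _ (winv u ++ v ++ winv v)).
  rewrite -{1}[winv u]cats0; apply: pres_cat; first exact: eqv_refl.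
  exact/eqv_sym/cat_winv.
rewrite catA -[X in _ =w X]cat0s; apply: pres_cat; last exact: eqv_refl.
apply: (@eqv_trans _ _ _ (winv u ++ u)); last exact: winv_catK.
by apply: pres_cat; [exact: eqv_refl|exact: eqv_sym].
Qed.

Definition pmul (x y : presented) : presented :=
  to_quot _ (of_quot x ++ of_quot y).
Definition pone : presented := to_quot _ [::].
Definition pinv (x : presented) : presented := to_quot _ (winv (of_quot x)).

Lemma pmulE u v : pmul (to_quot _ u) (to_quot _ v) = to_quot _ (u ++ v).
Proof. by apply/to_quotP; apply: pres_cat; exact: eqv_of_quot. Qed.

Lemma pinvE u : pinv (to_quot _ u) = to_quot _ (winv u).
Proof. by apply/to_quotP; apply: winv_eqv; exact: eqv_of_quot. Qed.

Lemma pmulA : associative pmul.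
Proof.
move=> x y z; rewrite -[x]of_quotK -[y]of_quotK -[z]of_quotK.
by rewrite !pmulE catA.
Qed.

Lemma pmul1g : left_id pone pmul.
Proof. by move=> x; rewrite -[x]of_quotK pmulE. Qed.

Lemma pmulg1 : right_id pone pmul.
Proof. by move=> x; rewrite -[x]of_quotK pmulE cats0. Qed.

Lemma pmulVg : left_inverse pone pinv pmul.
Proof.
move=> x; rewrite -[x]of_quotK pinvE pmulE.
by apply/to_quotP; exact: winv_catK.
Qed.

Lemma pmulgV : right_inverse pone pinv pmul.
Proof.
move=> x; rewrite -[x]of_quotK pinvE pmulE.
by apply/to_quotP; exact: cat_winv.
Qed.

HB.instance Definition _ :=
  isGroup.Build presented pmulA pmul1g pmulg1 pmulVg pmulgV.

Definition pgen (a : A) : presented := to_quot _ [:: (a, true)].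

End Presentation.

Section Metric.
Variables (R : realType) (T : Type) (d : T -> T -> R).

Definition is_metric : Prop :=
  [/\ forall x y, 0 <= d x y, forall x y, d x y = 0 <-> x = y,
      forall x y, d x y = d y x & forall x y z, d x z <= d x y + d y z].

Definition geodesic_segment (x y : T) (A : set T) : Prop :=
  exists c : R -> T,
    [/\ c 0 = x, c (d x y) = y, A = c @` `[0, d x y]
      & {in `[0, d x y] &, forall s t, d (c s) (c t) = `|s - t|}].

Definition geodesic_space : Prop :=
  forall x y, exists A, geodesic_segment x y A.

Definition slim_triangles (delta : R) : Prop :=
  forall x y z A B C, geodesic_segment x y A -> geodesic_segment y z B ->
    geodesic_segment x z C ->
    forall a, A a -> exists2 b, (B `|` C) b & d a b <= delta.

Definition hyperbolic : Prop :=
  [/\ is_metric, geodesic_space & exists delta, slim_triangles delta].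

Definition gromov_prod (p x y : T) : R := (d x p + d y p - d x y) / 2.

Definition equiv_at_infty (x y : nat -> T) : Prop :=
  forall p M, \forall i & j \near \oo, M <= gromov_prod p (x i) (y j).

Definition cvg_to_infty (x : nat -> T) : Prop := equiv_at_infty x x.

Definition boundary_class (xi : set (nat -> T)) : Prop :=
  exists2 x, cvg_to_infty x &
    xi = [set y | cvg_to_infty y /\ equiv_at_infty x y].

(* The sequential Gromov boundary: a point is an equivalence class, so that
   [val xi y] means that the sequence [y] converges to [xi]. *)
Definition boundary : Type := set_type boundary_class.
HB.instance Definition _ := Choice.on boundary.
HB.instance Definition _ := SubType.on boundary.

(* The points of the boundary that can be joined to [xi] by sequences with
   liminf_(i,j) of (x_i | y_j)_p at least r. *)
Definition boundary_nbhd (p : T) (r : R) (xi : boundary) : set boundary :=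
  [set eta : boundary | exists x y, [/\ val xi x, val eta y &
    forall r', r' < r ->
      \forall i & j \near \oo, r' <= gromov_prod p (x i) (y j)]].

Definition boundary_open (A : set boundary) : Prop :=
  forall p xi, A xi -> exists r, boundary_nbhd p r xi `<=` A.

Lemma boundary_nbhd_le p r r' xi :
  r <= r' -> boundary_nbhd p r' xi `<=` boundary_nbhd p r xi.
Proof.
move=> rr' eta [x [y [xix ey h]]]; exists x, y; split=> // s sr.
exact/h/(lt_le_trans sr).
Qed.

Lemma boundary_openT : boundary_open setT.
Proof. by move=> p xi _; exists 0. Qed.

Lemma boundary_openI : setI_closed boundary_open.
Proof.
move=> A B oA oB p xi [/(oA p)[r rA] /(oB p)[s sB]]; exists (Num.max r s).
move=> eta h; split.
- by apply/rA/(boundary_nbhd_le _ h); rewrite le_max lexx.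
- by apply/sB/(boundary_nbhd_le _ h); rewrite le_max lexx orbT.
Qed.

Lemma boundary_open_bigU (I : Type) (f : I -> set boundary) :
  (forall i, boundary_open (f i)) -> boundary_open (\bigcup_i f i).
Proof.
move=> of_ p xi [i _ /(of_ i p)[r h]]; exists r => eta /h fe.
by exists i.
Qed.

HB.instance Definition _ := isOpenTopological.Build boundary
  boundary_openT boundary_openI boundary_open_bigU.

Lemma boundary_openE (A : set boundary) : open A = boundary_open A.
Proof. by []. Qed.

End Metric.

Section CannonThurston.
Variables (R : realType) (Y X : Type) (dY : Y -> Y -> R) (dX : X -> X -> R).
Variable f : Y -> X.

(* [g] is the CT map of [f]: every y_n -> xi has f(y_n) -> g xi *)
Definition is_CT_map (g : boundary dY -> boundary dX) : Prop :=
  (forall xi y, val xi y -> val (g xi) (f \o y)) /\ continuous g.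

Definition admits_CT : Prop := exists g, is_CT_map g.

Definition mitra_criterion : Prop :=
  forall y0 : Y, exists M : R -> R,
    [/\ forall N, 0 <= M N, M x @[x --> +oo] --> +oo &
      forall N y y' A B, geodesic_segment dY y y' A ->
        (forall a, A a -> ~ dY y0 a < N) ->
        geodesic_segment dX (f y) (f y') B ->
        forall b, B b -> ~ dX (f y0) b < M N].

End CannonThurston.

Section Gluing.
Variables (R : realType) (I : Type) (P : I -> Type).
Variable dP : forall i, P i -> P i -> R.
Variable r : {i & P i} -> {i & P i} -> Prop.

(* [chain p q l]: there are finitely many segments [x_k, y_k], each in one
   piece, of total length l, with p ~ x_1, y_k ~ x_(k+1) and y_n ~ q. *)
Inductive chain : {i & P i} -> {i & P i} -> R -> Prop :=
| chain_glue p q : eqv_gen r p q -> chain p q 0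
| chain_step p q l i (x y : P i) : chain p (existT P i x) l ->
    eqv_gen r (existT P i y) q -> chain p q (l + dP x y).

(* The infimum is that of a nonempty set as soon as the glued space is
   connected; for disconnected ones [inf set0 = 0] is a junk value, which
   [is_metric] rules out. *)
Definition glue_dist (a b : quot r) : R :=
  inf [set l | chain (of_quot a) (of_quot b) l].

End Gluing.

Definition generates (G : groupType) (S : seq G) : Prop :=
  forall g : G, exists2 w : seq (G * bool), all (fun a => a.1 \in S) w &
    g = (\prod_(a <- w) (if a.2 then a.1 else a.1^-1))%g.

Section Cayley.
Variables (R : realType) (G : groupType) (S : seq G).

(* The geometric realization is glued from the vertices and a copy of [0, 1]
   for each edge (g, s), which runs from g to gs. *)
Definition cay_index : Type := (G + G * seq_sub S)%type.

Definition unit_interval := {t : R | 0 <= t <= 1}.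

Definition cay_piece (i : cay_index) : Type :=
  if i is inr _ then unit_interval else unit.

Definition cay_piece_dist (i : cay_index) : cay_piece i -> cay_piece i -> R :=
  match i with
  | inl _ => fun _ _ => 0
  | inr _ => fun x y : unit_interval => `|val x - val y|
  end.

Definition cay_vertex_pt (g : G) : {i & cay_piece i} :=
  existT cay_piece (inl g) tt.
Definition cay_edge_pt (g : G) (s : seq_sub S) (t : unit_interval) :
  {i & cay_piece i} := existT cay_piece (inr (g, s)) t.

Inductive cay_glue : {i & cay_piece i} -> {i & cay_piece i} -> Prop :=
| cay_glue0 g s t : val t = 0 -> cay_glue (cay_edge_pt g s t) (cay_vertex_pt g)
| cay_glue1 g s t : val t = 1 ->
    cay_glue (cay_edge_pt g s t) (cay_vertex_pt (g * val s)%g).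

Definition cayley := quot cay_glue.
Definition cayley_dist : cayley -> cayley -> R :=
  glue_dist cay_piece_dist (r:=cay_glue).
Definition cay_vertex (g : G) : cayley := to_quot _ (cay_vertex_pt g).

End Cayley.

Definition hyperbolic_group (R : realType) (G : groupType) : Prop :=
  exists2 S : seq G, generates S & hyperbolic (@cayley_dist R G S).

Definition quasiconvex_in (R : realType) (G : groupType) (S : seq G)
    (H : set G) : Prop :=
  exists K : R, forall g h A, H g -> H h ->
    geodesic_segment (@cayley_dist R G S)
      (cay_vertex R S g) (cay_vertex R S h) A ->
    forall a, A a ->
      exists2 k, H k & cayley_dist a (cay_vertex R S k) <= K.

(* For hyperbolic G this does not depend on the finite generating set. *)
Definition quasiconvex (R : realType) (G : groupType) (H : set G) : Prop :=
  exists2 S : seq G, generates S & quasiconvex_in R S H.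

Section CayleyMap.
Variables (R : realType) (H G : groupType) (f : H -> G).
Variables (S1 : seq H) (S : seq G) (fS : {in S1, forall s, f s \in S}).

Definition cay_letter_map (s : seq_sub S1) : seq_sub S :=
  SeqSub (fS (ssvalP s)).

Definition cay_map_pt (p : {i & cay_piece R (S:=S1) i}) :
    {i & cay_piece R (S:=S) i} :=
  match p with
  | existT (inl h) _ => cay_vertex_pt R S (f h)
  | existT (inr (h, s)) t => cay_edge_pt (f h) (cay_letter_map s) t
  end.

Definition cayley_map : cayley R S1 -> cayley R S :=
  quot_map (cay_glue (R:=R) (S:=S)) cay_map_pt.

Lemma cayley_mapE : {morph f : x y / (x * y)%g} ->
  forall p, cayley_map (to_quot _ p) = to_quot _ (cay_map_pt p).
Proof.
move=> fM; apply: quot_mapE => _ _ [h s t t0|h s t t1]; apply: eqv_base.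
- exact: cay_glue0.
- rewrite /= fM; exact: (cay_glue1 _ (cay_letter_map s)).
Qed.

End CayleyMap.

(* CT map for a homomorphism f of groups: finite generating sets S1 of H and
   S of G with f(S1) contained in S give a map of Cayley graphs. *)
Definition group_admits_CT (R : realType) (H G : groupType) (f : H -> G) :=
  forall (S1 : seq H) (S : seq G) (fS : {in S1, forall s, f s \in S}),
    generates S1 -> generates S ->
    admits_CT (@cayley_dist R H S1) (@cayley_dist R G S) (cayley_map fS).

Local Close Scope classical_set_scope.

Section Simplicial.
Variable V : finType.
Implicit Types K : {set {set V}}.

Definition simplicial_complex K : Prop :=
  finset.set0 \notin K /\
  forall s t : {set V}, s \in K -> t != finset.set0 -> t \subset s -> t \in K.

Definition connected_complex K : Prop :=
  K != finset.set0 /\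
  forall u v : V, [set u] \in K -> [set v] \in K ->
    connect [rel x y : V | [set x; y] \in K] u v.

(* e = (s, t) is the directed edge with origin s and terminus t, t < s *)
Definition edges K : {set {set V} * {set V}} :=
  [set e | [&& e.1 \in K, e.2 \in K & e.2 \proper e.1]].

Definition tree_rel (T : {set {set V} * {set V}}) : rel {set V} :=
  [rel s t | ((s, t) \in T) || ((t, s) \in T)].

Definition maximal_tree K (T : {set {set V} * {set V}}) : Prop :=
  [/\ T \subset edges K,
      {in K &, forall s t, connect (tree_rel T) s t}
    & forall c : seq {set V}, (2 < size c)%N -> ~ ucycle (tree_rel T) c].

Definition simplex K := {s : {set V} | s \in K}.

Definition incl_simplex K1 K (sK : K1 \subset K) (s : simplex K1) : simplex K :=
  exist _ (val s) (fintype.subsetP sK _ (valP s)).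

Definition edge K (s t : simplex K) : bool := val t \proper val s.

(* The local map of the edge e = (s, t) is psi s t; for e = (t, u) and
   e' = (s, t), so that e * e' = (s, u), the element g_{e,e'} is twist s t u. *)
Record complex_of_groups K := ComplexOfGroups {
  locgrp :> simplex K -> groupType ;
  psi : forall s t, edge s t -> {multiplicative locgrp s -> locgrp t} ;
  psi_inj : forall s t (e : edge s t), injective (psi e) ;
  twist : forall s t u, edge s t -> edge t u -> locgrp u ;
  twistP : forall s t u (e' : edge s t) (e : edge t u) (ee' : edge s u) x,
    (twist e' e * psi ee' x * (twist e' e)^-1 = psi e (psi e' x))%g ;
  twist_cocycle : forall q s t u
    (e'' : edge q s) (e' : edge s t) (e : edge t u)
    (e'e'' : edge q t) (ee' : edge s u),
    (psi e (twist e'' e') * twist e'e'' e = twist e' e * twist e'' ee')%g }.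

Section Restriction.
Variables (K1 K : {set {set V}}) (sK : K1 \subset K) (Y : complex_of_groups K).
Local Notation i := (incl_simplex sK).

Definition restrict_cog : complex_of_groups K1 :=
  @ComplexOfGroups K1 (fun s => Y (i s))
    (fun s t e => @psi K Y (i s) (i t) e)
    (fun s t e => @psi_inj K Y (i s) (i t) e)
    (fun s t u e' e => @twist K Y (i s) (i t) (i u) e' e)
    (fun s t u e' e ee' => @twistP K Y (i s) (i t) (i u) e' e ee')
    (fun q s t u e'' e' e e'e'' ee' =>
       @twist_cocycle K Y (i q) (i s) (i t) (i u) e'' e' e e'e'' ee').

End Restriction.

Section Pi1.
Variables (K : {set {set V}}) (Y : complex_of_groups K).
Variable T : {set {set V} * {set V}}.

Inductive pi1_gen : Type :=
| GLoc (s : simplex K) (x : Y s)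
| GEdge (s t : simplex K) (e : edge s t).

Local Notation loc x := (@GLoc _ x, true).
Local Notation ked e := (GEdge e, true).

Inductive pi1_rel : word pi1_gen -> word pi1_gen -> Prop :=
| rel_loc s (x y : Y s) : pi1_rel [:: loc x; loc y] [:: loc (x * y)%g]
| rel_conj s t (e : edge s t) (x : Y s) :
    pi1_rel [:: ked e; loc x; (GEdge e, false)] [:: loc (psi Y e x)]
| rel_comp s t u (e' : edge s t) (e : edge t u) (ee' : edge s u) :
    pi1_rel [:: ked e; ked e'] [:: loc (twist Y e' e); ked ee']
| rel_tree s t (e : edge s t) : (val s, val t) \in T -> pi1_rel [:: ked e] [::].

Definition pi1 : groupType := presented pi1_rel.

Definition pi1_loc (s : simplex K) (x : Y s) : pi1 := pgen pi1_rel (GLoc x).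
Definition pi1_edge (s t : simplex K) (e : edge s t) : pi1 :=
  pgen pi1_rel (GEdge e).

Definition developable : Prop := forall s, injective (@pi1_loc s).

End Pi1.

Section Pi1Map.
Variables (K1 K : {set {set V}}) (sK : K1 \subset K) (Y : complex_of_groups K).
Variables (T1 T : {set {set V} * {set V}}).
Local Notation i := (incl_simplex sK).
Local Notation Y1 := (restrict_cog sK Y).

Definition gen_map (a : pi1_gen Y1) : pi1_gen Y :=
  match a with
  | GLoc s x => @GLoc K Y (i s) x
  | GEdge s t e => @GEdge K Y (i s) (i t) e
  end.

Definition word_map (w : word (pi1_gen Y1)) : word (pi1_gen Y) :=
  [seq (gen_map a.1, a.2) | a <- w].

(* The map sending each generator to itself; it is a well-defined homomorphism
   when T1 \subset T, see [pi1_mapE] and [pi1_mapM]. *)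
Definition pi1_map : pi1 Y1 T1 -> pi1 Y T :=
  quot_map (pres_step (pi1_rel (Y:=Y) T)) word_map.

Lemma pi1_mapE : T1 \subset T -> forall w,
  pi1_map (to_quot _ w) = to_quot _ (word_map w).
Proof.
move=> sT; apply: quot_mapE => _ _ [u v a b|u v l r lr].
  rewrite /word_map !map_cat; apply: eqv_base; exact: (pres_cancel _ _ _ _ b).
rewrite /word_map !map_cat; apply: eqv_base; apply: pres_rel.
case: lr => [s x y|s t e x|s t p e' e ee'|s t e eT] /=.
- exact: (@rel_loc K Y T (i s) x y).
- exact: (@rel_conj K Y T (i s) (i t) e x).
- exact: (@rel_comp K Y T (i s) (i t) (i p) e' e ee').
- apply: (@rel_tree K Y T (i s) (i t) e); exact: (fintype.subsetP sT).
Qed.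

Lemma pi1_mapM : T1 \subset T -> {morph pi1_map : x y / (x * y)%g}.
Proof.
move=> sT x y; rewrite -[x]of_quotK -[y]of_quotK.
have mE K' (Y' : complex_of_groups K') T' u v :
    ((to_quot _ u : pi1 Y' T') * to_quot _ v)%g = to_quot _ (u ++ v).
  exact: pmulE.
by rewrite mE !pi1_mapE // mE /word_map map_cat.
Qed.

End Pi1Map.

Section Development.
Variable R : realType.

(* The standard simplex on s is the convex hull of the basis vectors e_v of
   R^V, v in s. A point of a face has the same coordinates in the face and in
   the simplex. *)
Definition std_simplex (s : {set V}) : Type :=
  {x : {ffun V -> R} | [&& [forall v, 0 <= x v], [forall v, (x v != 0) ==> (v \in s)]
                         & \sum_v x v == 1]}.

Definition std_dist (s : {set V}) (x y : std_simplex s) : R :=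
  Num.sqrt (\sum_v (val x v - val y v) ^+ 2).

Variables (K : {set {set V}}) (Y : complex_of_groups K).
Variable T : {set {set V} * {set V}}.
Local Notation G := (pi1 Y T).

Definition dev_piece (i : G * simplex K) : Type := std_simplex (val i.2).

Definition dev_pt (g : G) (s : simplex K) (x : std_simplex (val s)) :
  {i & dev_piece i} := existT dev_piece (g, s) x.

Inductive dev_glue : {i & dev_piece i} -> {i & dev_piece i} -> Prop :=
| dev_glue_loc g s (a : Y s) x :
    dev_glue (@dev_pt (g * pi1_loc T a)%g s x) (@dev_pt g s x)
| dev_glue_face g s t (e : edge s t)
    (x : std_simplex (val s)) (x' : std_simplex (val t)) : val x = val x' ->
    dev_glue (@dev_pt g s x) (@dev_pt (g * (pi1_edge Y T e)^-1)%g t x').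

Definition development := quot dev_glue.
Definition dev_dist : development -> development -> R :=
  glue_dist (fun i => @std_dist (val i.2)) (r:=dev_glue).

End Development.

Section DevelopmentMap.
Variables (R : realType) (K1 K : {set {set V}}) (sK : K1 \subset K).
Variables (Y : complex_of_groups K) (T1 T : {set {set V} * {set V}}).
Local Notation Y1 := (restrict_cog sK Y).
Local Notation i := (incl_simplex sK).
Local Notation iota := (@pi1_map K1 K sK Y T1 T).

Definition dev_map_pt (p : {j & dev_piece R (Y:=Y1) (T:=T1) j}) :
    {j & dev_piece R (Y:=Y) (T:=T) j} :=
  let: existT (h, s) x := p in @dev_pt R K Y T (iota h) (i s) x.

Definition development_map : development R Y1 T1 -> development R Y T :=
  quot_map (dev_glue (R:=R) (Y:=Y) (T:=T)) dev_map_pt.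

Lemma development_mapE : T1 \subset T -> forall p,
  development_map (to_quot _ p) = to_quot _ (dev_map_pt p).
Proof.
move=> sT; apply: quot_mapE => _ _ [g s a x|g s t e x x' xx']; apply: eqv_base.
- rewrite /= pi1_mapM // pi1_mapE //; exact: (@dev_glue_loc R K Y T _ (i s) a x).
- rewrite /= pi1_mapM //.
  have -> : iota (pi1_edge Y1 T1 e)^-1%g = (@pi1_edge K Y T (i s) (i t) e)^-1%g.
    have iE K' (Y' : complex_of_groups K') T' u :
        ((to_quot _ u : pi1 Y' T')^-1)%g = to_quot _ (winv u).
      exact: pinvE.
    by rewrite /pi1_edge /pgen !iE pi1_mapE.
  exact: (@dev_glue_face R K Y T _ (i s) (i t) e x x').
Qed.

End DevelopmentMap.

End Simplicial.

Arguments is_CT_map {R Y X} dY dX f g.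
Arguments pi1_loc {V K} Y T s x.
Arguments pi1_map {V K1 K} sK Y T1 T.
Arguments dev_dist {V} R {K} Y T.
Arguments development_map {V} R {K1 K} sK Y T1 T.

(* Main.v *)
Require Import Defs.
From mathcomp Require Import all_boot all_order all_algebra.
From mathcomp Require Import all_classical all_reals all_analysis.
From mathcomp Require Import zify ring lra.

(** Write d for a word metric of G and rho for the metric that the development B
    induces on an orbit of G.  Since the local groups are quasiconvex, intervals of d whose
    ends are rho-close are rho-bounded, and this forces geodesics of d and of rho to
    fellow-travel in rho ([stability], [alignment]).  Hence rho inherits hyperbolicity, and
    Gromov products of rho are rho-distances to intervals of d.  B is a geodesic space
    although it is not locally finite: near-minimal paths converge along an ultrafilter
    in barycentric coordinates, and these alone determine lengths.

    Mitra's criterion passes from B_1 -> B to G_1 -> G because an interval of G_1 that is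
    bounded in B_1 is undistorted in G, while its unbounded ends are controlled in B.
    If G_1 is not quasiconvex, some geodesic line of G_1 has an image that leaves every ball
    of G in between its ends; both ends then converge in the boundary of B_1, to distinct
    points with the same image. *)

Set Implicit Arguments.
Unset Strict Implicit.
Unset Printing Implicit Defensive.

Import Order.TTheory GRing.Theory Num.Theory.
Import numFieldNormedType.Exports.

Local Open Scope ring_scope.

(** * Real metric spaces and their boundaries *)

(** The local groups may be infinite, so an orbit of G in [B] can be far from quasi-isometric to G,
    and finite balls are available only for word metrics. The geometry of the groups is therefore
    kept in natural-number word metrics, with intervals [btw] in place of chosen geodesics, and what
    is needed of [rho] is isolated in the record [model]. Its instances are the orbit distances, [d]
    itself and every other word metric of the group, so that one stability theorem also yields the
    classical Morse lemma and the passage between generating sets. Mitra's criterion is used only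
    through Gromov products ([gromov_proper]): these change boundedly when points move boundedly, so
    the condition passes from a development to an orbit, and from vertices to a whole Cayley graph.
    For the groups the corresponding condition is that intervals of G_1 outside large balls have
    endpoints whose images span intervals of G outside large balls. *)

Section NearInfinity.
Local Open Scope classical_set_scope.

Lemma near2P (P : nat -> nat -> Prop) : (\forall i & j \near \oo, P i j) <->
  exists N, forall i j, (N <= i)%N -> (N <= j)%N -> P i j.
Proof.
split.
- case=> -[A B] /= [[a _ hA] [b _ hB]] h; exists (maxn a b) => i j.
  rewrite !geq_max => /andP[ai bi] /andP[aj bj]; apply: (h (i, j)).
  by split; [apply: hA|apply: hB].
- move=> [N h]; exists ([set i | (N <= i)%N], [set i | (N <= i)%N]).
    by split; exists N.
  by move=> [i j] [/= iN jN]; exact: h.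
Qed.

End NearInfinity.

(** Points at distance 0 may differ: the orbit distance of a development does not separate the
    elements of a coset of the local group at the base simplex. *)
Record pseudo_metric (R : realType) (T : Type) (d : T -> T -> R) : Prop :=
  PseudoMetric {
    pm0 : forall x, d x x = 0;
    pm_ge0 : forall x y, 0 <= d x y;
    pmC : forall x y, d x y = d y x;
    pmT : forall y x z, d x z <= d x y + d y z }.

Section RealMetric.
Local Open Scope classical_set_scope.
Local Open Scope ring_scope.
Variables (R : realType) (T : Type) (d : T -> T -> R).
Hypothesis dm : pseudo_metric d.

Let mge0 := pm_ge0 dm.
Let mxx := pm0 dm.
Let mC := pmC dm.
Let mT := pmT dm.

Lemma gromov_prodC p x y : gromov_prod d p x y = gromov_prod d p y x.
Proof. by rewrite /gromov_prod (mC x y) [d x p + _]addrC. Qed.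

Lemma gromov_prod_diff p x y p' x' y' :
  gromov_prod d p x y <= gromov_prod d p' x' y' + (d p p' + d x x' + d y y').
Proof.
rewrite /gromov_prod; have := mT x' x p; have := mT p' x' p; have := mT y' y p.
have := mT p' y' p; have := mT x x' y'; have := mT y x y'.
by rewrite (mC p' p) (mC x' x); lra.
Qed.

Lemma gromov_prod_btw p x y a : d x a + d a y = d x y -> gromov_prod d p x y <= d p a.
Proof.
rewrite /gromov_prod => h; have := mT a x p; have := mT a y p.
by rewrite (mC a p) (mC y a); lra.
Qed.

Lemma segment_at x y c t : c 0 = x -> c (d x y) = y ->
  {in `[0, d x y] &, forall s t, d (c s) (c t) = `|s - t|} -> 0 <= t <= d x y ->
  d x (c t) = t /\ d (c t) y = d x y - t.
Proof.
move=> c0 c1 h /andP[t0 t1]; have xy := mge0 x y.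
have := h 0 t; have := h t (d x y).
rewrite c0 c1 !in_itv /= !lexx xy t0 t1 => /(_ isT isT) -> /(_ isT isT) ->.
by rewrite sub0r normrN ger0_norm// ler0_norm ?subr_le0// opprB.
Qed.

Lemma segment_btw x y A a : geodesic_segment d x y A -> A a -> d x a + d a y = d x y.
Proof.
move=> [c [c0 c1 -> h]] [t]; rewrite /= in_itv /= => t0 <-.
by have [-> ->] := segment_at c0 c1 h t0; rewrite addrCA subrr addr0.
Qed.

Lemma segment_point x y A t : geodesic_segment d x y A -> 0 <= t <= d x y ->
  exists2 a, A a & d x a = t /\ d a y = d x y - t.
Proof.
move=> [c [c0 c1 -> h]] t0; exists (c t); last exact: segment_at.
by exists t => //=; rewrite in_itv.
Qed.

Lemma segment_ends x y A : geodesic_segment d x y A -> A x /\ A y.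
Proof.
move=> [c [c0 c1 -> h]]; have xy := mge0 x y.
by split; [exists 0|exists (d x y)]; rewrite //= in_itv /= xy lexx.
Qed.

Definition gromov_ineq (K : R) : Prop := forall w x y z,
  Num.min (gromov_prod d w x z) (gromov_prod d w z y) <= gromov_prod d w x y + K.

(** For a point [a] on the side from x to y the product [(x|y)_a] vanishes, so the product of z with
    one of them at [a] is at most K. The inequality based at that vertex then compares [a] with the
    point of the corresponding side at the same distance, or [a] is close to z. *)
Lemma gromov_ineq_slim K : gromov_ineq K -> slim_triangles d (4 * K).
Proof.
move=> hK x y z A B C gA gB gC a Aa; have ab := segment_btw gA Aa.
have K0 : 0 <= K.
  have := hK x x x x; rewrite /gromov_prod !mxx addr0 subrr mul0r minxx; lra.
have side u E : geodesic_segment d u z E -> gromov_prod d a u z <= K ->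
    exists2 b, E b & d a b <= 4 * K.
  move=> gE; rewrite /gromov_prod (mC z a) => h.
  have [k|k] := leP (d u a) (d u z).
    have [|b Eb [b1 b2]] := segment_point gE (t := d u a); first by rewrite mge0.
    exists b => //; have := hK u a b z; rewrite /gromov_prod !(mC _ u) (mC z b) b1 b2.
    rewrite ge_min => /orP[]; lra.
  exists z; first exact: (segment_ends gE).2.
  lra.
have := hK a x y z; rewrite {3}/gromov_prod (mC y a) ab subrr mul0r add0r ge_min.
move=> /orP[h|h].
  by have [b Cb hb] := side _ _ gC h; exists b => //; right.
rewrite gromov_prodC in h.
by have [b Bb hb] := side _ _ gB h; exists b => //; left.
Qed.

Hypothesis hyp : hyperbolic d.

(** Walk from x to y: the times spent within e of the side [x, w] have a supremum, and the point 1
    beyond it, or y, must be close to [y, w]. Overshooting by 1 makes it irrelevant whether the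
    supremum is attained. *)
Lemma segment_center : exists K, forall w x y A, geodesic_segment d x y A ->
  exists2 a, A a & d x a + d a w <= d x w + K /\ d y a + d a w <= d y w + K.
Proof.
have [_ geo [e he]] := hyp; exists (2 * (e + 2)) => w x y A gA.
have [B gB] := geo y w; have [C gC] := geo x w.
have e0 : 0 <= e.
  have [A0 gA0] := geo x x; have [x0 _] := segment_ends gA0.
  have [b _ h] := he x x x A0 A0 A0 gA0 gA0 gA0 x x0.
  exact: le_trans (mge0 _ _) h.
have nearw u E a : geodesic_segment d u w E -> (exists2 b, E b & d a b <= e + 2) ->
    d u a + d a w <= d u w + 2 * (e + 2).
  move=> gE [b Eb h]; rewrite -(segment_btw gE Eb).
  by have := mT b u a; have := mT b a w; rewrite (mC b a); lra.
have [c [c0 c1 defA hc]] := gA; have L0 := mge0 x y.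
pose S := [set t | 0 <= t <= d x y /\ exists2 b, C b & d (c t) b <= e].
have S0 : S 0.
  split; first by rewrite lexx.
  by exists x; [exact: (segment_ends gC).1|rewrite c0 mxx].
have supS : has_sup S by split; [exists 0|exists (d x y) => t [/andP[]]].
have sup0 : 0 <= sup S by apply: ub_le_sup => //; exact: supS.2.
have supL : sup S <= d x y by apply: ge_sup; [exists 0|move=> t [/andP[]]].
have [t [/andP[t0 tL] [b Cb tb]] ts] := sup_adherent (ltr01 : 0 < 1 :> R) supS.
pose t' := Num.min (sup S + 1) (d x y).
have t'L : t' <= d x y by rewrite ge_min lexx orbT.
have t'1 : t' <= sup S + 1 by rewrite ge_min lexx.
have tt' : t <= t'.
  rewrite le_min tL andbT; apply: (@le_trans _ _ (sup S)); last by rewrite lerDl.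
  apply: ub_le_sup; [exact: supS.2|split; [by rewrite t0|by exists b]].
have t'0 : 0 <= t' := le_trans t0 tt'.
have At' : A (c t') by rewrite defA; exists t' => //=; rewrite in_itv /= t'0.
exists (c t') => //; split; apply: nearw; [exact: gC| |exact: gB|].
  exists b => //; apply: le_trans (mT (c t) _ _) _; rewrite addrC; apply: lerD => //.
  by rewrite hc ?in_itv /= ?t0 ?t'0// ger0_norm ?subr_ge0//; lra.
have [hl|hl] := leP (d x y) (sup S + 1).
  exists y; first exact: (segment_ends gB).1.
  by rewrite /t' (min_idPr hl) c1 mxx; lra.
have [b' [Bb'|Cb'] hb'] := he x y w A B C gA gB gC _ At'.
  by exists b' => //; lra.
have : t' <= sup S.
  by apply: ub_le_sup; [exact: supS.2|split; [by rewrite t'0|by exists b']].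
by rewrite /t' (min_idPl (ltW hl)); lra.
Qed.

Lemma segment_gromov_prod : exists K, forall w x y A, geodesic_segment d x y A ->
  exists2 a, A a & d w a <= gromov_prod d w x y + K.
Proof.
have [K hK] := segment_center; exists K => w x y A gA.
have [a Aa [h1 h2]] := hK w _ _ _ gA; exists a => //.
by have := segment_btw gA Aa; rewrite /gromov_prod (mC w a) (mC a y); lra.
Qed.

(** A point of [x, y] that nearly realizes [(x|y)_w] is near one of the other two sides, and the
    distance from w to any point of a side is at least the product of its ends. *)
Lemma hyperbolic_gromov_ineq : exists K, gromov_ineq K.
Proof.
have [_ geo [e he]] := hyp; have [K hK] := segment_gromov_prod.
exists (K + e) => w x y z.
have [A gA] := geo x y; have [B gB] := geo y z; have [C gC] := geo x z.
have [a Aa ha] := hK w _ _ _ gA.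
have [b [Bb|Cb] hb] := he _ _ _ _ _ _ gA gB gC _ Aa; rewrite ge_min.
  have := gromov_prod_btw w (segment_btw gB Bb); rewrite gromov_prodC => h.
  by apply/orP; right; have := mT a w b; lra.
have := gromov_prod_btw w (segment_btw gC Cb) => h.
by apply/orP; left; have := mT a w b; lra.
Qed.

Lemma equiv_at_infty_sym x y : equiv_at_infty d x y -> equiv_at_infty d y x.
Proof.
move=> h p M; apply/near2P; have /near2P[N hN] := h p M.
by exists N => i j iN jN; rewrite gromov_prodC; exact: hN.
Qed.

Lemma equiv_at_infty_trans x y z :
  equiv_at_infty d x y -> equiv_at_infty d y z -> equiv_at_infty d x z.
Proof.
move=> xy yz p M; have [K hK] := hyperbolic_gromov_ineq.
have /near2P[N1 h1] := xy p (M + K); have /near2P[N2 h2] := yz p (M + K).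
apply/near2P; exists (maxn N1 N2) => i j.
rewrite !geq_max => /andP[i1 i2] /andP[j1 j2].
have := hK p (x i) (z j) (y (maxn N1 N2)).
have := h1 i (maxn N1 N2) i1 (leq_maxl _ _); have := h2 _ j (leq_maxr N1 N2) j2.
by move=> a b; rewrite ge_min => /orP[]; lra.
Qed.

Lemma equiv_at_infty_base p x y :
  (forall M, exists N, forall i j, (N <= i)%N -> (N <= j)%N ->
     M <= gromov_prod d p (x i) (y j)) -> equiv_at_infty d x y.
Proof.
move=> h q M; apply/near2P; have [N hN] := h (M + d p q).
exists N => i j iN jN; have := hN i j iN jN.
by have := gromov_prod_diff p (x i) (y j) q (x i) (y j); rewrite !mxx; lra.
Qed.

Lemma boundary_val_equiv (xi : boundary d) x y :
  val xi x -> val xi y -> equiv_at_infty d x y.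
Proof.
case: xi => s sP /=; have [z cz zE] := set_mem sP; rewrite zE => -[_ zx] [_ zy].
by apply: equiv_at_infty_trans zy; exact: equiv_at_infty_sym.
Qed.

Lemma boundary_eq (xi eta : boundary d) x y :
  val xi x -> val eta y -> equiv_at_infty d x y -> xi = eta.
Proof.
case: xi eta => [s sP] [t tP] /= sx ty xy; apply: val_inj => /=.
have [z cz zE] := set_mem sP; have [z' cz' zE'] := set_mem tP.
move: sx ty; rewrite zE zE' => -[_ zx] [_ z'y].
have zz' : equiv_at_infty d z z'.
  apply: equiv_at_infty_trans (equiv_at_infty_sym z'y).
  exact: equiv_at_infty_trans zx xy.
apply/seteqP; split=> w [cw zw]; split=> //.
  by apply: equiv_at_infty_trans zw; exact: equiv_at_infty_sym.
exact: equiv_at_infty_trans zz' zw.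
Qed.

Lemma boundary_of (x : nat -> T) : cvg_to_infty d x -> exists xi : boundary d, val xi x.
Proof.
move=> cx; have h : boundary_class d [set y | cvg_to_infty d y /\ equiv_at_infty d x y].
  by exists x.
by exists (exist (fun s => s \in (boundary_class d : set (set (nat -> T)))) _ (mem_set h)).
Qed.

End RealMetric.

(** * Mitra's criterion in terms of Gromov products, and boundary maps *)

Section GromovProper.
Local Open Scope classical_set_scope.
Local Open Scope ring_scope.
Variables (R : realType) (Y X : Type) (dY : Y -> Y -> R) (dX : X -> X -> R).
Variable f : Y -> X.
Hypotheses (mY : pseudo_metric dY) (mX : pseudo_metric dX).

(* A form of Mitra's criterion that does not mention geodesics. *)
Definition gromov_proper : Prop := forall y0 M, exists N, forall x y,
  N <= gromov_prod dY y0 x y -> M <= gromov_prod dX (f y0) (f x) (f y).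

(** The distance to a geodesic is at least the product of its ends, so a large product keeps
    geodesics of Y out of a ball; in X it is at most the product plus K, which turns the conclusion
    of the criterion back into products. *)
Lemma mitra_gromov_proper : hyperbolic dX -> hyperbolic dY -> mitra_criterion dY dX f ->
  gromov_proper.
Proof.
move=> hX hY mi y0 M; have [K hK] := segment_gromov_prod mX hX.
have [m [m0 mc hm]] := mi y0.
have [N [Nr hN]] : exists N, N \is Num.real /\ forall t, N < t -> M + K <= m t.
  by have /cvgryPge /(_ (M + K)) [N [Nr hN]] := mc; exists N; split.
exists (N + 1) => x y xy.
have [_ geoY _] := hY; have [_ geoX _] := hX.
have [A gA] := geoY x y; have [B gB] := geoX (f x) (f y).
have [b Bb hb] := hK (f y0) _ _ _ gB.
have AN a : A a -> ~ dY y0 a < N + 1.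
  move=> Aa; apply/negP; rewrite -leNgt; apply: le_trans xy _.
  exact: gromov_prod_btw mY _ _ _ _ (segment_btw mY gA Aa).
have /negP := hm _ _ _ _ _ gA AN gB _ Bb; rewrite -leNgt => h.
by have := hN (N + 1); rewrite ltrDl ltr01 => /(_ isT); lra.
Qed.

Lemma gromov_proper_of_base y0 :
  (forall M, exists N, forall x y, N <= gromov_prod dY y0 x y ->
     M <= gromov_prod dX (f y0) (f x) (f y)) -> gromov_proper.
Proof.
move=> h y1 M; have [N hN] := h (M + dX (f y0) (f y1)).
exists (N + dY y1 y0) => x y xy.
have := gromov_prod_diff mX (f y0) (f x) (f y) (f y1) (f x) (f y).
have := hN x y; have := gromov_prod_diff mY y1 x y y0 x y.
rewrite !(pm0 mX) !(pm0 mY) !addr0 => h1 h2 h3.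
have : M + dX (f y0) (f y1) <= gromov_prod dX (f y0) (f x) (f y) by apply: h2; lra.
by lra.
Qed.

Hypothesis gf : gromov_proper.

Lemma gromov_proper_equiv (y0 : Y) x y :
  equiv_at_infty dY x y -> equiv_at_infty dX (f \o x) (f \o y).
Proof.
move=> xy; apply: (equiv_at_infty_base mX (p := f y0)) => M.
have [N hN] := gf y0 M; have /near2P[n hn] := xy y0 N.
by exists n => i j ni nj; apply: hN; exact: hn.
Qed.

Theorem gromov_proper_CT (y0 : Y) : exists g, is_CT_map dY dX f g.
Proof.
have rep (xi : boundary dY) : exists z : boundary dX, forall y, val xi y -> val z (f \o y).
  case: xi => s sP; have [x cx xE] := set_mem sP.
  have cfx : cvg_to_infty dX (f \o x) by exact: gromov_proper_equiv.
  have h : boundary_class dX [set y | cvg_to_infty dX y /\ equiv_at_infty dX (f \o x) y].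
    by exists (f \o x).
  exists (exist (fun s => s \in (boundary_class dX : set (set (nat -> X)))) _ (mem_set h)).
  move=> y /=; rewrite xE => -[cy xy].
  by split; exact: gromov_proper_equiv.
have [g hg] := choice rep; exists g; split=> //.
apply/continuousP => A; rewrite !boundary_openE => oA p xi Axi.
have [r hr] := oA (f p) _ Axi; have [N hN] := gf p r.
(* A neighbourhood bounds the products only by every r' below its radius; the 1 leaves room for the
   value N. *)
exists (N + 1) => eta [x [y [xix ey h]]]; apply: hr.
exists (f \o x), (f \o y); split; [exact: hg|exact: hg|move=> r' rr'].
apply/near2P; have [|n hn] := (near2P _).1 (h N _); first by rewrite ltrDl ltr01.
exists n => i j ni nj; apply: le_trans (ltW rr') _; apply: hN; exact: hn.
Qed.

End GromovProper.

(** * Discrete hyperbolic geometry *)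

Section Discrete.
Local Open Scope nat_scope.
Variables (X : Type) (d : X -> X -> nat).

Definition nat_metric : Prop :=
  [/\ forall x, d x x = 0, forall x y, d x y = 0 -> x = y,
      forall x y, d x y = d y x & forall x y z, d x z <= d x y + d y z].

Definition interpolates : Prop :=
  forall x y k, k <= d x y -> exists2 z, d x z = k & d z y = d x y - k.

(** Gromov's inequality doubled, so that no halves occur and natural numbers suffice. *)
Definition four_point (c : nat) : Prop := forall x y z w,
  d x y + d z w <= maxn (d x z + d y w) (d x w + d y z) + c.

Record geo_graph : Prop := GeoGraph { geo_metric : nat_metric; geo_interp : interpolates }.

Record hyp_graph (c : nat) : Prop := HypGraph {
  hyp_geo :> geo_graph; hyp_four : four_point c }.

(** In a geodesic graph this is the union of all geodesics from x to y. *)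
Definition btw (x y p : X) : Prop := d x p + d p y = d x y.

End Discrete.

Section GeoGraph.
Local Open Scope nat_scope.
Variables (X : Type) (d : X -> X -> nat).
Hypothesis H : geo_graph d.
Local Notation I := (btw d).

Lemma geod0 x : d x x = 0. Proof. by case: H => -[]. Qed.
Lemma geod_eq x y : d x y = 0 -> x = y. Proof. by case: H => -[]; auto. Qed.
Lemma geodC x y : d x y = d y x. Proof. by case: H => -[]. Qed.
Lemma geodT y x z : d x z <= d x y + d y z. Proof. by case: H => -[]. Qed.
Lemma geodI x y k : k <= d x y -> exists2 z, d x z = k & d z y = d x y - k.
Proof. by case: H => _ h; exact: h. Qed.

Lemma btwC x y p : I x y p -> I y x p.
Proof. by rewrite /btw (geodC y p) (geodC p x) (geodC y x); lia. Qed.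
Lemma btw_l x y : I x y x. Proof. by rewrite /btw geod0. Qed.
Lemma btw_r x y : I x y y. Proof. by rewrite /btw geod0 addn0. Qed.
Lemma btw_xx x p : I x x p -> p = x.
Proof. by rewrite /btw geod0 => h; apply: geod_eq; lia. Qed.

Lemma btw_sub x y u p : I x y u -> I x u p -> I x y p.
Proof.
by rewrite /btw => h1 h2; have := geodT p x y; have := geodT u p y; lia.
Qed.
Lemma btw_subr x y u p : I x y u -> I u y p -> I x y p.
Proof.
by rewrite /btw => h1 h2; have := geodT p x y; have := geodT u x p; lia.
Qed.
Lemma btw_mid x y p u v : I x y p -> I x p u -> I p y v -> I u v p.
Proof.
rewrite /btw => h1 h2 h3.
by have := geodT p u v; have := geodT u x y; have := geodT v u y; lia.
Qed.
Lemma btw_span x y p u v q : I x y p -> I x p u -> I p y v -> I u v q -> I x y q.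
Proof.
rewrite /btw => h1 h2 h3 h4.
have := geodT q x y; have := geodT u x q; have := geodT v q y.
by have := geodT p u v; lia.
Qed.

Lemma btw_step x y : x <> y -> exists2 y', I x y y' & d y' y = 1.
Proof.
move=> xy; have h : 0 < d x y by rewrite lt0n; apply/eqP => /geod_eq.
have [|y' h1 h2] := @geodI x y (d x y).-1; first by lia.
by exists y'; rewrite /btw; lia.
Qed.

Lemma btw_ind (P : X -> Prop) x :
  P x -> (forall y y', I x y y' -> d y' y = 1 -> P y' -> P y) -> forall y, P y.
Proof.
move=> Px step y; have [n] := ubnP (d x y); elim: n y => // n IH y ny.
case: (pselect (x = y)) => [<-//|/btw_step[y' h1 h2]].
by apply: (step y y') => //; apply: IH; rewrite /btw in h1; lia.
Qed.

(** A discrete intermediate value theorem along a geodesic. *)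
Lemma btw_jump (P : X -> Prop) x y : P x -> ~ P y ->
  exists p p', [/\ I x y p, I x y p', d p p' = 1, P p & ~ P p'].
Proof.
move=> Px; move: y; apply: (btw_ind (x := x) (P := fun y => ~ P y ->
  exists p p', [/\ I x y p, I x y p', d p p' = 1, P p & ~ P p'])) => //.
move=> y y' h1 h2 IH nPy.
case: (pselect (P y')) => [Py'|/IH[p [p' [i1 i2 i3 i4 i5]]]].
  by exists y', y; split => //; exact: btw_r.
by exists p, p'; split => //; apply: btw_sub h1 _.
Qed.

Lemma geo_fun x y : exists z : nat -> X, [/\ z 0 = x, z (d x y) = y &
  forall i j, i <= j <= d x y -> d (z i) (z j) = j - i].
Proof.
move: y; apply: (btw_ind (x := x) (P := fun y => exists z : nat -> X,
  [/\ z 0 = x, z (d x y) = y &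
  forall i j, i <= j <= d x y -> d (z i) (z j) = j - i])).
  by exists (fun=> x); split => // i j; rewrite geod0 => /andP[]; lia.
move=> y y' h1 h2 [z [z0 zn zd]].
have hn : d x y = (d x y').+1 by rewrite /btw in h1; lia.
exists (fun i => if i <= d x y' then z i else y); split=> //.
- by rewrite hn ltnn.
- move=> i j; rewrite hn => /andP[ij]; rewrite leq_eqVlt => /predU1P[jn|jn].
    rewrite jn ltnn; move: ij; rewrite jn leq_eqVlt => /predU1P[->|].
      by rewrite ltnn geod0 subnn.
    rewrite ltnS => ii; rewrite ii.
    have := zd i (d x y'); rewrite ii leqnn zn => /(_ isT) e1.
    have := zd 0 i; rewrite ii z0 => /(_ isT) e2.
    by have := geodT y' (z i) y; have := geodT (z i) x y; lia.
  by rewrite ltnS in jn; rewrite jn (leq_trans ij jn); apply: zd; rewrite ij.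
Qed.

Lemma geo_fun_btw x y z : z 0 = x -> z (d x y) = y ->
  (forall i j, i <= j <= d x y -> d (z i) (z j) = j - i) ->
  forall i, i <= d x y -> I x y (z i).
Proof.
move=> z0 zn zd i id; have := zd 0 i; have := zd i (d x y).
by rewrite /btw z0 zn leqnn id => /(_ isT) -> /(_ isT) ->; lia.
Qed.

End GeoGraph.

Section Hyp.
Local Open Scope nat_scope.
Variables (X : Type) (d : X -> X -> nat) (c : nat).
Hypothesis H : hyp_graph d c.
Local Notation I := (btw d).
Let geod0 := geod0 H.
Let geodC := geodC H.
Let geodT := geodT H.
Let geodI := geodI H.
Let btw_r := btw_r H.

Lemma hypd4 x y z w : d x y + d z w <= maxn (d x z + d y w) (d x w + d y z) + c.
Proof. by case: H. Qed.
(** The point of the interval at distance [d x m] from x works, by the four-point condition for it,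
    m, x and y; if m is farther from x than y is, then y itself is close. *)
Lemma btw_near x y m e : d x m + d m y <= d x y + e ->
  exists2 m', I x y m' & d m m' <= e + c.
Proof.
move=> h; have [k|k] := leqP (d x m) (d x y).
  have [m' m1 m2] := geodI k; exists m'; first by rewrite /btw; lia.
  by have := hypd4 m m' x y; rewrite (geodC m x) (geodC m' x); lia.
by exists y; [exact: btw_r|lia].
Qed.

(** The four-point condition for p, z, x, y puts p between x and z or between z and y up to an error
    c; [btw_near] costs another c. *)
Lemma btw_thin x y z p : I x y p ->
  (exists2 q, I x z q & d p q <= c + c) \/ (exists2 q, I z y q & d p q <= c + c).
Proof.
rewrite /btw => h; have := hypd4 p z x y; rewrite (geodC p x).
case: (leqP (d x p + d z y) (d p y + d z x)) => h1 h2.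
- left; apply: btw_near; rewrite (geodC x z); lia.
- right; apply: btw_near; rewrite (geodC z p); lia.
Qed.

Lemma btw_center x y z : exists m,
  [/\ I x y m, exists2 q, I x z q & d m q <= c + c + 2
     & exists2 q, I y z q & d m q <= c + c + 2].
Proof.
have t1 := geodT y x z; have t2 := geodT x y z; have t3 := geodT z x y.
rewrite (geodC y x) in t2; rewrite (geodC z y) in t3.
(* k is the Gromov product of y and z at x, rounded down; the 2 in the bounds pays for the
   rounding. *)
have := odd_double_half (d x y + d x z - d y z); set k := _./2; set b := odd _.
have b1 : b <= 1 by case: b.
rewrite -muln2 => hk.
have kk : k <= d x y by lia.
have [m m1 m2] := geodI kk; exists m; split; first by rewrite /btw; lia.
- have [|q q1 q2] := @btw_near x z m (c + 2); last by exists q => //; lia.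
  by have := hypd4 m z x y; rewrite (geodC m x) (geodC z y) (geodC z x); lia.
- have [|q q1 q2] := @btw_near y z m (c + 2); last by exists q => //; lia.
  by have := hypd4 m z x y; rewrite (geodC m x) (geodC z y) (geodC z x) (geodC y m); lia.
Qed.

End Hyp.

(** * Stability of quasigeodesics *)

Section Exponential.
Local Open Scope nat_scope.

Lemma expn_dominates a b : exists m0, forall m, m0 <= m -> a * m + b <= 2 ^ m.
Proof.
exists (4 * (a + b) + 1) => m hm.
have h : (m./2).+1 * (m - m./2).+1 <= 2 ^ m.
  have e : m./2 + (m - m./2) = m by have := odd_double_half m; lia.
  by rewrite -[X in _ <= 2 ^ X]e expnD; apply: leq_mul; exact: ltn_expl.
apply: leq_trans h.
have : m <= (m./2).*2.+1 by have := odd_double_half m; case: odd; lia.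
have : m./2 <= m - m./2 by have := odd_double_half m; case: odd; lia.
rewrite -muln2; move: (m./2) (m - m./2) => q q' qq' hq.
have h1 : (a * m + b) * 4 <= m * m by nia.
by have h2 : m * m <= (q.+1 * 2) * (q'.+1 * 2); [apply: leq_mul|]; lia.
Qed.

(** Serves to choose the depth k of a bisection: with k about [D / (2 * e + 2)] the linear cost
    [e * k + h] stays below D while [2 ^ k] beats any linear function of D. *)
Lemma expn_dominates_div a b e h : exists C0, forall D, C0 <= D ->
  exists2 k, a * D + b <= 2 ^ k & e * k + h < D.
Proof.
have [m0 hm] := expn_dominates (a * (2 * e + 2)) (a * (2 * e + 2) + b).
exists ((m0 + h + 1) * (2 * e + 2)) => D hD.
have M0 : 0 < 2 * e + 2 by lia.
have k1 : m0 + h + 1 <= D %/ (2 * e + 2) by rewrite leq_divRL.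
have k2 := ltn_ceil D M0; have k3 := leq_divM D (2 * e + 2).
move: (D %/ _) k1 k2 k3 => k k1 k2 k3; exists k; last first.
  have : (e * k) <= k * (2 * e) by rewrite mulnC leq_mul2l; lia.
  by rewrite mulnDr in k3; lia.
apply: leq_trans (hm k _); last by lia.
have : a * D <= a * (k.+1 * (2 * e + 2)) by rewrite leq_mul2l ltnW ?orbT.
by rewrite [k.+1 * _]mulnC mulnA mulnS; lia.
Qed.

End Exponential.

Section RPath.
Local Open Scope nat_scope.
Variables (R : realType) (X : Type) (rho : X -> X -> R).

Inductive rpath (P : X -> Prop) (r : nat) (x : X) : nat -> X -> Prop :=
| rpath0 : P x -> rpath P r x 0 x
| rpathS n y z : rpath P r x n y -> (rho y z <= r%:R)%R -> P z ->
    rpath P r x n.+1 z.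

Variables (P : X -> Prop) (r : nat).

Lemma rpath_cat x n y m z : rpath P r x n y -> rpath P r y m z ->
  rpath P r x (n + m) z.
Proof.
move=> p1; elim=> [_|{}m w t _ IH h Pt]; first by rewrite addn0.
by rewrite addnS; apply: rpathS IH h Pt.
Qed.

Lemma rpath_end x n y : rpath P r x n y -> P y.
Proof. by case. Qed.

Lemma rpath_rev : pseudo_metric rho -> forall x n y, rpath P r x n y -> rpath P r y n x.
Proof.
move=> hp x n y; elim=> [?|{}n {}y z p IH h Pz]; first exact: rpath0.
rewrite -add1n; apply: rpath_cat IH; apply: (rpathS (y := z)).
- exact: rpath0.
- by rewrite (pmC hp).
- exact: rpath_end p.
Qed.

Lemma rpath_split x n y m : rpath P r x n y -> m <= n ->
  exists2 w, rpath P r x m w & rpath P r w (n - m) y.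
Proof.
elim=> [Px|{}n {}y z p IH h Pz].
  by rewrite leqn0 => /eqP ->; exists x; exact: rpath0.
rewrite leq_eqVlt ltnS => /predU1P[->|mn].
  by exists z; [exact: rpathS h Pz|rewrite subnn; exact: rpath0].
have [w w1 w2] := IH mn; exists w => //.
by rewrite subSn//; apply: rpathS w2 h Pz.
Qed.

Lemma rpath_fun n (z : nat -> X) :
  (forall i, i < n -> (rho (z i) (z i.+1) <= r%:R)%R) ->
  (forall i, i <= n -> P (z i)) ->
  forall i j, i <= j <= n -> rpath P r (z i) (j - i) (z j).
Proof.
move=> hz hP i; elim=> [|j IH] /andP[ij jn].
  by move: ij; rewrite leqn0 => /eqP ->; apply: rpath0; exact: hP.
move: ij; rewrite leq_eqVlt ltnS => /predU1P[->|ij].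
  by rewrite subnn; apply: rpath0; exact: hP.
rewrite subSn//; apply: rpathS (IH _) (hz _ _) (hP _ _) => //.
by rewrite ij ltnW.
Qed.

End RPath.

Section Model.
Variables (R : realType) (X : Type) (d : X -> X -> nat) (rho : X -> X -> R).
Local Open Scope ring_scope.

(** What the stability argument asks of a second distance. It may collapse sets that are unbounded
    for d, as the development collapses cosets of local groups; [mod_btw] takes the place of a lower
    bound of rho by d. *)
Record model : Prop := Model {
  mod_pm : pseudo_metric rho;
  mod_lip : exists A : nat, forall x y, rho x y <= A%:R * (d x y)%:R;
  mod_btw : forall r : nat, exists h : nat, forall x y p,
    rho x y <= r%:R -> btw d x y p -> rho x p <= h%:R;
  mod_geo : exists C : nat, forall x y, exists n (z : nat -> X),
    [/\ z 0%N = x, z n = y &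
    forall i j, (i <= j <= n)%N -> `|rho (z i) (z j) - (j - i)%:R| <= C%:R] }.

Definition quasi_geodesic (A n : nat) (z : nat -> X) : Prop :=
  (forall i, (i < n)%N -> rho (z i) (z i.+1) <= A%:R) /\
  forall i j, (i <= j <= n)%N -> (j - i)%:R <= A%:R * rho (z i) (z j) + A%:R.

End Model.

Section Stability.
Variables (R : realType) (X : Type) (d : X -> X -> nat) (c : nat).
Variables (rho : X -> X -> R).
Hypothesis H : hyp_graph d c.
Hypothesis M : model d rho.
Local Notation I := (btw d).
Local Open Scope ring_scope.

Let rT := pmT (mod_pm M).
Let rC := pmC (mod_pm M).
Let r0 := pm0 (mod_pm M).
Let r_ge0 := pm_ge0 (mod_pm M).

(** Bisection: thinness moves p to the interval of one half of the path at a cost of [c + c] in d,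
    hence [L * (c + c)] in rho. After k halvings at most one jump is left, and the bound h for
    rho-close ends applies. This is the logarithmic estimate of the Morse lemma, with jumps measured
    by rho and thinness by d. *)
Lemma rpath_btw (L r h : nat) (P : X -> Prop) :
  (forall x y, rho x y <= L%:R * (d x y)%:R) ->
  (forall x y p, rho x y <= r%:R -> I x y p -> rho x p <= h%:R) ->
  forall k n x y p, rpath rho P r x n y -> (n <= 2 ^ k)%N -> I x y p ->
  exists2 w, P w & rho p w <= (L * (c + c) * k + h)%:R.
Proof.
move=> hL hh; elim=> [|k IH] n x y p.
  case => [Px _ /(btw_xx H) ->|{}n {}y z p' xy Pz].
    by exists x => //; rewrite r0.
  rewrite expn0 ltnS leqn0 => /eqP n0; move: p' xy; rewrite n0 => p'.
  inversion p'; subst => xy xz; exists y => //.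
  by rewrite muln0 add0n rC; apply: hh xy xz.
move=> hp hn xyp.
have [|w w1 w2] := @rpath_split _ _ _ P r x n y (minn n (2 ^ k)) hp; first by rewrite geq_minl.
have n1 : (minn n (2 ^ k) <= 2 ^ k)%N by rewrite geq_minr.
have n2 : (n - minn n (2 ^ k) <= 2 ^ k)%N by rewrite expnS in hn; lia.
have key q : (d p q <= c + c)%N -> (exists2 w, P w & rho q w <= (L * (c + c) * k + h)%:R) ->
    exists2 w, P w & rho p w <= (L * (c + c) * k.+1 + h)%:R.
  move=> pq [t Pt qt]; exists t => //; apply: le_trans (rT q _ _) _.
  rewrite mulnS -addnA natrD; apply: lerD => //; apply: le_trans (hL _ _) _.
  by rewrite natrM ler_wpM2l// ler_nat.
case: (btw_thin H w xyp) => -[q q1 q2]; apply: key q2 _.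
- exact: IH w1 n1 q1.
- exact: IH w2 n2 q1.
Qed.

(** Walking from p towards w, stop as soon as the rho-distance exceeds T; the last step adds at most
    L. *)
Lemma btw_stop (L T : nat) p w : (forall x y, rho x y <= L%:R * (d x y)%:R) ->
  exists u, [/\ I p w u, rho p u <= (T + L)%:R & u = w \/ T%:R < rho p u].
Proof.
move=> hL; move: w; apply: (btw_ind H (x := p) (P := fun w =>
  exists u, [/\ I p w u, rho p u <= (T + L)%:R & u = w \/ T%:R < rho p u])).
  exists p; split; [exact: (btw_l H)|by rewrite r0|by left].
move=> y y' h1 h2 [u [u1 u2 u3]].
have [uT|uT] := ltP T%:R (rho p u).
  by exists u; split => //; [exact: (btw_sub H h1)|right].
case: u3 => u3; last by rewrite ltNge uT in u3.
subst u; exists y; split; [exact: (btw_r H)| |by left].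
apply: le_trans (rT y' _ _) _; rewrite natrD; apply: lerD => //.
by apply: le_trans (hL _ _) _; rewrite h2 mulr1.
Qed.

Lemma rough_rpath (C r : nat) P x y n (z : nat -> X) : z 0%N = x -> z n = y ->
  (forall i j, (i <= j <= n)%N -> `|rho (z i) (z j) - (j - i)%:R| <= C%:R) ->
  (C.+1 <= r)%N ->
  (forall w, rho x w <= rho x y + (3 * C)%:R -> P w) -> rpath rho P r x n y.
Proof.
move=> <- <- hz rC' hP.
suff h : (forall i, (i < n)%N -> rho (z i) (z i.+1) <= r%:R) /\
    (forall i, (i <= n)%N -> P (z i)).
  by have := rpath_fun h.1 h.2 (i := 0%N) (j := n); rewrite subn0 leqnn; apply.
split.
- move=> i ni; have := hz i i.+1; rewrite leqnSn ni => /(_ isT).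
  rewrite subSnn ler_distl => /andP[_ h]; apply: le_trans h _.
  by rewrite -natrD ler_nat addnC addn1.
- move=> i ni; apply: hP; have := hz 0%N i; have := hz i n; have := hz 0%N n.
  rewrite !leqnn ni !leq0n /= !ler_distl => /(_ isT) /andP[a1 a2] /(_ isT) /andP[b1 b2].
  move=> /(_ isT) /andP[c1 c2]; move: a1 a2 b1 b2 c1 c2 (r_ge0 (z i) (z n)).
  rewrite !subn0 natrB// natrM; lra.
Qed.

(* For p in the interval take u and v on its two sides at rho-distance about 2 D from p.
   The path that goes from u to z, along z and then to v stays far from p outside z, and by
   [rpath_btw] it comes logarithmically close to p. *)
Lemma stability_step (A L r h Cg D k n : nat) (z : nat -> X) :
  (forall x y, rho x y <= L%:R * (d x y)%:R) ->
  (forall x y p, rho x y <= r%:R -> I x y p -> rho x p <= h%:R) ->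
  (forall x y, exists n (z : nat -> X), [/\ z 0%N = x, z n = y &
    forall i j, (i <= j <= n)%N -> `|rho (z i) (z j) - (j - i)%:R| <= Cg%:R]) ->
  (Cg.+1 <= r)%N -> (A <= r)%N -> quasi_geodesic rho A n z ->
  (forall p, I (z 0%N) (z n) p -> exists2 i, (i <= n)%N & rho p (z i) <= D%:R) ->
  (2 * (D + Cg) + A * (6 * D + 2 * L) + A <= 2 ^ k)%N ->
  (L * (c + c) * k + h + 3 * Cg < D)%N ->
  forall p, I (z 0%N) (z n) p ->
    exists2 i, (i <= n)%N & rho p (z i) <= (L * (c + c) * k + h)%:R.
Proof.
move=> hL hh hg rg rA [z1 z2] hD hk hkD p hp.
(* The region of the path: far from p, or on z. By the choice of k, only a point on z can be as
   close to p as [rpath_btw] promises. *)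
pose P w := (D - 3 * Cg)%:R <= rho p w \/ exists2 i, (i <= n)%N & w = z i.
(* A rough rho-geodesic from u to the nearby point of z stays within [D + 3 * Cg] of u, and u is
   more than [2 * D] away from p. *)
have conn u : I (z 0%N) (z n) u -> (2 * D)%:R < rho p u ->
    exists i m, [/\ (i <= n)%N, rho u (z i) <= D%:R, rpath rho P r u m (z i) &
      (m <= D + Cg)%N].
  move=> /hD[i ni ui] pu; have [m [t [t0 tm ht]]] := hg u (z i).
  exists i, m; split=> //.
    apply: rough_rpath t0 tm ht rg _ => w uw; left.
    have := rT w p u; rewrite (rC w u) natrB; last by lia.
    rewrite !natrM in pu uw *; lra.
  have := ht 0%N m; rewrite leqnn leq0n t0 tm subn0 ler_distl => /(_ isT) /andP[b1 b2].
  rewrite -(ler_nat R) natrD; lra.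
(* If the walk reaches an end of z before getting [2 * D] away from p, then u is on z and the
   connecting path is trivial. *)
have conn' w : w = z 0%N \/ w = z n -> exists u i m,
    [/\ I p w u, rho p u <= (2 * D + L)%:R, rho u (z i) <= D%:R &
    [/\ (i <= n)%N, rpath rho P r u m (z i) & (m <= D + Cg)%N]].
  move=> hw; have [u [u1 u2 u3]] := @btw_stop L (2 * D) p w hL.
  have uI : I (z 0%N) (z n) u.
    case: hw => hw; rewrite hw in u1.
      by apply: (btw_sub H hp); exact: (btwC H).
    exact: (btw_subr H hp).
  case: u3 => [uw|/(conn _ uI)[i [m [i1 i2 i3 i4]]]]; last by exists u, i, m.
  have [i ni zi] : exists2 i, (i <= n)%N & u = z i.
    by rewrite uw; case: hw => ->; [exists 0%N|exists n].
  exists u, i, 0%N; split=> //; first by rewrite zi r0.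
  by split => //; rewrite -zi; apply: rpath0; right; exists i.
have [u [i [m [u1 u2 u3 [i1 i2 i3]]]]] := conn' _ (or_introl erefl).
have [v [j [m' [v1 v2 v3 [j1 j2 j3]]]]] := conn' _ (or_intror erefl).
have uvp : I u v p by apply: (btw_mid H hp) => //; exact: (btwC H).
have zz : forall i j, (i <= n)%N -> (j <= n)%N -> rho (z i) (z j) <= (6 * D + 2 * L)%:R ->
    exists2 l, rpath rho P r (z i) l (z j) & (l <= A * (6 * D + 2 * L) + A)%N.
  move=> {i1 i2 j1 j2 u3 v3}i {}j; wlog ij : i j / (i <= j)%N.
    move=> IH ni nj h1; have [ij|ij] := leqP i j; first exact: IH.
    have [|l l1 l2] := IH j i (ltnW ij) nj ni; first by rewrite rC.
    by exists l => //; apply: rpath_rev l1; exact: mod_pm M.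
  move=> _ nj h1; exists (j - i)%N.
    apply: (rpath_fun (n := n)) => [l ln|l ln|]; last by rewrite ij nj.
      by apply: le_trans (z1 _ ln) _; rewrite ler_nat.
    by right; exists l.
  have := z2 i j; rewrite ij nj => /(_ isT); rewrite -(ler_nat R) natrD natrM => h2.
  apply: le_trans h2 _; rewrite lerD2r ler_wpM2l//.
have [|l l1 l2] := zz i j i1 j1.
  have := rT u (z i) (z j); have := rT p u (z j); have := rT v p (z j).
  rewrite (rC (z i) u) (rC u p); rewrite natrD natrM in u2; rewrite natrD natrM in v2.
  by rewrite natrD !natrM; lra.
have uv := rpath_cat i2 (rpath_cat l1 (rpath_rev (mod_pm M) j2)).
have [|w Pw w1] := rpath_btw hL hh (k := k) uv _ uvp.
  by apply: leq_trans hk; lia.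
case: Pw => [w2|[q q1 q2]]; last by exists q => //; rewrite -q2.
suff : (D - 3 * Cg)%:R <= (L * (c + c) * k + h)%:R :> R by rewrite ler_nat; lia.
exact: le_trans w2 w1.
Qed.

(** A descent on the constant: the bound [L * d (z 0) (z n)] holds trivially, and [stability_step]
    lowers every bound above a threshold C0 that does not depend on z. For the converse, two
    adjacent points of the interval are close to z at parameters before and after k respectively;
    the quasi-geodesic inequality bounds the gap between these parameters. *)
Theorem stability (A : nat) : exists C : nat, forall n z,
  quasi_geodesic rho A n z ->
  (forall p, I (z 0%N) (z n) p -> exists2 i, (i <= n)%N & rho p (z i) <= C%:R) /\
  (forall i, (i <= n)%N -> exists2 p, I (z 0%N) (z n) p & rho (z i) p <= C%:R).
Proof.
have [L hL] := mod_lip M; have [Cg hg] := mod_geo M.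
have [h hh] := mod_btw M (A + Cg.+1).
have [C0 hC0] := expn_dominates_div (2 + A * 6) (2 * Cg + A * (2 * L) + A)
  (L * (c + c)) (h + 3 * Cg).
have fwd n z : quasi_geodesic rho A n z ->
    forall p, I (z 0%N) (z n) p -> exists2 i, (i <= n)%N & rho p (z i) <= C0%:R.
  move=> qz; suff key D : (forall p, I (z 0%N) (z n) p ->
      exists2 i, (i <= n)%N & rho p (z i) <= D%:R) ->
      forall p, I (z 0%N) (z n) p -> exists2 i, (i <= n)%N & rho p (z i) <= C0%:R.
    apply: (key (L * d (z 0%N) (z n))%N) => p Ip; exists 0%N => //.
    rewrite rC; apply: le_trans (hL _ _) _.
    by rewrite -natrM ler_nat leq_mul2l; rewrite /btw in Ip; apply/orP; right; lia.
  elim: D => [|D IH] hD.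
    move=> p /hD[i ni pi]; exists i => //; apply: le_trans pi _; exact: ler0n.
  have [DC|DC] := leqP D.+1 C0.
    by move=> p /hD[i ni pi]; exists i => //; apply: le_trans pi _; rewrite ler_nat.
  have [k k1 k2] := hC0 D.+1 (ltnW DC); apply: IH => p Ip.
  have r1 : (Cg.+1 <= A + Cg.+1)%N by rewrite leq_addl.
  have r2 : (A <= A + Cg.+1)%N by rewrite leq_addr.
  have k3 : (2 * (D.+1 + Cg) + A * (6 * D.+1 + 2 * L) + A <= 2 ^ k)%N.
    by apply: leq_trans k1; rewrite !mulnDr !mulnDl !mulnA; lia.
  have k4 : (L * (c + c) * k + h + 3 * Cg < D.+1)%N by rewrite -addnA.
  have [i ni pi] := stability_step hL hh hg r1 r2 qz hD k3 k4 Ip.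
  by exists i => //; apply: le_trans pi _; rewrite ler_nat; lia.
exists (C0 + (A * (A * (2 * C0 + L) + A)))%N => n z qz; split.
  move=> p /(fwd _ _ qz)[i ni pi]; exists i => //; apply: le_trans pi _.
  by rewrite ler_nat leq_addr.
move=> k kn; have [z1 z2] := qz.
have near i j : (i <= k <= j)%N -> (j <= n)%N -> rho (z i) (z j) <= (2 * C0 + L)%:R ->
    rho (z k) (z i) <= (A * (A * (2 * C0 + L) + A))%:R.
  move=> /andP[ik kj] jn h1; rewrite rC.
  have h2 : (j - i <= A * (2 * C0 + L) + A)%N.
    have := z2 i j; rewrite (leq_trans ik kj) jn => /(_ isT) h2.
    rewrite -(ler_nat R) natrD natrM; apply: le_trans h2 _.
    by rewrite lerD2r ler_wpM2l.
  have h3 : rho (z i) (z k) <= (A * (k - i))%:R.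
    elim: {h1 h2 kj jn} k ik kn => [|k IH] ik kn.
      by move: ik; rewrite leqn0 => /eqP ->; rewrite r0.
    move: ik; rewrite leq_eqVlt ltnS => /predU1P[<-|ik]; first by rewrite subnn muln0 r0.
    rewrite subSn// mulnS addnC natrD; apply: le_trans (rT (z k) _ _) _.
    by apply: lerD (z1 _ kn); apply: IH => //; exact: ltnW.
  by apply: le_trans h3 _; rewrite ler_nat leq_mul2l; apply/orP; right; lia.
pose Q p := exists2 i, (i <= k)%N & rho p (z i) <= C0%:R.
have Q0 : Q (z 0%N) by exists 0%N => //; rewrite r0 ler0n.
case: (pselect (Q (z n))) => [[i ik zi]|nQ].
  exists (z n); first exact: (btw_r H).
  apply: le_trans (rT (z i) _ _) _; rewrite addrC natrD (rC (z i)); apply: lerD => //.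
  apply: (near i n); rewrite ?ik ?kn// (rC (z i)); apply: le_trans zi _.
  by rewrite ler_nat; lia.
have [p [p' [h1 h2 h3 [i ik zi] h5]]] := btw_jump H Q0 nQ.
have [j jn zj] := fwd _ _ qz _ h2.
have kj : (k <= j)%N by rewrite leqNgt; apply/negP => jk; apply: h5; exists j => //; exact: ltnW.
exists p => //; apply: le_trans (rT (z i) _ _) _; rewrite addrC natrD (rC (z i)).
apply: lerD => //; apply: (near i j); rewrite ?ik//.
have := rT p (z i) (z j); have := rT p' p (z j); have := hL p p'.
rewrite h3 mulr1 (rC (z i) p) natrD natrM; lra.
Qed.

(** A rough rho-geodesic is a quasi-geodesic of rho, so every point of the d-interval with the same
    ends is rho-close to it, and along it rho is nearly additive. *)
Theorem alignment : exists C : nat, forall x y p, I x y p ->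
  rho x p + rho p y <= rho x y + C%:R.
Proof.
have [Cg hg] := mod_geo M; have [C hC] := stability (Cg + Cg.+1).
exists (2 * C + 3 * Cg)%N => x y p xyp.
have [n [z [z0 zn hz]]] := hg x y.
have qz : quasi_geodesic rho (Cg + Cg.+1) n z.
  split=> [i ni|i j ij].
    have := hz i i.+1; rewrite leqnSn ni => /(_ isT); rewrite subSnn ler_distl.
    move=> /andP[_ h]; apply: le_trans h _; rewrite -natrD ler_nat; lia.
  have := hz _ _ ij; rewrite ler_distl => /andP[h _].
  have : rho (z i) (z j) <= (Cg + Cg.+1)%:R * rho (z i) (z j).
    by rewrite ler_peMl// ler1n addnS.
  have : Cg%:R <= (Cg + Cg.+1)%:R :> R by rewrite ler_nat leq_addr.
  lra.
have [fwd _] := hC _ _ qz; rewrite z0 zn in fwd.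
have [i ni pi] := fwd _ xyp.
have := hz 0%N i; have := hz i n; have := hz 0%N n.
rewrite !leqnn ni !leq0n /= !ler_distl => /(_ isT) /andP[a1 a2] /(_ isT) /andP[b1 b2].
move=> /(_ isT) /andP[c1 c2]; move: a1 a2 b1 b2 c1 c2; rewrite z0 zn !subn0 natrB//.
have := rT (z i) x p; have := rT (z i) p y; rewrite (rC (z i) p) natrD !natrM; lra.
Qed.

End Stability.

(** * Gromov products and undistorted intervals *)

Lemma nat_bound (R : realType) (x : R) : exists n : nat, x <= n%:R.
Proof.
exists (Num.bound x); apply: le_trans (ler_norm _) _; apply: ltW.
by have := archi_boundP (normr_ge0 x); rewrite /Num.bound normr_id.
Qed.

Section Aligned.
Variables (R : realType) (X : Type) (d : X -> X -> nat) (c : nat).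
Variables (rho : X -> X -> R) (L C : nat).
Hypothesis H : hyp_graph d c.
Hypothesis pm : pseudo_metric rho.
Hypothesis lip : forall x y, rho x y <= L%:R * (d x y)%:R.
Hypothesis al : forall x y p, btw d x y p -> rho x p + rho p y <= rho x y + C%:R.
Local Notation I := (btw d).
Local Notation gp := (gromov_prod rho).

Let rT := pmT pm.
Let rC := pmC pm.

Lemma gp_le_btw w x y p : I x y p -> gp w x y <= rho w p + C%:R.
Proof.
move=> /al h; have := rT p x w; have := rT p y w; have := ler0n R C.
by rewrite /gromov_prod (rC w p) (rC y p); lra.
Qed.

Lemma aligned_near x y m q e : I x y q -> (d m q <= e)%N ->
  rho x m + rho m y <= rho x y + C%:R + (2 * (L * e))%:R.
Proof.
move=> /al h he; have k : rho m q <= (L * e)%:R.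
  by apply: le_trans (lip _ _) _; rewrite natrM ler_wpM2l// ler_nat.
by have := rT q x m; have := rT q m y; rewrite (rC q m) natrM; lra.
Qed.

(** The center of the d-triangle x, y, w is close to both sides at w, so by alignment it is nearly
    rho-between on each; adding the two estimates gives the product. With [gp_le_btw] this reads
    products of rho off d-intervals. *)
Lemma gp_center : exists K : nat, forall w x y, exists m,
  [/\ I x y m, rho w m <= gp w x y + K%:R,
      exists2 q, I x w q & (d m q <= c + c + 2)%N
    & exists2 q, I y w q & (d m q <= c + c + 2)%N].
Proof.
exists (C + 2 * (L * (c + c + 2)))%N => w x y.
have [m [m1 [q q1 q2] [q' q1' q2']]] := btw_center H x y w.
exists m; split; [done| |by exists q|by exists q'].
have := aligned_near q1 q2; have := aligned_near q1' q2'; have := rT m x y.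
by rewrite /gromov_prod (rC m w) (rC m y) natrD; lra.
Qed.

Lemma aligned_gromov_ineq : exists K, gromov_ineq rho K.
Proof.
have [K hK] := gp_center; exists ((K + C)%:R + (L * (c + c))%:R) => w x y z.
have [m [m1 m2 _ _]] := hK w x y.
have key q : (d m q <= c + c)%N -> rho w q <= rho w m + (L * (c + c))%:R.
  move=> h; apply: le_trans (rT m _ _) _; rewrite lerD2l; apply: le_trans (lip _ _) _.
  by rewrite natrM ler_wpM2l// ler_nat.
rewrite natrD ge_min; case: (btw_thin H z m1) => -[q /(gp_le_btw w) q1 /key q2].
- by apply/orP; left; lra.
- by apply/orP; right; lra.
Qed.

(** The center of o, a fixed late [u N1] and [u i] is rho-far from o, yet within [d o (u N1)] of o
    for d. The intervals from [u i] to [v j] escape a larger ball, so by thinness the center is also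
    near the interval from o to [v j]: a rho-far point on the way to both. *)
Lemma aligned_limit (o : X) (u v : nat -> X) :
  (forall D : R, exists N, forall i j, (N <= i)%N -> (N <= j)%N -> D <= gp o (u i) (u j)) ->
  (forall m : nat, exists N, forall i j, (N <= i)%N -> (N <= j)%N ->
     forall p, I (u i) (v j) p -> (m < d o p)%N) ->
  forall D : R, exists N, forall i j, (N <= i)%N -> (N <= j)%N ->
    D <= rho o (v j) /\ D <= gp o (u i) (v j).
Proof.
move=> hu huv D; have [K hK] := gp_center.
pose e := (c + c + 2)%N.
pose E := C%:R + (2 * (L * (e + (c + c))))%:R : R.
have [N1 hN1] := hu (D + E + C%:R + (L * e)%:R).
have [N2 hN2] := huv (d o (u N1) + e + (c + c))%N.
exists (maxn N1 N2) => i j; rewrite !geq_max => /andP[i1 i2] /andP[j1 j2].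
have [m [m1 m2 [q q1 q2] [q' q1' q2']]] := hK (u i) o (u N1).
have om : (d o m <= d o (u N1))%N by move: m1; rewrite /btw; lia.
have rm : D + E <= rho o m.
  have := gp_le_btw o q1'; have := hN1 _ _ (leqnn N1) i1.
  have : rho m q' <= (L * e)%:R.
    by apply: le_trans (lip _ _) _; rewrite natrM ler_wpM2l// ler_nat.
  by have := rT m o q'; lra.
have [q'' v1 v2] : exists2 q'', I o (v j) q'' & (d m q'' <= e + (c + c))%N.
  case: (btw_thin H (v j) q1) => -[t t1 t2].
    by exists t => //; have := geodT H q m t; lia.
  have := hN2 _ _ i2 j2 _ (btwC H t1).
  by have := geodT H m o t; have := geodT H q m t; rewrite /e; lia.
have h1 := aligned_near v1 v2.
have h2 := @aligned_near _ _ m _ (e + (c + c)) q1 (leq_trans q2 (leq_addr _ _)).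
have h3 := rT m (u i) (v j); have h4 := pm_ge0 pm m (v j).
rewrite -/E in h1 h2; move: (D) rm; rewrite /gromov_prod => D' rm.
have h1' : rho o m + rho m (v j) <= rho o (v j) + E by rewrite /E; lra.
have h2' : rho o m + rho m (u i) <= rho o (u i) + E by rewrite /E; lra.
rewrite !(rC _ o) (rC (u i) m) in h3 *; lra.
Qed.

End Aligned.

Section Geo.
Variables (X : Type) (d : X -> X -> nat) (c : nat).
Hypothesis H : hyp_graph d c.
Local Open Scope nat_scope.

Lemma geo_fun_through x y w : btw d x y w -> exists z : nat -> X,
  [/\ z 0 = x, z (d x y) = y, z (d x w) = w &
  forall i j, i <= j <= d x y -> d (z i) (z j) = j - i].
Proof.
move=> xyw; have [z1 [a1 b1 c1]] := geo_fun H x w; have [z2 [a2 b2 c2]] := geo_fun H w y.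
pose m := d x w; have xy : d x y = m + d w y by move: xyw; rewrite /btw /m; lia.
exists (fun i => if i <= m then z1 i else z2 (i - m)); split.
- by rewrite a1.
- rewrite xy; case: leqP => h; last by rewrite addKn b2.
  have wy0 : d w y = 0 by lia.
  by rewrite wy0 addn0 b1; exact: (geod_eq H).
- by rewrite leqnn b1.
- move=> i j; rewrite xy => /andP[ij jn].
  case: (leqP j m) => jm; first by rewrite (leq_trans ij jm); apply: c1; rewrite ij.
  case: leqP => im; last by rewrite c2; lia.
  have e1 : d (z1 i) w = m - i by rewrite -{1}b1 c1// im leqnn.
  have e2 : d x (z1 i) = i by rewrite -{1}a1 c1 ?subn0// leq0n im.
  have e3 : d w (z2 (j - m)) = j - m by rewrite -{1}a2 c2 ?subn0//; lia.
  have e4 : d (z2 (j - m)) y = d w y - (j - m) by rewrite -{1}b2 c2 ?leqnn//; lia.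
  have := geodT H w (z1 i) (z2 (j - m)); have := geodT H (z1 i) x y.
  by have := geodT H (z2 (j - m)) (z1 i) y; lia.
Qed.

(** With this instance [stability] becomes the classical Morse lemma for d. *)
Lemma model_self (R : realType) : model d (fun x y => (d x y)%:R : R).
Proof.
split.
- split=> [x|x y|x y|y x z]; rewrite ?(geod0 H)//.
  + by rewrite (geodC H).
  + by rewrite -natrD ler_nat (geodT H).
- by exists 1 => x y; rewrite mul1r.
- move=> r; exists r => x y p; rewrite !ler_nat /btw; lia.
- exists 0 => x y; have [z [z0 zn hz]] := geo_fun H x y.
  by exists (d x y), z; split => // i j ij; rewrite hz// subrr normr0.
Qed.

End Geo.

Section Pair.
Variables (R : realType) (X1 X : Type) (d1 : X1 -> X1 -> nat) (d : X -> X -> nat).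
Variables (c1 c : nat) (iota : X1 -> X) (L : nat).
Hypothesis H1 : hyp_graph d1 c1.
Hypothesis H : hyp_graph d c.
Hypothesis iota_lip : forall x y, (d (iota x) (iota y) <= L * d1 x y)%N.
Hypothesis iota_proper : forall n, exists m, forall x y,
  (d (iota x) (iota y) <= n)%N -> (d1 x y <= m)%N.
Local Notation I1 := (btw d1).
Local Notation I := (btw d).

(* All pairs inside the interval are compared, which makes the property hereditary. *)
Definition undistorted (C : nat) (x y : X1) : Prop := forall u v,
  I1 x y u -> I1 x y v -> (d1 u v <= C * d (iota u) (iota v) + C)%N.

Lemma undistortedC C x y : undistorted C x y -> undistorted C y x.
Proof. by move=> h u v /(btwC H1) xu /(btwC H1) xv; exact: h. Qed.

Lemma undistorted_sub C x y u : undistorted C x y -> I1 x y u -> undistorted C x u.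
Proof. by move=> h xu p q /(btw_sub H1 xu) hp /(btw_sub H1 xu) hq; exact: h. Qed.

Lemma undistorted_short n x y : (d1 x y <= n)%N -> undistorted (2 * n) x y.
Proof.
move=> xy u v; rewrite /btw => h1 h2; have := geodT H1 x u v; rewrite (geodC H1 u x); lia.
Qed.

Lemma undistorted_le C C' x y : (C <= C')%N -> undistorted C x y -> undistorted C' x y.
Proof.
move=> CC h u v hu hv; apply: leq_trans (h u v hu hv) _.
by apply: leq_add => //; rewrite leq_mul2r CC orbT.
Qed.

(** The image of a d1-geodesic is a quasi-geodesic of d, so the Morse lemma applies. In the second
    half the geodesic is taken through the given w, which covers the whole interval. *)
Lemma undistorted_stable C : exists K : nat, forall x y, undistorted C x y ->
  (forall p, I (iota x) (iota y) p -> exists2 w, I1 x y w & (d p (iota w) <= K)%N) /\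
  (forall w, I1 x y w -> exists2 p, I (iota x) (iota y) p & (d (iota w) p <= K)%N).
Proof.
have [K hK] := stability H (model_self H R) (L + C)%N; exists K => x y gxy.
have qg z : z 0%N = x -> z (d1 x y) = y ->
    (forall i j, (i <= j <= d1 x y)%N -> d1 (z i) (z j) = (j - i)%N) ->
    quasi_geodesic (fun x y => (d x y)%:R : R) (L + C) (d1 x y) (iota \o z).
  move=> z0 zn hz; split=> [i ni|i j ij].
    rewrite ler_nat; apply: leq_trans (iota_lip _ _) _.
    by rewrite hz ?leqnSn// subSnn muln1 leq_addr.
  have zI := geo_fun_btw z0 zn hz; move/andP: (ij) => [ij' jn].
  have := gxy _ _ (zI i (leq_trans ij' jn)) (zI j jn); rewrite hz// => h.
  rewrite -natrM -natrD ler_nat; apply: leq_trans h _.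
  by apply: leq_add; rewrite ?leq_mul2r ?leq_addl ?orbT.
split.
- move=> p hp; have [z [z0 zn hz]] := geo_fun H1 x y.
  have [fwd _] := hK _ _ (qg z z0 zn hz); rewrite /= z0 zn in fwd.
  have [i ni pi] := fwd p hp; exists (z i); last by rewrite -(ler_nat R).
  exact: geo_fun_btw z0 zn hz _ ni.
- move=> w hw; have [z [z0 zn zw hz]] := geo_fun_through H1 hw.
  have [_ bwd] := hK _ _ (qg z z0 zn hz); rewrite /= z0 zn in bwd.
  have [|p p1 p2] := bwd (d1 x w); first by move: hw; rewrite /btw; lia.
  by exists p => //; rewrite -(ler_nat R) -[w in X in X <= _]zw.
Qed.

(* For u and v on the two sides, the center of the triangle with vertices iota u, iota v and
   iota z is close to points of both sides, and these are d1-close because iota is proper. *)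
Lemma undistorted_comp C : exists C' : nat, forall x y z,
  undistorted C x z -> undistorted C z y -> undistorted C' x y.
Proof.
have [K hK] := undistorted_stable C.
pose e := (c + c + 2)%N; have [m hm] := iota_proper (2 * (K + e)).
pose E := (C * (2 * (K + e) + L * (4 * c1)) + 2 * C + m + 4 * c1)%N.
exists (C + E)%N => x y z gxz gzy.
have cross u v : I1 x z u -> I1 z y v ->
    (d1 u v <= C * (d (iota u) (iota v) + 2 * (K + e)) + 2 * C + m)%N.
  move=> xu yv; have [w [w1 [q q1 q2] [q' q1' q2']]] := btw_center H (iota u) (iota v) (iota z).
  have guz : undistorted C z u.
    by apply: (@undistorted_sub C z x); [exact: undistortedC|exact: (btwC H1)].
  have gvz : undistorted C z v by apply: (@undistorted_sub C z y).
  have [u' u1 u2] := (hK _ _ guz).1 _ (btwC H q1).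
  have [v' v1 v2] := (hK _ _ gvz).1 _ (btwC H q1').
  have := guz u u' (btw_r H1 _ _) u1; have := gvz v v' (btw_r H1 _ _) v1.
  have uv' : (d1 u' v' <= m)%N.
    apply: hm; have := geodT H q (iota u') (iota v'); have := geodT H w q (iota v').
    have := geodT H q' w (iota v'); rewrite (geodC H (iota u') q) (geodC H q w) /e; lia.
  have := geodT H1 u' u v; have := geodT H1 v' u' v; rewrite (geodC H1 v' v).
  have a1 : (d (iota u) (iota u') <= d (iota u) w + (e + K))%N.
    by have := geodT H w (iota u) (iota u'); have := geodT H q w (iota u'); rewrite /e; lia.
  have a2 : (d (iota v) (iota v') <= d w (iota v) + (e + K))%N.
    have := geodT H w (iota v) (iota v'); have := geodT H q' w (iota v').
    by rewrite (geodC H (iota v) w) /e; lia.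
  move: w1; rewrite /btw => <-.
  have := leq_mul (leqnn C) a1; have := leq_mul (leqnn C) a2; rewrite !mulnDr; lia.
have same u v : I1 x z u /\ I1 x z v \/ I1 z y u /\ I1 z y v ->
    (d1 u v <= C * (d (iota u) (iota v) + 2 * (K + e)) + 2 * C + m)%N.
  move=> h; have : (d1 u v <= C * d (iota u) (iota v) + C)%N.
    by case: h => -[hu hv]; [exact: gxz|exact: gzy].
  by rewrite !mulnDr; lia.
have all4 u v : I1 x z u \/ I1 z y u -> I1 x z v \/ I1 z y v ->
    (d1 u v <= C * (d (iota u) (iota v) + 2 * (K + e)) + 2 * C + m)%N.
  move=> [xu|yu] [xv|yv]; [by apply: same; left|exact: cross| |by apply: same; right].
  by rewrite (geodC H1) (geodC H (iota u)); exact: cross.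
have near u : I1 x y u -> exists2 u', I1 x z u' \/ I1 z y u' & (d1 u u' <= c1 + c1)%N.
  by move=> /(btw_thin H1 z)[[q]|[q]] q1 q2; exists q => //; [left|right].
move=> u v /near[u' u1 u2] /near[v' v1 v2]; have := all4 _ _ u1 v1.
have := geodT H1 u' u v; have := geodT H1 v' u' v; rewrite (geodC H1 v' v).
have a1 : (d (iota u') (iota v') <= d (iota u) (iota v) + L * (4 * c1))%N.
  have := geodT H (iota u) (iota u') (iota v'); have := geodT H (iota v) (iota u) (iota v').
  have := iota_lip u u'; have := iota_lip v v'; rewrite (geodC H (iota u') (iota u)).
  have b1 := leq_mul (leqnn L) u2; have b2 := leq_mul (leqnn L) v2.
  by rewrite !mulnDr in b1 b2 *; lia.
have := leq_mul (leqnn C) a1; rewrite /E !mulnDl !mulnDr; lia.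
Qed.

Variables (rho1 : X1 -> X1 -> R) (rho : X -> X -> R) (A1 A B1 B : nat).
Hypothesis pm1 : pseudo_metric rho1.
Hypothesis pm : pseudo_metric rho.
Hypothesis lip1 : forall x y, rho1 x y <= A1%:R * (d1 x y)%:R.
Hypothesis lip : forall x y, rho x y <= A%:R * (d x y)%:R.
Hypothesis al1 : forall x y p, I1 x y p -> rho1 x p + rho1 p y <= rho1 x y + B1%:R.
Hypothesis al : forall x y p, I x y p -> rho x p + rho p y <= rho x y + B%:R.

(** The center of o, x, y is carried close to the interval of the images, and its distance to o does
    not grow because iota shortens rho. This reverse inequality is what separates boundary
    points. *)
Lemma undistorted_gromov_prod C o :
  (forall x y, rho (iota x) (iota y) <= rho1 x y) ->
  (forall x y, undistorted C x y) -> exists K : nat, forall x y,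
  gromov_prod rho (iota o) (iota x) (iota y) <= gromov_prod rho1 o x y + K%:R.
Proof.
move=> hr hC; have [K1 hK1] := gp_center H1 pm1 lip1 al1.
have [K hK] := undistorted_stable C; exists (K1 + A * K + B)%N => x y.
have [m [m1 m2 _ _]] := hK1 o x y; have [p p1 p2] := (hK _ _ (hC x y)).2 _ m1.
have := gp_le_btw pm al (iota o) p1; have := hr o m; have := pmT pm (iota m) (iota o) p.
have : rho (iota m) p <= (A * K)%:R.
  by apply: le_trans (lip _ _) _; rewrite natrM ler_wpM2l// ler_nat.
by rewrite !natrD; lra.
Qed.

Hypothesis und : forall D : nat, exists C, forall x y, rho1 x y <= D%:R -> undistorted C x y.
Variable o : X1.
Hypothesis mitra : forall m : R, exists n, forall x y,
  n <= gromov_prod rho1 o x y -> m <= gromov_prod rho (iota o) (iota x) (iota y).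

(** By [gp_center] a rho1-far interval has a large product at o; the criterion makes the product of
    the images large, which bounds the rho-distance, hence the d-distance, of every point between
    them from below. *)
Lemma far_of_rho_far (m : nat) : exists D : nat, forall x y,
  (forall p, I1 x y p -> D%:R < rho1 o p) ->
  forall p, I (iota x) (iota y) p -> (m < d (iota o) p)%N.
Proof.
have [K hK] := gp_center H1 pm1 lip1 al1.
have [n hn] := mitra ((A * m)%:R + B%:R + 1); have [n' n'n] := nat_bound n.
exists (n' + K)%N => x y far p Ip; have [q [q1 q2 _ _]] := hK o x y.
have := far q q1; rewrite natrD => h1.
have h2 : n <= gromov_prod rho1 o x y by lra.
have := hn _ _ h2; have := gp_le_btw pm al (iota o) Ip; have := lip (iota o) p.
rewrite ltnNge => h3 h4 h5; apply/negP => h6.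
have : A%:R * (d (iota o) p)%:R <= (A * m)%:R :> R by rewrite natrM ler_wpM2l// ler_nat.
lra.
Qed.

(* Cut the interval at its first and last points rho1-close to o: the outer parts are far
   by [far_of_rho_far], and the middle part is undistorted. *)
Lemma far_image (m : nat) : exists n : nat, forall x y,
  (forall p, I1 x y p -> (n <= d1 o p)%N) ->
  forall p, I (iota x) (iota y) p -> (m < d (iota o) p)%N.
Proof.
pose m' := (m + 6 * c + L)%N; have [D hD] := far_of_rho_far m'.
have [C hC] := und (2 * D); have [K hK] := undistorted_stable C.
have [n hn] := iota_proper (m' + K).
have far w : (n.+1 <= d1 o w)%N -> (m' + K < d (iota o) (iota w))%N.
  by rewrite ltnNge => h; rewrite ltnNge; apply: contra h => /hn.
have ends x p0 : (forall w, I1 x p0 w -> (n.+1 <= d1 o w)%N) -> rho1 o p0 <= D%:R ->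
    exists z, [/\ I1 x p0 z, rho1 o z <= D%:R &
      forall q, I (iota x) (iota z) q -> (m + 4 * c < d (iota o) q)%N].
  move=> fx op0.
  (* z is the point rho1-close to o that is nearest to x, so the interval from x to its predecessor
     z' satisfies the hypothesis of [far_of_rho_far]. *)
  pose P k := `[< exists z, [/\ I1 x p0 z, rho1 o z <= D%:R & d1 x z = k] >].
  have exP : exists k, P k.
    by exists (d1 x p0); apply/asboolP; exists p0; split => //; exact: (btw_r H1).
  case: (ex_minnP exP) => k /asboolP[z [z1 z2 z3]] kmin; exists z; split=> // q.
  case: (pselect (x = z)) => [<-|xz].
    move=> /(btw_xx H) ->; have := far x (fx _ (btw_l H1 _ _)); rewrite /m'; lia.
  have [z' h1 h2] := btw_step H1 xz => /(btw_thin H (iota z'))[[t t1 t2]|[t t1 t2]].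
    have : (m' < d (iota o) t)%N.
      apply: hD t1 => w xw; rewrite ltNge; apply/negP => ow.
      have : P (d1 x w).
        apply/asboolP; exists w; split=> //.
        exact: (btw_sub H1 z1 (btw_sub H1 h1 xw)).
      by move=> /kmin; move: xw h1; rewrite /btw; lia.
    by have := geodT H q (iota o) t; rewrite /m'; lia.
  have := far z (fx _ z1); have := iota_lip z' z; rewrite h2 muln1.
  have := geodT H q (iota o) t; have := geodT H t (iota o) (iota z).
  by move: t1; rewrite /btw /m'; lia.
exists n.+1 => x y fxy p hp.
case: (pselect (exists2 p0, I1 x y p0 & rho1 o p0 <= D%:R)) => [[p0 xyp op0]|no]; last first.
  have : (m' < d (iota o) p)%N.
    apply: hD hp => q xyq; rewrite ltNge; apply/negP => oq; apply: no.
    by exists q.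
  by rewrite /m'; lia.
have [|z1 [a1 a2 a3]] := ends x p0 _ op0.
  by move=> w /(btw_sub H1 xyp); exact: fxy.
have [|z2 [b1 b2 b3]] := ends y p0 _ op0.
  by move=> w h; apply: fxy; apply: (btw_subr H1 xyp); exact: (btwC H1).
(* Undistortedness puts q near the image of a point of the d1-interval; that point is far from o,
   and properness of iota makes its image far as well. *)
have mid q : I (iota z1) (iota z2) q -> (m' < d (iota o) q)%N.
  have gz : undistorted C z1 z2.
    apply: hC; rewrite natrM; have := pmT pm1 o z1 z2; rewrite (pmC pm1 z1 o); lra.
  move=> /((hK _ _ gz).1)[w w1 w2].
  have := far w (fxy _ (btw_span H1 xyp a1 (btwC H1 b1) w1)).
  by have := geodT H q (iota o) (iota w); lia.
case: (btw_thin H (iota z1) hp) => -[q q1 q2].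
  by have := a3 _ q1; have := geodT H p (iota o) q; lia.
case: (btw_thin H (iota z2) q1) => -[t t1 t2].
  have := mid _ t1; have := geodT H p (iota o) t; have := geodT H q p t; rewrite /m'; lia.
have := b3 _ (btwC H t1); have := geodT H p (iota o) t; have := geodT H q p t; lia.
Qed.

End Pair.

(** * Word metrics *)

Section WordMetric.
Local Open Scope group_scope.
Variables (G : groupType) (S : seq G).

Definition letter (a : G * bool) : G := if a.2 then a.1 else a.1^-1.
Definition wprod (w : seq (G * bool)) : G := \prod_(a <- w) letter a.
Definition wlen_is (g : G) (n : nat) : bool :=
  `[< exists w, [/\ all (fun a => a.1 \in S) w, size w = n & wprod w = g] >].
(** An element that is no product of letters gets the default length 0; [generates S] rules this
    out. *)
Definition wlen (g : G) : nat :=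
  if pselect (exists n, wlen_is g n) is left h then ex_minn h else 0%N.
Definition wd (g h : G) : nat := wlen (g^-1 * h).

Hypothesis gen : generates S.

Lemma wlen_ex g : exists w, [/\ all (fun a => a.1 \in S) w, size w = wlen g & wprod w = g].
Proof.
rewrite /wlen; case: pselect => [h|[]]; first by case: ex_minnP => n /asboolP.
by have [w Sw ->] := gen g; exists (size w); apply/asboolP; exists w.
Qed.

Lemma wlen_min w : all (fun a => a.1 \in S) w -> (wlen (wprod w) <= size w)%N.
Proof.
move=> Sw; rewrite /wlen; case: pselect => // h; case: ex_minnP => n _; apply.
by apply/asboolP; exists w.
Qed.

Lemma wprod_cat u v : wprod (u ++ v) = wprod u * wprod v.
Proof. by rewrite /wprod big_cat. Qed.

Lemma wlen1 : wlen 1 = 0%N.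
Proof.
by apply/eqP; rewrite -leqn0; have := @wlen_min [::] isT; rewrite /wprod big_nil.
Qed.

Lemma wlen0 g : wlen g = 0%N -> g = 1.
Proof.
move=> g0; have [w [_]] := wlen_ex g; rewrite g0 => /size0nil -> <-.
by rewrite /wprod big_nil.
Qed.

Lemma wlenM g h : (wlen (g * h) <= wlen g + wlen h)%N.
Proof.
have [u [Su <- <-]] := wlen_ex g; have [v [Sv <- <-]] := wlen_ex h.
by rewrite -wprod_cat -size_cat; apply: wlen_min; rewrite all_cat Su.
Qed.

Lemma wlenV_le g : (wlen g^-1 <= wlen g)%N.
Proof.
have [u [Su <- <-]] := wlen_ex g.
have -> : (wprod u)^-1 = wprod (rev [seq (a.1, ~~ a.2) | a <- u]).
  elim: u {Su} => [|[a b] u IH]; first by rewrite /wprod !big_nil invg1.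
  rewrite /= rev_cons -cats1 wprod_cat -IH /wprod big_cons invgM big_seq1.
  by rewrite /letter /=; case: b => //=; rewrite invgK.
by rewrite -(size_map (fun a => (a.1, ~~ a.2)) u) -size_rev wlen_min// all_rev all_map.
Qed.

Lemma wlenV g : wlen g^-1 = wlen g.
Proof. by apply/eqP; rewrite eqn_leq wlenV_le -{1}[g]invgK wlenV_le. Qed.

Lemma wlen_letter s : s \in S -> (wlen s <= 1)%N.
Proof.
move=> sS; have := @wlen_min [:: (s, true)].
by rewrite /wprod big_seq1 /= sS; apply.
Qed.

Lemma wd_mull x g h : wd (x * g) (x * h) = wd g h.
Proof. by rewrite /wd invgM -mulgA mulKg. Qed.

Lemma wd_metric : nat_metric wd.
Proof.
split.
- by move=> x; rewrite /wd mulVg wlen1.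
- by move=> x y /wlen0 /(congr1 ( *%g x)); rewrite mulVKg mulg1.
- by move=> x y; rewrite /wd -wlenV invgM invgK.
- move=> x y z; rewrite /wd -[x^-1 * z](_ : (x^-1 * y) * (y^-1 * z) = _) ?wlenM//.
  by rewrite mulgA mulgK.
Qed.

Lemma wd_interpolates : interpolates wd.
Proof.
move=> x y k; rewrite /wd => h; have [w [Sw sw wE]] := wlen_ex (x^-1 * y).
have e : wprod (take k w) * wprod (drop k w) = x^-1 * y.
  by rewrite -wprod_cat cat_take_drop.
have /andP[St Sd] : all (fun a => a.1 \in S) (take k w) && all (fun a => a.1 \in S) (drop k w).
  by rewrite -all_cat cat_take_drop.
exists (x * wprod (take k w)).
- rewrite mulKg; apply/eqP; rewrite eqn_leq; apply/andP; split.
    by apply: leq_trans (wlen_min _) _; [exact: St|rewrite size_take; case: ifP; lia].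
  have := wlenM (wprod (take k w)) (wprod (drop k w)); rewrite e.
  have := @wlen_min (drop k w); rewrite size_drop => /(_ Sd); lia.
- have -> : (x * wprod (take k w))^-1 * y = wprod (drop k w).
    by rewrite invgM -mulgA -e mulKg.
  apply/eqP; rewrite eqn_leq; apply/andP; split.
    by rewrite -sw -size_drop; apply: wlen_min; exact: Sd.
  have := wlenM (wprod (take k w)) (wprod (drop k w)); rewrite e.
  have := @wlen_min (take k w); rewrite size_take => /(_ St).
  by case: ifP; lia.
Qed.

Lemma wd_geo : geo_graph wd.
Proof. split; [exact: wd_metric|exact: wd_interpolates]. Qed.

Lemma word_lip (R : realType) (rho : G -> G -> R) (A : nat) : pseudo_metric rho ->
  (forall g s, s \in S -> (rho g (g * s)%g <= A%:R)%R) ->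
  forall g h, (rho g h <= A%:R * (wd g h)%:R)%R.
Proof.
move=> pm hA g h; rewrite /wd; have [w [Sw <- wE]] := wlen_ex (g^-1 * h)%g.
have -> : h = (g * wprod w)%g by rewrite wE mulVKg.
elim: w Sw g {wE h} => [|[s b] w IH] /=.
  by move=> _ g; rewrite /wprod big_nil mulg1 (pm0 pm) mulr0.
move=> /andP[sS /IH h] g; rewrite /wprod big_cons mulgA -add1n natrD mulrDr mulr1.
apply: le_trans (pmT pm (g * letter (s, b))%g _ _) _; apply: lerD; last exact: h.
rewrite /letter /=; case: b => /=; first exact: hA.
by rewrite (pmC pm) -{2}[g](mulgVK s); exact: hA.
Qed.

Lemma wd_ball n : exists s : seq G, forall g, (wlen g <= n)%N -> g \in s.
Proof.
elim: n => [|n [s hs]].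
  by exists [:: 1] => g; rewrite leqn0 => /eqP /wlen0 ->; rewrite mem_head.
exists (s ++ [seq g * l | g <- s, l <- S ++ [seq x^-1 | x <- S]]) => g.
rewrite leq_eqVlt ltnS mem_cat => /predU1P[gn|/hs->//]; apply/orP; right.
have [w [Sw sw wE]] := wlen_ex g; move: Sw sw wE.
case/lastP: w => [|w a]; first by rewrite gn.
rewrite all_rcons size_rcons gn => /andP[aS Sw] [sw]; rewrite -cats1 wprod_cat => <-.
apply/allpairsP; exists (wprod w, wprod [:: a]); split=> //=.
  by apply: hs; rewrite -sw; exact: wlen_min.
rewrite /wprod big_seq1 /letter mem_cat; case: a aS => a [] /= aS; first by rewrite aS.
by rewrite map_f ?orbT.
Qed.

End WordMetric.

Lemma letters_bound (G : groupType) (S : seq G) (P : G -> nat -> Prop) :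
  (forall g n m, (n <= m)%N -> P g n -> P g m) -> (forall g, g \in S -> exists n, P g n) ->
  exists n, forall g, g \in S -> P g n.
Proof.
move=> mono; elim: S => [|a S IH] h; first by exists 0%N.
have [n hn] := h a (mem_head _ _).
have [|m hm] := IH; first by move=> g gS; apply: h; rewrite inE gS orbT.
exists (n + m)%N => g; rewrite inE => /predU1P[->|gS].
  by apply: mono hn; exact: leq_addr.
by apply: mono (hm _ gS); exact: leq_addl.
Qed.

Section Hom.
Local Open Scope group_scope.
Variables (G1 G : groupType) (f : G1 -> G) (S1 : seq G1) (S : seq G).
Hypotheses (fM : {morph f : x y / x * y}) (gen1 : generates S1) (gen : generates S).

Lemma morph1 : f 1 = 1.
Proof. by have /(congr1 ( *%g (f 1)^-1)) := fM 1 1; rewrite mulg1 mulKg mulVg => ->. Qed.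

Lemma morphV x : f x^-1 = (f x)^-1.
Proof. by symmetry; apply: mulg1_eq; rewrite -fM mulgV morph1. Qed.

Lemma wlen_lip : exists L : nat, forall x, (wlen S (f x) <= L * wlen S1 x)%N.
Proof.
have [|s _|L hL] := @letters_bound _ S1 (fun s n => wlen S (f s) <= n)%N.
- by move=> s n m nm h; exact: leq_trans h nm.
- by exists (wlen S (f s)).
exists L => x; have [w [Sw <- <-]] := wlen_ex gen1 x; elim: w Sw => [|a w IH] /=.
  by rewrite /wprod big_nil morph1 wlen1.
move=> /andP[aS /IH h]; rewrite /wprod big_cons fM mulnS.
apply: leq_trans (wlenM gen _ _) _; apply: leq_add h.
by rewrite /letter; case: ifP => _; rewrite ?morphV ?wlenV// hL.
Qed.

Lemma wd_lip : exists L : nat, forall x y, (wd S (f x) (f y) <= L * wd S1 x y)%N.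
Proof.
by have [L hL] := wlen_lip; exists L => x y; rewrite /wd -morphV -fM.
Qed.

Hypothesis fI : injective f.

(** A ball of G is finite, and each of its elements has at most one preimage. *)
Lemma wd_proper n : exists m, forall x y,
  (wd S (f x) (f y) <= n)%N -> (wd S1 x y <= m)%N.
Proof.
have [s hs] := wd_ball gen n.
have [|g gs|m hm] := @letters_bound _ s (fun g n => forall x, f x = g -> wlen S1 x <= n)%N.
- by move=> g k m km h x /h hx; exact: leq_trans hx km.
- case: (pselect (exists x, f x = g)) => [[x xg]|no].
    by exists (wlen S1 x) => y; rewrite -xg => /fI ->.
  by exists 0%N => x xg; case: no; exists x.
exists m => x y; rewrite {1}/wd -morphV -fM => /hs h.
exact: hm h _ erefl.
Qed.

End Hom.

Lemma wd_change (G : groupType) (S S' : seq G) : generates S -> generates S' ->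
  exists L : nat, forall x y, (wd S' x y <= L * wd S x y)%N.
Proof. by move=> gS gS'; apply: (@wd_lip _ _ id). Qed.

(** Lets Gromov products for an arbitrary generating set be estimated by the intervals of a fixed
    one. *)
Lemma model_wd (R : realType) (G : groupType) (S S' : seq G) : generates S ->
  generates S' -> model (wd S) (fun x y => (wd S' x y)%:R%R : R).
Proof.
move=> gS gS'; have [L hL] := wd_change gS gS'; have [L' hL'] := wd_change gS' gS.
have [w0 w1 w2 w3] := wd_metric gS'.
split.
- split=> [x|x y|x y|y x z].
  + by rewrite w0.
  + by rewrite ler0n.
  + by rewrite w2.
  + by rewrite -natrD ler_nat.
- by exists L => x y; rewrite -natrM ler_nat.
- move=> r; exists (L * (L' * r))%N => x y p; rewrite !ler_nat /btw => h1 h2.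
  apply: leq_trans (hL _ _) _; rewrite leq_mul2l; apply/orP; right.
  by apply: (@leq_trans (L' * wd S' x y)); [have := hL' x y; lia|rewrite leq_mul2l h1 orbT].
- exists 0%N => x y; have [z [z0 zn hz]] := geo_fun (wd_geo gS') x y.
  by exists (wd S' x y), z; split => // i j ij; rewrite hz// subrr normr0.
Qed.

(** * Glued metric spaces *)

Section LipschitzPath.
Local Open Scope classical_set_scope.
Local Open Scope ring_scope.
Variables (R : realType) (T : Type) (d : T -> T -> R).

(** A 1-Lipschitz path of duration l, together with its image. Upper bounds alone make concatenation
    easy. *)
Definition lpath (a b : T) (l : R) (A : set T) : Prop :=
  0 <= l /\ exists c : R -> T, [/\ c 0 = a, c l = b, A = c @` `[0, l] &
    {in `[0, l] &, forall s t, d (c s) (c t) <= `|s - t|}].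

Hypothesis pm : pseudo_metric d.

Lemma lpath_refl a : lpath a a 0 [set a].
Proof.
split=> //; exists (fun=> a); split=> //.
  apply/seteqP; split=> [_ ->|_ [_ _ <-]]//.
  by exists 0 => //=; rewrite in_itv /= lexx.
by move=> s t _ _; rewrite (pm0 pm).
Qed.

Lemma lpath_cat a b e l m A B : lpath a b l A -> lpath b e m B ->
  lpath a e (l + m) (A `|` B).
Proof.
move=> [l0 [c [c0 cl -> hc]]] [m0 [k [k0 km -> hk]]]; split; first exact: addr_ge0.
pose g t := if t <= l then c t else k (t - l).
have gl t : t <= l -> g t = c t by rewrite /g => ->.
have gr t : l <= t -> g t = k (t - l).
  rewrite /g le_eqVlt => /predU1P[<-|h]; first by rewrite lexx subrr cl k0.
  by rewrite leNgt h.
exists g; split.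
- by rewrite gl.
- by rewrite gr ?lerDl// addrC addKr.
- apply/seteqP; split=> x /=.
  + case=> -[t] /=; rewrite in_itv /= => /andP[t0 tl] <-.
      by exists t; rewrite ?gl// in_itv /= t0 (le_trans tl)// lerDl.
    exists (l + t); last by rewrite gr ?lerDl// addrC addKr.
    by rewrite in_itv /= addr_ge0// lerD2l.
  + case=> t; rewrite in_itv /= => /andP[t0 tlm] <-.
    have [tl|tl] := leP t l.
      by left; exists t; rewrite ?gl// in_itv /= t0.
    right; exists (t - l); last by rewrite gr// ltW.
    by rewrite /= in_itv /= subr_ge0 ltW//= lerBlDl.
- move=> s t; wlog st : s t / s <= t.
    move=> h sI tI; have [/h|ts] := leP s t; first exact.
    by rewrite (pmC pm) distrC; apply: h => //; exact: ltW.
  rewrite !in_itv /= => /andP[s0 slm] /andP[t0 tlm].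
  have [tl|tl] := leP t l.
    rewrite !gl// ?(le_trans st)//; apply: hc; rewrite in_itv /= ?s0 ?t0//.
    exact: le_trans st tl.
  have [sl|sl] := leP s l; last first.
    rewrite (gr s (ltW sl)) (gr t (ltW tl)).
    have := hk (s - l) (t - l); rewrite !in_itv /= !subr_ge0 !lerBlDl (ltW sl) (ltW tl).
    by rewrite slm tlm opprB addrA subrK; apply.
  rewrite (gl s sl) (gr t (ltW tl)); apply: le_trans (pmT pm (c l) _ _) _.
  have h1 := hc s l; rewrite !in_itv /= s0 sl l0 lexx in h1.
  have h2 := hk 0 (t - l); rewrite !in_itv /= m0 lexx subr_ge0 (ltW tl) lerBlDl tlm in h2.
  have := h1 isT isT; have := h2 isT isT; rewrite k0 -cl.
  rewrite sub0r normrN (ger0_norm (x := t - l)) ?subr_ge0 ?(ltW tl)//.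
  rewrite (ler0_norm (x := s - l)) ?subr_le0// (ler0_norm (x := s - t)) ?subr_le0//; lra.
Qed.

(** If the path lost length between two times, the triangle inequality through these points would
    bring its ends too close. *)
Lemma lpath_segment a b A : lpath a b (d a b) A -> geodesic_segment d a b A.
Proof.
move=> [l0 [c [c0 cl -> hc]]]; exists c; split=> // s t.
wlog st : s t / s <= t.
  move=> h sI tI; have [/h|ts] := leP s t; first exact.
  by rewrite (pmC pm) distrC; apply: h => //; exact: ltW.
move=> sI tI; apply: le_anti; rewrite hc//=.
have z0 : 0 \in `[0, d a b] by rewrite in_itv /= lexx.
have zl : d a b \in `[0, d a b] by rewrite in_itv /= lexx l0.
have := hc _ _ z0 sI; have := hc _ _ tI zl; move: sI tI.
rewrite !in_itv /= => /andP[s0 sl] /andP[t0 tl].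
have := pmT pm (c s) a b; have := pmT pm (c t) (c s) b.
rewrite c0 cl sub0r normrN (ger0_norm s0) (ler0_norm (x := t - _)) ?subr_le0//.
rewrite (ler0_norm (x := s - _)) ?subr_le0//; lra.
Qed.

Lemma lpath_ends a b l A : lpath a b l A -> A a /\ A b.
Proof.
by move=> [l0 [c [c0 cl -> hc]]]; split; [exists 0|exists l];
  rewrite //= in_itv /= lexx l0.
Qed.

End LipschitzPath.

Section Glue.
Local Open Scope classical_set_scope.
Local Open Scope ring_scope.
Variables (R : realType) (I : Type) (P : I -> Type).
Variable dP : forall i, P i -> P i -> R.
Variable r : {i & P i} -> {i & P i} -> Prop.
Local Notation pt x := (to_quot r (existT P _ x)).

Definition adj (a b : quot r) (l : R) : Prop :=
  exists i (x y : P i), [/\ a = pt x, b = pt y & l = dP x y].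

(** Chains between classes, with the number of segments recorded: limits of chains are taken at a
    fixed number ([limit_chain]). *)
Inductive qchain : nat -> quot r -> quot r -> R -> Prop :=
| qchain0 a : qchain 0 a a 0
| qchainS n a b l e m : qchain n a b l -> adj b e m -> qchain n.+1 a e (l + m).

Lemma chain_qchain p q l : chain dP r p q l <->
  exists n, qchain n (to_quot r p) (to_quot r q) l.
Proof.
split.
- elim=> {p q l} [p q /to_quotP ->|p q l i x y _ [n IH] /to_quotP <-].
    by exists 0%N; exact: qchain0.
  by exists n.+1; apply: qchainS IH _; exists i, x, y.
- case=> n; move E: (to_quot r p) => a; move F: (to_quot r q) => b h.
  elim: h p q E F => {n a b l} [a p q <- /to_quotP h|n a b l e m _ IH be p q pa qe].
    by apply: chain_glue; exact: eqv_sym.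
  have [i [x [y [bx ey ->]]]] := be; apply: chain_step (IH _ _ pa (esym bx)) _.
  by apply/to_quotP; rewrite qe ey.
Qed.

Lemma qchain_cat n a b l m e k : qchain n a b l -> qchain m b e k ->
  qchain (n + m) a e (l + k).
Proof.
move=> h1 h2; elim: h2 h1 => {m b e k} [b|m b e k f k' _ IH ef] h1.
  by rewrite addn0 addr0.
by rewrite addnS addrA; apply: qchainS ef; exact: IH.
Qed.

Lemma qchain1 a b l : adj a b l -> qchain 1 a b l.
Proof. by move=> h; rewrite -[l]add0r; apply: qchainS h; exact: qchain0. Qed.

Hypothesis dP0 : forall i (x : P i), dP x x = 0.
Hypothesis dP_ge0 : forall i (x y : P i), 0 <= dP x y.
Hypothesis dPC : forall i (x y : P i), dP x y = dP y x.

Lemma adj_ge0 a b l : adj a b l -> 0 <= l.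
Proof. by case=> i [x [y [_ _ ->]]]. Qed.

Lemma adjC a b l : adj a b l -> adj b a l.
Proof. by case=> i [x [y [-> -> ->]]]; exists i, y, x; split. Qed.

Lemma adj_refl a : adj a a 0.
Proof.
rewrite -[a]of_quotK; case: (of_quot a) => i x.
by exists i, x, x; split.
Qed.

Lemma qchain_ge0 n a b l : qchain n a b l -> 0 <= l.
Proof. by elim=> // *; apply: addr_ge0 => //; apply: adj_ge0; eassumption. Qed.

Lemma qchain_rev n a b l : qchain n a b l -> qchain n b a l.
Proof.
elim=> {n a b l} [a|n a b l e m _ IH /adjC h]; first exact: qchain0.
by rewrite addrC -add1n; apply: qchain_cat IH; exact: qchain1.
Qed.

Lemma qchain_fun n a b l : qchain n a b l -> exists (z : nat -> quot r) (m : nat -> R),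
  [/\ z 0%N = a, z n = b, forall i, (i < n)%N -> adj (z i) (z i.+1) (m i)
    & l = \sum_(i < n) m i].
Proof.
elim=> {n a b l} [a|n a b l e m _ [z [k [z0 zn hz ->]]] he].
  by exists (fun=> a), (fun=> 0); split => //; rewrite big_ord0.
exists (fun i => if (i <= n)%N then z i else e), (fun i => if (i < n)%N then k i else m).
split; rewrite ?ltnn//.
- by move=> i; rewrite ltnS /=; case: (ltngtP i n) => [ni|ni|->] // _; [exact: hz|rewrite zn].
- rewrite big_ord_recr /= ltnn; congr (_ + _); apply: eq_bigr => i _.
  by rewrite ltn_ord.
Qed.

Lemma fun_qchain n (z : nat -> quot r) (m : nat -> R) :
  (forall i, (i < n)%N -> adj (z i) (z i.+1) (m i)) ->
  qchain n (z 0%N) (z n) (\sum_(i < n) m i).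
Proof.
elim: n => [|n IH] h; first by rewrite big_ord0; exact: qchain0.
rewrite big_ord_recr /=; apply: qchainS (h n (leqnn _)).
by apply: IH => i ni; apply: h; exact: ltnW.
Qed.

Hypothesis conn : forall a b, exists n l, qchain n a b l.
Local Notation gd := (glue_dist dP (r := r)).

Let chains (a b : quot r) : set R := [set l | chain dP r (of_quot a) (of_quot b) l].

Let chainsE a b l : chains a b l <-> exists n, qchain n a b l.
Proof. by rewrite /chains /= chain_qchain !of_quotK. Qed.

Let has_inf_chains a b : has_inf (chains a b).
Proof.
split; first by have [n [l h]] := conn a b; exists l; apply/chainsE; exists n.
by exists 0 => l /chainsE[n]; exact: qchain_ge0.
Qed.

Lemma glue_dist_le n a b l : qchain n a b l -> gd a b <= l.
Proof.
move=> h; apply: ge_inf; first exact: (has_inf_chains a b).2.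
by apply/chainsE; exists n.
Qed.

Lemma glue_dist_lt a b l : gd a b < l -> exists n l', l' < l /\ qchain n a b l'.
Proof.
move=> h; have [k /chainsE[n hk] kl] := inf_lt (has_inf_chains a b).1 h.
by exists n, k.
Qed.

Lemma le_glue_dist a b k : (forall n l, qchain n a b l -> k <= l) -> k <= gd a b.
Proof.
move=> h; apply: lb_le_inf; [exact: (has_inf_chains a b).1|].
by move=> l /chainsE[n]; exact: h.
Qed.

Lemma glue_pseudo_metric : pseudo_metric gd.
Proof.
split.
- move=> a; apply: le_anti; rewrite (glue_dist_le (qchain0 a)) /=.
  by apply: le_glue_dist => n l; exact: qchain_ge0.
- by move=> a b; apply: le_glue_dist => n l; exact: qchain_ge0.
- move=> a b; apply: le_anti; apply/andP; split; apply: le_glue_dist => n l /qchain_rev;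
    exact: glue_dist_le.
- move=> b a e; rewrite leNgt; apply/negP => h.
  have [|n [l [h1 h2]]] := @glue_dist_lt a b (gd a b + (gd a e - gd a b - gd b e) / 2).
    by rewrite ltrDl divr_gt0//; lra.
  have [|m [k [h3 h4]]] := @glue_dist_lt b e (gd b e + (gd a e - gd a b - gd b e) / 2).
    by rewrite ltrDl divr_gt0//; lra.
  have := glue_dist_le (qchain_cat h2 h4); lra.
Qed.

Lemma qchain_lip (f : quot r -> R) n a b l :
  (forall a b l, adj a b l -> `|f a - f b| <= l) -> qchain n a b l -> `|f a - f b| <= l.
Proof.
move=> hf; elim=> {n a b l} [a|n a b l e m _ IH /hf h]; first by rewrite subrr normr0.
rewrite -(subrK (f b) (f a)) -addrA; apply: le_trans (ler_normD _ _) _.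
exact: lerD.
Qed.

Lemma glue_dist_lip (f : quot r -> R) a b :
  (forall a b l, adj a b l -> `|f a - f b| <= l) -> `|f a - f b| <= gd a b.
Proof. by move=> hf; apply: le_glue_dist => n l; exact: qchain_lip. Qed.

Lemma qchain_lpath (hp : forall a b l, adj a b l -> exists A, lpath gd a b l A) n a b l :
  qchain n a b l -> exists A, lpath gd a b l A.
Proof.
elim=> {n a b l} [a|n a b l e m _ [A IH] /hp[B h]].
  by exists [set a]; apply: lpath_refl; exact: glue_pseudo_metric.
by exists (A `|` B); apply: lpath_cat IH h; exact: glue_pseudo_metric.
Qed.

End Glue.

(** * Cayley graphs *)

Lemma min_ends_lip (R : realType) (u v x y : R) :
  `|Num.min (u + x) (v + 1 - x) - Num.min (u + y) (v + 1 - y)| <= `|x - y|.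
Proof.
rewrite ler_distl; have : x - y <= `|x - y| by exact: ler_norm.
have : y - x <= `|x - y| by rewrite distrC; exact: ler_norm.
by rewrite /Num.min; case: ifP => h1; case: ifP => h2 h3 h4; apply/andP; split; lra.
Qed.

Section CayleyGraph.
Local Open Scope classical_set_scope.
Local Open Scope ring_scope.
Variables (R : realType) (G : groupType) (S : seq G).
Local Notation piece := (@cay_piece R G S).
Local Notation pdist := (@cay_piece_dist R G S).
Local Notation glue := (@cay_glue R G S).
Local Notation cay := (cayley R S).
Local Notation cd := (@cayley_dist R G S).
Local Notation vtx := (cay_vertex R S).

Fact unit_interval0 : 0 <= (0 : R) <= 1. Proof. by rewrite lexx ler01. Qed.
Fact unit_interval1 : 0 <= (1 : R) <= 1. Proof. by rewrite lexx ler01. Qed.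
Let t0 : unit_interval R := exist _ 0 unit_interval0.
Let t1 : unit_interval R := exist _ 1 unit_interval1.

Lemma cay_piece_dist_ge0 i (x y : piece i) : 0 <= pdist x y.
Proof. by case: i x y => /=. Qed.

Lemma cay_piece_dist0 i (x : piece i) : pdist x x = 0.
Proof. by case: i x => //= [[g s]] x; rewrite subrr normr0. Qed.

Lemma cay_piece_distC i (x y : piece i) : pdist x y = pdist y x.
Proof. by case: i x y => //= [[g s]] x y; rewrite distrC. Qed.

Definition cay_edge (g : G) (s : seq_sub S) (t : unit_interval R) : cay :=
  to_quot _ (cay_edge_pt g s t).

Lemma cay_edge0 g s t : val t = 0 -> cay_edge g s t = vtx g.
Proof. by move=> h; apply/to_quotP; apply: eqv_base; exact: cay_glue0. Qed.

Lemma cay_edge1 g s t : val t = 1 -> cay_edge g s t = vtx (g * val s)%g.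
Proof. by move=> h; apply/to_quotP; apply: eqv_base; exact: cay_glue1. Qed.

Lemma adj_cay_edge g s t u : adj pdist (r := glue) (cay_edge g s t) (cay_edge g s u)
  `|val t - val u|.
Proof. by exists (inr (g, s)), t, u. Qed.

Lemma cay_ind (P : cay -> Prop) : (forall g, P (vtx g)) ->
  (forall g s t, P (cay_edge g s t)) -> forall a, P a.
Proof.
move=> hv he a; rewrite -[a]of_quotK; case: (of_quot a) => -[g|[g s]] x /=.
  by case: x; exact: hv.
exact: he.
Qed.

Hypothesis gen : generates S.

Lemma adj_letter g (l : G * bool) : l.1 \in S ->
  qchain pdist (r := glue) 1 (vtx g) (vtx (g * letter l)%g) 1.
Proof.
case: l => s [] /= sS; apply: qchain1; rewrite /letter /=.
- have := adj_cay_edge g (SeqSub sS) t0 t1.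
  by rewrite cay_edge0// cay_edge1//= sub0r normrN normr1.
- have := adj_cay_edge (g * s^-1)%g (SeqSub sS) t1 t0.
  by rewrite (@cay_edge0 _ _ t0)// (@cay_edge1 _ _ t1)//= subr0 normr1 mulgVK.
Qed.

Lemma qchain_word g w : all (fun a => a.1 \in S) w ->
  qchain pdist (r := glue) (size w) (vtx g) (vtx (g * wprod w)%g) (size w)%:R.
Proof.
elim: w g => [|l w IH] g /=; first by move=> _; rewrite /wprod big_nil mulg1; exact: qchain0.
move=> /andP[/(adj_letter g) h1 /(IH (g * letter l)%g) h2].
rewrite /wprod big_cons mulgA -add1n natrD; exact: qchain_cat h1 h2.
Qed.

Lemma qchain_vertices g h : qchain pdist (r := glue) (wd S g h) (vtx g) (vtx h) (wd S g h)%:R.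
Proof.
rewrite /wd; have [w [Sw <- e]] := wlen_ex gen (g^-1 * h)%g.
by have := qchain_word g Sw; rewrite e mulVKg.
Qed.

Lemma near_vertex (a : cay) : exists g l, l <= 1 /\ qchain pdist (r := glue) 1 a (vtx g) l.
Proof.
elim/cay_ind: a => [g|g s t]; exists g.
  by exists 0; split=> //; apply: qchain1; apply: (adj_refl cay_piece_dist0).
exists `|val t - val t0|; split.
  by case: t => t /= /andP[h1 h2]; rewrite subr0 ger0_norm.
by apply: qchain1; rewrite -(@cay_edge0 g s t0)//; exact: adj_cay_edge.
Qed.

Lemma cay_connected (a b : cay) : exists n l, qchain pdist (r := glue) n a b l.
Proof.
have [g [l [_ hg]]] := near_vertex a; have [h [k [_ hh]]] := near_vertex b.
exists (1 + wd S g h + 1)%N, (l + (wd S g h)%:R + k).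
apply: qchain_cat (qchain_rev cay_piece_distC hh).
exact: qchain_cat hg (qchain_vertices g h).
Qed.

Lemma cayley_pm : pseudo_metric cd.
Proof.
exact: (glue_pseudo_metric cay_piece_dist_ge0 cay_piece_distC cay_connected).
Qed.

Lemma cayley_dist_le n a b l : qchain pdist (r := glue) n a b l -> cd a b <= l.
Proof.
exact: (glue_dist_le cay_piece_dist_ge0 cay_connected).
Qed.

Lemma near_vertex_dist (a : cay) : exists g, cd a (vtx g) <= 1.
Proof.
have [g [l [l1 h]]] := near_vertex a; exists g; apply: le_trans l1.
exact: cayley_dist_le h.
Qed.

(* The distance from the vertex g0: being 1-Lipschitz on each piece, it bounds [cayley_dist]
   from below. *)
Definition cay_height (g0 : G) (p : {i & piece i}) : R :=
  match p with
  | existT (inl h) _ => (wd S g0 h)%:R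
  | existT (inr (h, s)) t =>
      Num.min ((wd S g0 h)%:R + val t) ((wd S g0 (h * val s)%g)%:R + 1 - val t)
  end.

Lemma wd_edge g0 h s : s \in S -> (wd S g0 h <= wd S g0 (h * s)%g + 1)%N /\
  (wd S g0 (h * s)%g <= wd S g0 h + 1)%N.
Proof.
move=> sS; have [_ _ C T] := wd_metric gen.
have e : (wd S h (h * s)%g <= 1)%N by rewrite /wd mulKg; exact: wlen_letter.
by have := T g0 h (h * s)%g; have := T g0 (h * s)%g h; rewrite (C (h * s)%g h); lia.
Qed.

Lemma cay_height_glue g0 p q : eqv_gen glue p q -> cay_height g0 p = cay_height g0 q.
Proof.
elim=> {p q} [_ _ [h s t ht|h s t ht]|//|p q _ -> //|p q u _ -> _ -> //] /=; rewrite ht.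
- rewrite addr0 subr0; apply/min_idPl; rewrite natr1 ler_nat -addn1.
  exact: (wd_edge _ _ (ssvalP s)).1.
- rewrite addrK; apply/min_idPr; rewrite natr1 ler_nat -addn1.
  exact: (wd_edge _ _ (ssvalP s)).2.
Qed.

Lemma cayley_dist_vertex g h : cd (vtx g) (vtx h) = (wd S g h)%:R.
Proof.
apply: le_anti; rewrite (cayley_dist_le (qchain_vertices g h)) /=.
pose f (a : cay) := cay_height g (of_quot a).
have fE p : f (to_quot _ p) = cay_height g p.
  by apply: cay_height_glue; exact: eqv_of_quot.
have := @glue_dist_lip R _ _ pdist glue cay_piece_dist_ge0 cay_connected f (vtx g) (vtx h).
rewrite !fE /= {1}/wd mulVg wlen1// sub0r normrN ger0_norm ?ler0n//; apply.
move=> a b l [[k|[k s]] [x [y [-> -> ->]]]]; rewrite !fE /=.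
  by rewrite subrr normr0.
exact: min_ends_lip.
Qed.

Lemma edge_lpath g (l : G * bool) : l.1 \in S ->
  exists A, lpath cd (vtx g) (vtx (g * letter l)%g) 1 A.
Proof.
case: l => s b /= sS.
pose clip (t : R) : unit_interval R := if pselect (0 <= t <= 1) is left h then exist _ t h else t0.
have clipE (t : R) : 0 <= t <= 1 -> val (clip t) = t by rewrite /clip; case: pselect.
rewrite /letter /=; case: b.
- pose c t := cay_edge g (SeqSub sS) (clip t).
  exists (c @` `[0, 1]); split=> //; exists c; split=> //.
  + by rewrite /c cay_edge0// clipE// unit_interval0.
  + by rewrite /c cay_edge1//= clipE// unit_interval1.
  + move=> x y; rewrite !in_itv /= => hx hy.
    by have := cayley_dist_le (qchain1 (adj_cay_edge g (SeqSub sS) (clip x) (clip y)));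
      rewrite !clipE.
- pose c t := cay_edge (g * s^-1)%g (SeqSub sS) (clip (1 - t)).
  have h1 (t : R) : 0 <= t <= 1 -> 0 <= 1 - t <= 1 by move=> /andP[? ?]; apply/andP; split; lra.
  exists (c @` `[0, 1]); split=> //; exists c; split=> //.
  + by rewrite /c cay_edge1//= ?mulgVK// subr0 clipE// unit_interval1.
  + by rewrite /c cay_edge0//= subrr clipE// unit_interval0.
  + move=> x y; rewrite !in_itv /= => hx hy.
    have := adj_cay_edge (g * s^-1)%g (SeqSub sS) (clip (1 - x)) (clip (1 - y)).
    move/qchain1/cayley_dist_le.
    by rewrite !clipE ?h1// (_ : 1 - x - (1 - y) = y - x) 1?distrC; last by lra.
Qed.

Lemma word_lpath g w : all (fun a => a.1 \in S) w -> exists A,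
  lpath cd (vtx g) (vtx (g * wprod w)%g) (size w)%:R A /\
  forall i, (i <= size w)%N -> A (vtx (g * wprod (take i w))%g).
Proof.
elim: w g => [|l w IH] g /=.
  exists [set vtx g]; rewrite /wprod big_nil mulg1; split.
    exact: (lpath_refl cayley_pm).
  by move=> i _; rewrite ?big_nil ?mulg1.
move=> /andP[/(edge_lpath g)[A hA] /(IH (g * letter l)%g)[B [hB1 hB2]]].
exists (A `|` B); rewrite /wprod big_cons mulgA -add1n natrD; split.
  exact: (lpath_cat cayley_pm hA hB1).
case=> [_|i iw] /=; first by rewrite big_nil mulg1; left; exact: (lpath_ends hA).1.
by rewrite big_cons mulgA; right; exact: hB2.
Qed.

(** Quasiconvexity speaks of segments in the realization; this one carries a word geodesic on its
    vertices, where the discrete arguments apply. *)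
Lemma geodesic_through_vertices g h : exists (z : nat -> G) A,
  [/\ z 0%N = g, z (wd S g h) = h,
     forall i j, (i <= j <= wd S g h)%N -> wd S (z i) (z j) = (j - i)%N,
     geodesic_segment cd (vtx g) (vtx h) A & forall i, (i <= wd S g h)%N -> A (vtx (z i))].
Proof.
have [w [Sw sw e]] := wlen_ex gen (g^-1 * h)%g; have [A [hA1 hA2]] := word_lpath g Sw.
have eh : (g * wprod w)%g = h by rewrite e mulVKg.
have hd : wd S g h = size w by rewrite sw.
rewrite eh -hd -cayley_dist_vertex in hA1.
pose z i := (g * wprod (take i w))%g.
have zl i j : (i <= j <= size w)%N -> (wd S (z i) (z j) <= j - i)%N.
  move=> /andP[ij jw]; rewrite /z wd_mull /wd -{1}(cat_take_drop i (take j w)).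
  rewrite take_takel// wprod_cat mulKg; apply: leq_trans (wlen_min _) _.
    have : all (fun a => a.1 \in S) (take j w ++ drop j w) by rewrite cat_take_drop.
    rewrite all_cat => /andP[+ _]; rewrite -{1}(cat_take_drop i (take j w)) all_cat.
    by case/andP.
  by rewrite size_drop size_take; case: ifP; lia.
have z0 : z 0%N = g by rewrite /z take0 /wprod big_nil mulg1.
have zn : z (size w) = h by rewrite /z take_size.
exists z, A; rewrite hd; split=> //.
- move=> i j /andP[ij jw]; apply/eqP; rewrite eqn_leq zl ?ij//=.
  have := zl 0%N i; have := zl j (size w); rewrite leqnn jw (leq_trans ij jw) zn z0.
  have [_ _ _ T] := wd_metric gen; have := T g (z i) h; have := T (z i) (z j) h.
  by rewrite hd => h1 h2 /(_ isT) h3 /(_ isT) h4; lia.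
- exact: (lpath_segment cayley_pm hA1).
Qed.

Lemma cayley_hyp_graph : hyperbolic cd -> exists c, hyp_graph (wd S) c.
Proof.
move=> hyp; have [K hK] := hyperbolic_gromov_ineq cayley_pm hyp.
have [c hc] := nat_bound (2 * K); exists c; split; first exact: wd_geo.
move=> x y z w; have := hK (vtx w) (vtx x) (vtx y) (vtx z).
rewrite /gromov_prod !cayley_dist_vertex; have [_ _ C _] := wd_metric gen.
rewrite ge_min => /orP h.
have : (wd S x y + wd S z w <= wd S x z + wd S y w + c)%N \/
       (wd S x y + wd S z w <= wd S x w + wd S y z + c)%N.
  by case: h => h; [left|right]; rewrite -(ler_nat R) !natrD ?(C y z); lra.
by move: (wd S) => d; lia.
Qed.

(** A point of a segment is within 1 of a vertex, which is between the ends up to an error 2, so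
    [btw_near] finds a point of the interval within [2 + c] of it. *)
Lemma quasiconvex_of_btw c (H : set G) (K : nat) : hyp_graph (wd S) c ->
  (forall x y p, H x -> H y -> btw (wd S) x y p -> exists2 k, H k & (wd S p k <= K)%N) ->
  quasiconvex_in R S H.
Proof.
move=> hg hK; exists (1 + (2 + c + K)%:R) => x y A Hx Hy gA a Aa.
have [g ag] := near_vertex_dist a; have ab := segment_btw cayley_pm gA Aa.
have T := pmT cayley_pm; have C := pmC cayley_pm.
have [p p1 p2] : exists2 p, btw (wd S) x y p & (wd S g p <= 2 + c)%N.
  apply: (btw_near hg); rewrite -(ler_nat R) !natrD -!cayley_dist_vertex.
  have := T a (vtx x) (vtx g); have := T a (vtx g) (vtx y); rewrite (C (vtx g) a); lra.
have [k Hk pk] := hK x y p Hx Hy p1; exists k => //.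
have : (wd S g k <= 2 + c + K)%N by have := geodT hg p g k; lia.
rewrite -(ler_nat R) -cayley_dist_vertex; have := T (vtx g) a (vtx k); lra.
Qed.

End CayleyGraph.

(** The generating set that witnesses quasiconvexity is not under control. Moving the vertices of a
    geodesic to nearby elements of H gives a sequence in H whose indices measure distance up to
    constants, a property that survives a change of generators. *)
Lemma quasiconvex_sequences (R : realType) (G : groupType) (H : set G) (S : seq G) :
  quasiconvex R H -> generates S ->
  exists A : nat, forall x y, H x -> H y -> exists n (z : nat -> G),
    [/\ z 0%N = x, z n = y, forall i, (i <= n)%N -> H (z i) &
    forall i j, (i <= j <= n)%N -> (wd S (z i) (z j) <= A * (j - i) + A)%N /\
      (j - i <= A * wd S (z i) (z j) + A)%N].
Proof.
move=> [S' gen' [K hK]] gen; have [k Kk] := nat_bound K.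
have [L hL] := wd_change gen' gen; have [L' hL'] := wd_change gen gen'.
have [W0 _ C T] := wd_metric gen'.
exists ((L + L') * (2 * k) + L + L' + 2 * k)%N => x y Hx Hy.
have [v [A [v0 vn vd gA vA]]] := geodesic_through_vertices R gen' x y.
set n := wd S' x y in vn vd vA *.
have near i : (i <= n)%N -> exists h, [/\ H h, (wd S' (v i) h <= k)%N, (i = 0%N -> h = x)
    & (i = n -> h = y)].
  move=> ni; have [h Hh hv] := hK _ _ _ Hx Hy gA _ (vA i ni).
  have vh : (wd S' (v i) h <= k)%N.
    by rewrite -(ler_nat R) -cayley_dist_vertex//; exact: le_trans hv Kk.
  have [i0|i0] := eqVneq i 0%N.
    exists x; split=> //; first by rewrite i0 v0 W0.
    by move=> e; rewrite -vn -e i0 v0.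
  have [inn|inn] := eqVneq i n.
    by exists y; split; rewrite ?inn ?vn ?W0// -inn => /eqP; rewrite (negPf i0).
  by exists h; split=> // e; [rewrite e eqxx in i0|rewrite e eqxx in inn].
have [z hz] : exists z : nat -> G, forall i, (i <= n)%N ->
    [/\ H (z i), (wd S' (v i) (z i) <= k)%N, (i = 0%N -> z i = x) & (i = n -> z i = y)].
  have [|z hz] := @choice _ _ (fun i h => (i <= n)%N -> [/\ H h, (wd S' (v i) h <= k)%N,
      (i = 0%N -> h = x) & (i = n -> h = y)]); last by exists z.
  move=> i; case: (leqP i n) => [/near[h hh]|ni]; first by exists h.
  by exists x.
exists n, z; split.
- by have [_ _ h _] := hz 0%N (leq0n _); exact: h.
- by have [_ _ _ h] := hz n (leqnn _); exact: h.
- by move=> i /hz[].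
- move=> i j /andP[ij jn]; have in_ := leq_trans ij jn.
  have [_ zi _ _] := hz i in_; have [_ zj _ _] := hz j jn.
  have e := vd i j; rewrite ij jn in e; have {}e := e isT.
  have h1 := T (z i) (v i) (z j); have h2 := T (v i) (v j) (z j).
  have h3 := T (v i) (z i) (v j); have h4 := T (z i) (z j) (v j).
  rewrite (C (z i) (v i)) in h1; rewrite (C (z j) (v j)) in h4.
  have a1 : (wd S' (z i) (z j) <= (j - i) + 2 * k)%N by lia.
  have a2 : (j - i <= wd S' (z i) (z j) + 2 * k)%N by lia.
  have b1 := leq_trans (hL (z i) (z j)) (leq_mul (leqnn L) a1).
  have b2 := leq_trans a2 (leq_add (hL' (z i) (z j)) (leqnn _)).
  move: b1 b2; move: (j - i)%N (wd S _ _) => m w {a1 a2 h1 h2 h3 h4 e} b1 b2.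
  by rewrite !mulnDr in b1; rewrite !mulnDl; split; lia.
Qed.

Section CayleyCT.
Local Open Scope classical_set_scope.
Local Open Scope ring_scope.
Variables (R : realType) (H G : groupType) (f : H -> G) (S1 : seq H) (S : seq G).
Variable fS : {in S1, forall s, f s \in S}.
Hypotheses (fM : {morph f : x y / (x * y)%g}) (gen1 : generates S1) (gen : generates S).
Local Notation v1 := (cay_vertex R S1).
Local Notation v := (cay_vertex R S).

Lemma cayley_map_vertex g : cayley_map (R := R) fS (cay_vertex R S1 g) = cay_vertex R S (f g).
Proof. by rewrite /cay_vertex cayley_mapE. Qed.

Lemma near_vertex_map (a : cayley R S1) : exists g,
  cayley_dist a (cay_vertex R S1 g) <= 1 /\
  cayley_dist (cayley_map fS a) (cay_vertex R S (f g)) <= 1.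
Proof.
elim/cay_ind: a => [g|g s t]; exists g.
  by rewrite cayley_map_vertex !(pm0 (cayley_pm _ _)).
have key (G' : groupType) (S' : seq G') (g' : G') s' : generates S' ->
    cayley_dist (cay_edge g' s' t) (cay_vertex R S' g') <= 1.
  move=> gen'; have h0 := unit_interval0 R.
  rewrite -(@cay_edge0 R _ S' g' s' (exist _ 0 h0))//.
  apply: le_trans (cayley_dist_le gen' (qchain1 (adj_cay_edge _ _ _ _))) _.
  by case: t => t /= /andP[h1 h2]; rewrite subr0 ger0_norm.
split; first exact: key.
by rewrite /cay_edge cayley_mapE//=; exact: key.
Qed.

(** Points and their images are within 1 of corresponding vertices, which changes each product by at
    most 2. *)
Lemma cayley_map_CT :
  (forall M : R, exists N, forall x y : H,
     N <= gromov_prod (@cayley_dist R H S1) (v1 1%g) (v1 x) (v1 y) ->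
     M <= gromov_prod (@cayley_dist R G S) (v 1%g) (v (f x)) (v (f y))) ->
  admits_CT (@cayley_dist R H S1) (@cayley_dist R G S) (cayley_map fS).
Proof.
move=> h; have p1 := cayley_pm R gen1; have p := cayley_pm R gen.
apply: (gromov_proper_CT p _ (cay_vertex R S1 1%g)).
apply: (gromov_proper_of_base p1 p (y0 := cay_vertex R S1 1%g)) => M.
have [N hN] := h (M + 2); exists (N + 2) => x y xy.
have [g [xg fxg]] := near_vertex_map x; have [k [yk fyk]] := near_vertex_map y.
rewrite cayley_map_vertex (morph1 fM).
have := gromov_prod_diff p1 (v1 1%g) x y (v1 1%g) (v1 g) (v1 k).
have := gromov_prod_diff p (v 1%g) (v (f g)) (v (f k)) (v 1%g)
  (cayley_map fS x) (cayley_map fS y).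
rewrite !(pm0 p) !(pm0 p1) (pmC p _ (cayley_map fS x)) (pmC p _ (cayley_map fS y)) => h1 h2.
have := hN g k.
have h3 : N <= gromov_prod (@cayley_dist R H S1) (v1 1%g) (v1 g) (v1 k) by lra.
by move=> /(_ h3); lra.
Qed.

End CayleyCT.

(** * Euclidean coordinates and the fundamental group *)

Lemma fin_bound (I : finType) (P : I -> nat -> Prop) :
  (forall i n m, (n <= m)%N -> P i n -> P i m) -> (forall i, exists n, P i n) ->
  exists n, forall i, P i n.
Proof.
move=> mono h; have [f hf] := choice h; exists (\sum_i f i)%N => i.
by apply: mono (hf i); rewrite (bigD1 i)//= leq_addr.
Qed.

Lemma fin_pos_bound (R : realType) (I : finType) (f : I -> R) : (forall i, 0 <= f i) ->
  exists2 e, 0 < e & forall i, f i != 0 -> e < f i.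
Proof.
move=> f0; exists ((\big[Order.min/1]_(i | f i != 0) f i) / 2).
  rewrite divr_gt0//; apply: lt_bigmin => // i fi.
  by rewrite lt_def fi f0.
move=> i fi; have := @bigmin_le_cond _ _ I 1 i (fun i => f i != 0) f fi.
have : 0 < f i by rewrite lt_def fi f0.
by move: (\big[_/_]_(_ | _) _) => m h1 h2; apply: le_lt_trans (_ : f i / 2 < _); lra.
Qed.

Section Euclid.
Variables (R : realType) (V : finType).
Implicit Types f g h : V -> R.

Definition eucl f g : R := Num.sqrt (\sum_v (f v - g v) ^+ 2).

Lemma eucl_ge0 f g : 0 <= eucl f g. Proof. exact: sqrtr_ge0. Qed.

Lemma euclxx f : eucl f f = 0.
Proof. by rewrite /eucl big1 ?sqrtr0// => v _; rewrite subrr expr0n. Qed.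

Lemma euclC f g : eucl f g = eucl g f.
Proof. by congr Num.sqrt; apply: eq_bigr => v _; rewrite -sqrrN opprB. Qed.

Lemma sumsq_ge0 (u : V -> R) : 0 <= \sum_v u v ^+ 2.
Proof. by apply: sumr_ge0 => v _; exact: sqr_ge0. Qed.

Lemma eucl_coord f g v : `|f v - g v| <= eucl f g.
Proof.
rewrite -sqrtr_sqr ler_wsqrtr// (bigD1 v)//= lerDl.
by apply: sumr_ge0 => w _; exact: sqr_ge0.
Qed.

Lemma cauchy_schwarz (u w : V -> R) :
  \sum_v u v * w v <= Num.sqrt (\sum_v u v ^+ 2) * Num.sqrt (\sum_v w v ^+ 2).
Proof.
set a := \sum_v u v ^+ 2; set b := \sum_v w v ^+ 2; set p := \sum_v _.
have a0 : 0 <= a by exact: sumsq_ge0.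
have b0 : 0 <= b by exact: sumsq_ge0.
rewrite -sqrtrM//; apply: le_trans (ler_norm _) _; rewrite -sqrtr_sqr ler_wsqrtr//.
have h (x y : R) : 0 <= x ^+ 2 * a - 2 * x * y * p + y ^+ 2 * b.
  have -> : x ^+ 2 * a - 2 * x * y * p + y ^+ 2 * b = \sum_v (x * u v - y * w v) ^+ 2.
    rewrite /a /b /p !mulr_sumr -sumrB -big_split /=; apply: eq_bigr => v _; ring.
  exact: sumsq_ge0.
(* For b = 0 the values x = p and y = (a + 1) / 2 turn the form h into -p^2. *)
have [b00|bn0] := eqVneq b 0.
  by have := h p ((a + 1) / 2); rewrite b00 !mulr0 addr0; nra.
have bp : 0 < b by rewrite lt_def bn0.
rewrite -(ler_pM2l bp) -subr_ge0; apply: le_trans (h b p) _; rewrite le_eqVlt; apply/orP; left.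
by apply/eqP; ring.
Qed.

Lemma eucl_triangle g f h : eucl f h <= eucl f g + eucl g h.
Proof.
rewrite -[leRHS]ger0_norm ?addr_ge0 ?eucl_ge0// -sqrtr_sqr ler_wsqrtr//.
rewrite sqrrD !sqr_sqrtr ?sumsq_ge0//.
have -> : \sum_v (f v - h v) ^+ 2 = \sum_v (f v - g v) ^+ 2 +
    (\sum_v (f v - g v) * (g v - h v)) *+ 2 + \sum_v (g v - h v) ^+ 2.
  by rewrite -sumrMnl -!big_split /=; apply: eq_bigr => v _; ring.
by rewrite lerD2r lerD2l lerMn2r cauchy_schwarz orbT.
Qed.

Lemma eucl_le_sup f g e : (forall v, `|f v - g v| <= e) -> eucl f g <= #|V|%:R * e.
Proof.
move=> h; have [V0|V0] := eqVneq #|V| 0%N.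
  rewrite /eucl big1 ?sqrtr0 ?V0 ?mul0r// => v _.
  by have := card0_eq V0 v.
have [v _|V1] := pickP (@predT V); last by move: V0; rewrite eq_card0.
have e0 : 0 <= e := le_trans (normr_ge0 _) (h v).
rewrite -[leRHS]ger0_norm ?mulr_ge0// -sqrtr_sqr ler_wsqrtr//.
apply: (@le_trans _ _ (\sum_(v : V) e ^+ 2)).
  by apply: ler_sum => w _; rewrite -[leLHS]real_normK ?num_real// ler_sqr ?nnegrE.
rewrite sumr_const -[_ *+ _]mulr_natl exprMn; apply: ler_wpM2r; first exact: sqr_ge0.
rewrite -natrX ler_nat -mulnn.
by rewrite leq_pmulr// lt0n.
Qed.

Lemma eucl_affine f g s t : eucl (fun v => f v + s * (g v - f v)) (fun v => f v + t * (g v - f v)) =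
  `|s - t| * eucl f g.
Proof.
rewrite /eucl -sqrtr_sqr -sqrtrM ?sqr_ge0//; congr Num.sqrt; rewrite mulr_sumr.
by apply: eq_bigr => v _; ring.
Qed.

End Euclid.

Section Pi1Relations.
Variables (V : finType) (K : {set {set V}}) (Y : complex_of_groups K).
Variable T : {set {set V} * {set V}}.
Local Notation G := (pi1 Y T).
Local Notation loc s a := (pi1_loc Y T s a).
Local Notation ked e := (pi1_edge Y T e).
Local Open Scope group_scope.

Lemma pi1_mulE u w : (to_quot _ u : G) * (to_quot _ w : G) = to_quot _ (u ++ w).
Proof. exact: pmulE. Qed.

Lemma pi1_invE u : (to_quot _ u : G)^-1 = to_quot _ (winv u).
Proof. exact: pinvE. Qed.

Lemma pi1_relE u w : pi1_rel (Y := Y) T u w -> to_quot _ u = to_quot _ w :> G.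
Proof.
move=> h; apply/to_quotP; apply: eqv_base.
by have := @pres_rel _ (pi1_rel (Y := Y) T) [::] [::] _ _ h; rewrite /= !cats0.
Qed.

Lemma pi1_locM s (a b : Y s) : loc s (a * b) = loc s a * loc s b.
Proof. by rewrite /pi1_loc /pgen pi1_mulE /=; apply/esym/pi1_relE/rel_loc. Qed.

Lemma pi1_loc1 s : loc s 1 = 1.
Proof.
by have /(congr1 ( *%g (loc s 1)^-1)) := pi1_locM (1 : Y s) 1; rewrite mulg1 mulKg mulVg.
Qed.

Lemma pi1_locV s (a : Y s) : loc s a^-1 = (loc s a)^-1.
Proof. by symmetry; apply: mulg1_eq; rewrite -pi1_locM mulgV pi1_loc1. Qed.

Lemma pi1_conj s t (e : edge s t) (a : Y s) :
  ked e * loc s a * (ked e)^-1 = loc t (psi Y e a).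
Proof.
rewrite /pi1_loc /pi1_edge /pgen pi1_invE.
rewrite (pi1_mulE [:: (GEdge Y e, true)] [:: (GLoc a, true)]) pi1_mulE.
exact: (pi1_relE (rel_conj T e a)).
Qed.

Lemma pi1_comp s t u (e' : edge s t) (e : edge t u) (ee' : edge s u) :
  ked e * ked e' = loc u (twist Y e' e) * ked ee'.
Proof.
rewrite /pi1_loc /pi1_edge /pgen !pi1_mulE /=.
exact/pi1_relE/rel_comp.
Qed.

Lemma pi1_tree s t (e : edge s t) : (val s, val t) \in T -> ked e = 1.
Proof. by move=> h; rewrite /pi1_edge /pgen; apply: (pi1_relE (rel_tree Y e h)). Qed.

Lemma edge_irr (s t : simplex K) (e e' : edge s t) : e = e'.
Proof. exact: bool_irrelevance. Qed.

Inductive step_elt : G -> Prop :=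
| step_loc s a : step_elt (loc s a)
| step_edge s t (e : edge s t) : step_elt (ked e)
| step_edgeV s t (e : edge s t) : step_elt (ked e)^-1.

(** Length over the possibly infinite set of local elements and edge symbols, as in a coned-off
    Cayley graph. It is comparable with the orbit distance, by [orbit_dist_prod] and
    [prod_of_orbit_dist]. *)
Inductive prod_len : nat -> G -> Prop :=
| prod_len0 : prod_len 0 1
| prod_lenS n x y : prod_len n x -> step_elt y -> prod_len n.+1 (x * y).

Lemma prod_len_inv n z : prod_len n z ->
  if n is m.+1 then exists x y, [/\ prod_len m x, step_elt y & z = x * y] else z = 1.
Proof. by case=> // m x y hx hy; exists x, y. Qed.

Lemma prod_len_cat n x m y : prod_len n x -> prod_len m y -> prod_len (n + m) (x * y).
Proof.
move=> hx; elim=> [|{}m {}y z _ IH hz]; first by rewrite addn0 mulg1.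
by rewrite addnS mulgA; apply: prod_lenS.
Qed.

Lemma prod_len1 y : step_elt y -> prod_len 1 y.
Proof. by move=> h; rewrite -[y]mul1g; apply: prod_lenS => //; exact: prod_len0. Qed.

Lemma step_eltV y : step_elt y -> step_elt y^-1.
Proof.
case=> *; rewrite ?invgK; [|exact: step_edgeV|exact: step_edge].
by rewrite -pi1_locV; exact: step_loc.
Qed.

Lemma prod_len_all x : exists n, prod_len n x.
Proof.
rewrite -[x]of_quotK; elim: (of_quot x) => [|[a b] w [n IH]].
  by exists 0%N; exact: prod_len0.
exists (1 + n)%N.
have -> : to_quot _ ((a, b) :: w) = (to_quot _ [:: (a, b)] : G) * (to_quot _ w : G).
  by rewrite pi1_mulE.
apply: prod_len_cat IH; apply: prod_len1.
have pos : step_elt (to_quot _ [:: (a, true)] : G).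
  by case: a => [s a|s t e]; [exact: (@step_loc s a)|exact: (@step_edge s t e)].
case: b => //; have := step_eltV pos; rewrite pi1_invE.
by [].
Qed.

End Pi1Relations.

(** * The metric of the development *)

Section Development.
Variables (R : realType) (V : finType) (K : {set {set V}}) (Y : complex_of_groups K).
Variable T : {set {set V} * {set V}}.
Local Notation G := (pi1 Y T).
Local Notation B := (development R Y T).
Local Notation dB := (dev_dist R Y T).
Local Notation glue := (@dev_glue V R K Y T).
Local Notation piece := (@dev_piece V R K Y T).
Local Notation pdist := (fun i : G * simplex K => @std_dist V R (val i.2)).
Local Notation dpt g x := (@dev_pt V R K Y T g _ x).
Local Notation bp g x := (to_quot glue (dpt g x) : B).

Definition barycentric (f : {ffun V -> R}) : Prop := (forall v, 0 <= f v) /\ \sum_v f v = 1.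

Definition in_simplex (f : {ffun V -> R}) (s : {set V}) : bool :=
  [&& [forall v, 0 <= f v], [forall v, (f v != 0) ==> (v \in s)] & \sum_v f v == 1].

Definition subsupp (f g : {ffun V -> R}) : Prop := forall v, f v != 0 -> g v != 0.

Lemma in_simplexP f (s : {set V}) :
  reflect (barycentric f /\ forall v, f v != 0 -> v \in s) (in_simplex f s).
Proof.
apply: (iffP and3P).
  move=> [/forallP h1 /forallP h2 /eqP h3]; split; first by split.
  by move=> v fv; have := h2 v; rewrite fv.
move=> [[h1 h3] h2]; split; [exact/forallP| |exact/eqP].
by apply/forallP => v; apply/implyP; exact: h2.
Qed.

Definition pt_coord (p : {i & piece i}) : {ffun V -> R} := val (projT2 p).
(** The projection of [B] to the realization of the complex; gluing preserves coordinates, so the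
    choice of representative is harmless. *)
Definition bcoord (a : B) : {ffun V -> R} := pt_coord (of_quot a).

Definition recoord (p : {i & piece i}) f (h : in_simplex f (val (projT1 p).2)) :
    {i & piece i} :=
  existT piece (projT1 p) (exist _ f h).

(** Each gluing also identifies the points with coordinates f in the two pieces, if f is supported
    where p is. The coordinates are constant along a sequence of gluings, so every intermediate
    piece contains such a point. *)
Lemma recoord_eqv p q : eqv_gen glue p q -> pt_coord p = pt_coord q /\
  forall f, subsupp f (pt_coord p) ->
  forall hp hq, eqv_gen glue (@recoord p f hp) (@recoord q f hq).
Proof.
elim=> {p q}.
- move=> _ _ [g s a x|g s t e x x' xx']; split=> // f _ hp hq.
  + rewrite (bool_irrelevance hq hp); apply: eqv_base.
    exact: (dev_glue_loc g a (exist _ f hp)).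
  + apply: eqv_base; exact: (@dev_glue_face _ _ _ _ _ g s t e (exist _ f hp) (exist _ f hq)).
- move=> p; split=> // f _ hp hq; rewrite (bool_irrelevance hq hp); exact: eqv_refl.
- move=> p q _ [e h]; split=> // f fq hp hq; apply: eqv_sym; apply: h.
  by rewrite e.
- move=> p m q _ [e1 h1] _ [e2 h2]; split; first by rewrite e1.
  move=> f fp hp hq.
  have hm : in_simplex f (val (projT1 m).2).
    have /in_simplexP[bf _] := hp; apply/in_simplexP; split=> // v /fp.
    rewrite e1; have /in_simplexP[_ hm] := valP (projT2 m); exact: hm.
  apply: eqv_trans (h1 f fp hp hm) (h2 f _ hm hq).
  by rewrite -e1.
Qed.

Lemma bcoordE g s (x : std_simplex R (val s)) : bcoord (bp g x) = val x.
Proof. by have [h _] := recoord_eqv (eqv_of_quot glue (dpt g x)); exact: h. Qed.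

Lemma bary_coord a : barycentric (bcoord a).
Proof. by have /in_simplexP[h _] := valP (projT2 (of_quot a)). Qed.

Lemma development_ind (P : B -> Prop) : (forall g s (x : std_simplex R (val s)), P (bp g x)) ->
  forall a, P a.
Proof. by move=> h a; rewrite -[a]of_quotK; case: (of_quot a) => -[g s] x; exact: h. Qed.

Lemma bp_recoord g s (x : std_simplex R (val s)) h t (y : std_simplex R (val t)) f
    (hs : in_simplex f (val s)) (ht : in_simplex f (val t)) :
  bp g x = bp h y -> subsupp f (val x) ->
  bp g (exist _ f hs : std_simplex R (val s)) = bp h (exist _ f ht : std_simplex R (val t)).
Proof.
move=> /to_quotP e fx; apply/to_quotP.
exact: (recoord_eqv e).2 f fx hs ht.
Qed.

Definition joined (a b : B) : Prop := exists g s (x y : std_simplex R (val s)),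
  a = bp g x /\ b = bp g y.

Lemma adj_joined a b l : adj pdist a b l <-> joined a b /\ l = eucl (bcoord a) (bcoord b).
Proof.
split.
  move=> [[g s] [x [y [-> -> ->]]]]; split; first by exists g, s, x, y.
  by rewrite !bcoordE.
move=> [[g [s [x [y [-> ->]]]]] ->]; exists (g, s), x, y; split=> //.
by rewrite !bcoordE.
Qed.

Lemma joinedC a b : joined a b -> joined b a.
Proof. by move=> [g [s [x [y [-> ->]]]]]; exists g, s, y, x. Qed.

Lemma joined_eq a b : joined a b -> bcoord a = bcoord b -> a = b.
Proof.
move=> [g [s [x [y [-> ->]]]]]; rewrite !bcoordE => xy.
by rewrite (val_inj xy).
Qed.

Lemma subsupp_simplex (s : simplex K) (x : std_simplex R (val s)) f : barycentric f ->
  subsupp f (val x) -> in_simplex f (val s).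
Proof.
move=> bf fx; apply/in_simplexP; split=> // v /fx.
by have /in_simplexP[_ h] := valP x; exact: h.
Qed.

(* The point with coordinates f of the smallest simplex containing a. *)
Lemma retract_ex a f : barycentric f -> subsupp f (bcoord a) ->
  exists b : B, bcoord b = f /\ forall g s (x : std_simplex R (val s)), a = bp g x ->
    exists x' : std_simplex R (val s), val x' = f /\ b = bp g x'.
Proof.
move=> bf; elim/development_ind: a => g s x; rewrite bcoordE => fx.
have hs := subsupp_simplex bf fx.
exists (bp g (exist _ f hs : std_simplex R (val s))); split; first by rewrite bcoordE.
move=> h t y e; have fy : subsupp f (val y) by rewrite -(bcoordE h y) -e bcoordE.
have ht := subsupp_simplex bf fy.
exists (exist _ f ht); split=> //; exact: (bp_recoord hs ht e fx).
Qed.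

(** A point y whose support is inside that of a lies in every simplex containing a, because
    [retract_ex] fixes the point with these coordinates independently of the simplex. *)
Lemma joined_star y a b : joined y a -> joined a b -> subsupp (bcoord y) (bcoord a) -> joined y b.
Proof.
move=> [g [s [x [x' [yE aE]]]]] [h [t [z [z' [aE' ->]]]]] sub.
have [b' [b1 b2]] := retract_ex (bary_coord y) sub.
have [w [w1 w2]] := b2 _ _ _ aE; have [w' [w1' w2']] := b2 _ _ _ aE'.
exists h, t, w', z'; split=> //.
rewrite -w2' w2 yE; congr (to_quot _ (dpt _ _)); apply: val_inj.
by rewrite /= w1 yE bcoordE.
Qed.

Lemma std_dist_ge0 (i : G * simplex K) (x y : piece i) : 0 <= pdist i x y.
Proof. exact: sqrtr_ge0. Qed.

Lemma std_distC (i : G * simplex K) (x y : piece i) : pdist i x y = pdist i y x.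
Proof. exact: euclC. Qed.

Lemma qchain_eucl n a b l : qchain pdist (r := glue) n a b l -> eucl (bcoord a) (bcoord b) <= l.
Proof.
elim=> {n a b l} [a|n a b l e m _ IH /adj_joined[_ ->]]; first by rewrite euclxx.
by apply: le_trans (eucl_triangle (bcoord b) _ _) _; exact: lerD.
Qed.

Lemma qchain_coord n a b l v : qchain pdist (r := glue) n a b l -> `|bcoord a v - bcoord b v| <= l.
Proof. by move=> /qchain_eucl; apply: le_trans; exact: eucl_coord. Qed.

(** A coordinate changes by at most the length travelled, so a chain shorter than the coordinates of
    a on the support of y stays in the star of y. The radius depends on coordinates alone, which
    makes up for the lack of local finiteness. *)
Lemma qchain_star n a b l y : qchain pdist (r := glue) n a b l -> joined y a ->
  (forall v, bcoord y v != 0 -> l < bcoord a v) -> joined y b.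
Proof.
move=> h; elim: h => {n a b l} [//|n a b l e m h IH be] ya hl.
have m0 : 0 <= m by have [_ ->] := (adj_joined _ _ _).1 be; exact: eucl_ge0.
have [be' _] := (adj_joined _ _ _).1 be; apply: joined_star be' _.
  by apply: IH => // v /hl h'; apply: le_lt_trans h'; rewrite lerDl.
move=> v /hl h'; have := qchain_coord v h; rewrite ler_distl => /andP[h1 h2].
by rewrite gt_eqF//; lra.
Qed.

Hypothesis conn : forall a b : B, exists n l, qchain pdist (r := glue) n a b l.

Lemma dev_pm : pseudo_metric dB.
Proof. exact: (glue_pseudo_metric std_dist_ge0 std_distC conn). Qed.

Lemma dev_dist_le n a b l : qchain pdist (r := glue) n a b l -> dB a b <= l.
Proof. exact: (glue_dist_le std_dist_ge0 conn). Qed.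

Lemma dev_dist_lt a b l : dB a b < l -> exists n l', l' < l /\ qchain pdist (r := glue) n a b l'.
Proof. exact: (glue_dist_lt std_dist_ge0 conn). Qed.

Lemma dev_dist_eucl a b : eucl (bcoord a) (bcoord b) <= dB a b.
Proof. by apply: (le_glue_dist std_dist_ge0 conn) => n l; exact: qchain_eucl. Qed.

Lemma joined_dist a b : joined a b -> dB a b = eucl (bcoord a) (bcoord b).
Proof.
move=> h; apply: le_anti; rewrite dev_dist_eucl andbT.
by apply: dev_dist_le; apply: qchain1; apply/adj_joined.
Qed.

Lemma dev_star a b y e : dB a b < e -> joined y a ->
  (forall v, bcoord y v != 0 -> e <= bcoord a v) -> joined y b.
Proof.
move=> /dev_dist_lt[n [l [le h]]] ya hv; apply: (qchain_star h ya) => v /hv.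
exact: lt_le_trans.
Qed.

Lemma joined_refl a : joined a a.
Proof. by elim/development_ind: a => g s x; exists g, s, x, x. Qed.

(** By [dev_star] a point at distance 0 from a shares a simplex with it, and there the distance is
    Euclidean. *)
Lemma dev_metric : is_metric dB.
Proof.
have pm := dev_pm; split; [exact: pm_ge0 pm| |exact: pmC pm|by move=> x y z; exact: (pmT pm)].
move=> a b; split=> [ab|->]; last exact: (pm0 pm).
have [e e0 he] := fin_pos_bound (bary_coord a).1.
have ab' : joined a b.
  apply: (@dev_star a b a e); rewrite ?ab//; [exact: joined_refl|].
  by move=> v /he /ltW.
apply: joined_eq => //; apply/ffunP => v.
have := eucl_coord (bcoord a) (bcoord b) v; rewrite -(joined_dist ab') ab normr_le0 subr_eq0.
by move/eqP.
Qed.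

Lemma joined_lpath a b : joined a b -> exists A, lpath dB a b (dB a b) A.
Proof.
move=> ab; have [g [s [x [y [aE bE]]]]] := ab.
have l0 : 0 <= dB a b by exact: (pm_ge0 dev_pm).
have [l00|ln0] := eqVneq (dB a b) 0.
  have -> : b = a by symmetry; have [_ h _ _] := dev_metric; apply/h.
  by exists [set a]%classic; rewrite (pm0 dev_pm); exact: (lpath_refl dev_pm).
pose f t : {ffun V -> R} := [ffun v => bcoord a v + (t / dB a b) * (bcoord b v - bcoord a v)].
have fs t : 0 <= t <= dB a b -> in_simplex (f t) (val s).
  move=> /andP[t0 t1].
  have u0 : 0 <= t / dB a b by rewrite divr_ge0.
  have u1 : t / dB a b <= 1 by rewrite ler_pdivrMr ?mul1r// lt_def ln0.
  have [a1 a2] := bary_coord a; have [b1 b2] := bary_coord b.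
  apply/in_simplexP; split; first split.
  - by move=> v; rewrite ffunE; have := a1 v; have := b1 v; nra.
  - under eq_bigr do rewrite ffunE.
    by rewrite big_split /= -mulr_sumr sumrB a2 b2 subrr mulr0 addr0.
  - move=> v; apply: contraR => vs; rewrite ffunE.
    have /in_simplexP[_ hx] := valP x; have /in_simplexP[_ hy] := valP y.
    have -> : bcoord a v = 0.
      by apply/eqP; rewrite aE bcoordE; apply: contraNT vs; exact: hx.
    have -> : bcoord b v = 0.
      by apply/eqP; rewrite bE bcoordE; apply: contraNT vs; exact: hy.
    by rewrite subrr mulr0 addr0.
pose c t : B := if pselect (0 <= t <= dB a b) is left h
  then bp g (exist _ (f t) (fs t h) : std_simplex R (val s)) else a.
have cE t : 0 <= t <= dB a b -> exists z : std_simplex R (val s), val z = f t /\ c t = bp g z.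
  by move=> h; rewrite /c; case: pselect => // h'; exists (exist _ (f t) (fs t h')).
have z0 : 0 <= (0 : R) <= dB a b by rewrite lexx l0.
have zl : 0 <= dB a b <= dB a b by rewrite lexx l0.
exists (c @` `[0, dB a b])%classic; split=> //; exists c; split=> //.
- have [z [z1 ->]] := cE _ z0; rewrite aE; congr (to_quot _ (dpt _ _)); apply: val_inj.
  by rewrite z1; apply/ffunP => v; rewrite ffunE mul0r mul0r addr0 aE bcoordE.
- have [z [z1 ->]] := cE _ zl; rewrite [RHS]bE; congr (to_quot _ (dpt _ _)); apply: val_inj.
  rewrite z1; apply/ffunP => v; rewrite ffunE divff// mul1r addrCA subrr addr0.
  by rewrite {1}bE bcoordE.
- move=> t u; rewrite !in_itv /= => ht hu.
  have [z [z1 ->]] := cE _ ht; have [w [w1 ->]] := cE _ hu.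
  rewrite joined_dist; last by exists g, s, z, w.
  rewrite !bcoordE z1 w1.
  have -> : eucl (f t) (f u) = eucl (fun v => bcoord a v + t / dB a b * (bcoord b v - bcoord a v))
      (fun v => bcoord a v + u / dB a b * (bcoord b v - bcoord a v)).
    by congr Num.sqrt; apply: eq_bigr => v _; rewrite !ffunE.
  rewrite eucl_affine -(joined_dist ab) -mulrBl normrM normfV (ger0_norm l0).
  by rewrite mulfVK.
Qed.

Lemma qchain_lpath_dev n a b l : qchain pdist (r := glue) n a b l -> exists A, lpath dB a b l A.
Proof.
apply: (qchain_lpath std_dist_ge0 std_distC conn) => {}a {}b {}l /adj_joined[ab ->].
by have [A] := joined_lpath ab; rewrite (joined_dist ab); exists A.
Qed.

End Development.

(** * Geodesics of the development *)

Section UltraLimit.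
Local Open Scope classical_set_scope.
Local Open Scope ring_scope.

Lemma ultra_limit (R : realType) (U : set_system nat) (u : nat -> R) : UltraFilter U ->
  (forall k, 0 <= u k <= 1) ->
  exists l, forall e, 0 < e -> \forall k \near U, `|u k - l| < e.
Proof.
move=> uU hu; have pU : ProperFilter U by exact: ultra_proper.
have [|l [_ hl]] := @segment_compact R 0 1 (u @ U) _.
  by apply: nearW => k /=; rewrite in_itv /=.
exists l => e e0; have [//|h] := in_ultra_setVsetC [set k | `|u k - l| < e] uU.
have h2 : U (u @^-1` (u @` ~` [set k | `|u k - l| < e])).
  by apply: filterS h => k hk; exists k.
have [_ [[k hk <-] hb]] := hl _ (ball l e) h2 (nbhsx_ballx _ _ e0).
by case: hk; move: hb; rewrite /ball /= distrC.
Qed.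

End UltraLimit.

Section Geodesics.
Local Open Scope classical_set_scope.
Local Open Scope ring_scope.
Variables (R : realType) (V : finType) (K : {set {set V}}) (Y : complex_of_groups K).
Variable T : {set {set V} * {set V}}.
Local Notation G := (pi1 Y T).
Local Notation B := (development R Y T).
Local Notation dB := (dev_dist R Y T).
Local Notation glue := (@dev_glue V R K Y T).
Local Notation pdist := (fun i : G * simplex K => @std_dist V R (val i.2)).
Local Notation qch := (qchain pdist (r := glue)).

Lemma coord01 (a : B) v : 0 <= bcoord a v <= 1.
Proof.
have [h0 h1] := bary_coord a; rewrite h0 /= -h1 (bigD1 v)//= lerDl.
by apply: sumr_ge0 => w _; exact: h0.
Qed.

Section Limits.
Variable U : set_system nat.
Hypothesis uU : UltraFilter U.
Hypothesis Uoo : \oo `<=` U.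

Let pU : ProperFilter U := @ultra_proper _ _ uU.

(** Only the coordinates converge; the points may run through infinitely many simplices without a
    limit in [B]. *)
Lemma coord_limit (z : nat -> B) : exists f : {ffun V -> R}, barycentric f /\
  forall e, 0 < e -> \forall k \near U, forall v, `|bcoord (z k) v - f v| < e.
Proof.
have [v|f hf] := @choice _ _ (fun v l => forall e : R, 0 < e ->
    \forall k \near U, `|bcoord (z k) v - l| < e).
  by apply: ultra_limit => // k; exact: coord01.
have hall e : 0 < e -> \forall k \near U, forall v, `|bcoord (z k) v - f v| < e.
  by move=> e0; apply: filter_forall => v; exact: hf.
exists [ffun v => f v]; split; last first.
  by move=> e /hall; apply: filterS => k h v; rewrite ffunE.
split.
- move=> v; rewrite ffunE leNgt; apply/negP => fv.
  have /filter_ex[k hk] := hf v (- f v) ltac:(lra).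
  by have := (bary_coord (z k)).1 v; move: hk; rewrite ltr_distl => /andP[h1 h2]; lra.
- under eq_bigr do rewrite ffunE.
  apply/eqP; rewrite -subr_eq0 -normr_le0 leNgt; apply/negP => s0.
  pose e := `|\sum_v f v - 1| / (#|V|%:R + 1).
  have n0 : 0 < #|V|%:R + 1 :> R by rewrite ltr_wpDl.
  have /filter_ex[k hk] := hall e ltac:(by rewrite divr_gt0).
  have : `|\sum_v f v - 1| <= #|V|%:R * e.
    have -> : \sum_v f v - 1 = \sum_v (f v - bcoord (z k) v).
      by rewrite sumrB (bary_coord (z k)).2.
    apply: le_trans (ler_norm_sum _ _ _) _.
    rewrite mulr_natl -sumr_const; apply: ler_sum => v _.
    by rewrite distrC ltW.
  by rewrite /e mulrCA -ler_pdivrMl// mulVf ?gt_eqF// ler_pdivlMr//; lra.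
Qed.

Lemma retract_limit (z : nat -> B) f e : barycentric f ->
  (forall v, f v != 0 -> e < f v) -> 0 < e ->
  forall k, (forall v, `|bcoord (z k) v - f v| < e) -> subsupp f (bcoord (z k)).
Proof.
move=> bf fe e0 k hk v fv; have := hk v; have := fe v fv.
by rewrite ltr_distl => h1 /andP[h2 h3]; rewrite gt_eqF//; lra.
Qed.

Hypothesis conn : forall a b : B, exists n l, qch n a b l.

(** Let f be the limit of the coordinates of [c k t0]. For U-most k the carrier of [c k t0] contains
    a point y, depending on k, with coordinates f, and near t0 the path stays in the star of y. Two
    segments through y thus replace it, at an arbitrarily small cost. *)
Lemma local_chains (D : R) (l : nat -> R) (c : nat -> R -> B) (t0 : R) : 0 <= D ->
  (forall k, D <= l k < D + k.+1%:R^-1) ->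
  (forall k, {in `[0, 1] &, forall s t, dB (c k s) (c k t) <= l k * `|s - t|}) ->
  t0 \in `[0, 1] ->
  exists2 eta, 0 < eta & forall s t, s \in `[0, 1] -> t \in `[0, 1] ->
    t0 - eta < s <= t0 -> t0 <= t < t0 + eta ->
    forall e, 0 < e -> \forall k \near U, exists m,
      m <= D * (t - s) + e /\ qch 2 (c k s) (c k t) m.
Proof.
move=> D0 hl hc ht0; have [f [bf hf]] := coord_limit (fun k => c k t0).
have [eps eps0 feps] := fin_pos_bound bf.1.
have pm := dev_pm conn.
(* All [l k] are at most D + 1, so within this time a path moves by less than [eps / 4]. *)
pose eta := eps / (4 * (D + 1)).
have D1 : 0 < 4 * (D + 1) by lra.
exists eta; first by rewrite divr_gt0.
move=> s t sI tI /andP[s1 s2] /andP[t1 t2] e e0.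
(* The first bound keeps the coordinates of [c k t0] on the support of f above [eps / 2], the second
   makes the passage from [c k t0] to y short. *)
pose e' := Num.min (eps / 4) (e / (4 * (#|V|%:R + 1))).
have n0 : 0 < #|V|%:R + 1 :> R by rewrite ltr_wpDl.
have e'0 : 0 < e' by rewrite lt_min !divr_gt0// mulr_gt0.
have e'1 : e' <= eps / 4 by rewrite ge_min lexx.
have e'2 : #|V|%:R * e' <= e / 4.
  have : e' <= e / (4 * (#|V|%:R + 1)) by rewrite ge_min lexx orbT.
  rewrite ler_pdivlMr ?mulr_gt0// => h; have : 0 <= e' by exact: ltW.
  by move: h; move: (#|V|%:R : R) => n; nra.
have inv : \forall k \near U, k.+1%:R^-1 < e / 2.
  have e2 : 0 < e / 2 by rewrite divr_gt0.
  by apply: Uoo; exact: near_infty_natSinv_lt (PosNum e2).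
apply: filterS2 (hf _ e'0) inv => k hk ke.
have hsub : subsupp f (bcoord (c k t0)).
  apply: (@retract_limit (fun k => c k t0) f eps) => // v.
  by apply: lt_le_trans (hk v) _; lra.
have [y [yf hy]] := retract_ex bf hsub.
have yj : joined y (c k t0).
  move: hy; elim/development_ind: (c k t0) => g sx x hy.
  by have [x' [_ yE]] := hy _ _ _ erefl; exists g, sx, x', x.
have [lk1 lk2] := andP (hl k).
have k1 : k.+1%:R^-1 <= 1 :> R by rewrite invf_le1// ler1n.
have k0 : 0 <= k.+1%:R^-1 :> R by rewrite invr_ge0.
move: (k.+1%:R^-1 : R) k0 k1 lk2 ke => iv k0 k1 lk2 ke.
have near u : u \in `[0, 1] -> `|t0 - u| < eta -> exists m,
    m <= D * `|t0 - u| + iv * `|t0 - u| + e / 4 /\ qch 1 (c k u) y m.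
  move=> uI hu; have cu := hc k _ _ ht0 uI.
  have lu : l k * `|t0 - u| < eps / 4.
    apply: le_lt_trans (_ : (D + 1) * `|t0 - u| < _).
      by apply: ler_wpM2r => //; lra.
    move: hu; rewrite /eta ltr_pdivlMr// => hu; lra.
  have yu : joined y (c k u).
    apply: (dev_star conn (e := eps / 2) _ yj); first by lra.
    move=> v; rewrite yf => fv; have := feps v fv; have := hk v.
    by rewrite ltr_distl => /andP[h1 h2] h3; lra.
  exists (eucl (bcoord (c k u)) (bcoord y)); split; last first.
    by apply: qchain1; apply/adj_joined; split => //; exact: joinedC.
  apply: le_trans (eucl_triangle (bcoord (c k t0)) _ _) _; apply: lerD.
    apply: le_trans (dev_dist_eucl conn _ _) _; rewrite (pmC pm).
    apply: le_trans cu _; rewrite -mulrDl; apply: ler_wpM2r => //; exact: ltW.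
  rewrite yf; apply: le_trans e'2; apply: eucl_le_sup => v; exact/ltW/hk.
have ns : `|t0 - s| = t0 - s by rewrite ger0_norm// subr_ge0.
have nt : `|t0 - t| = t - t0 by rewrite ler0_norm ?subr_le0// opprB.
have [|m [m1 m2]] := near s sI; first by rewrite ns; lra.
have [|m' [m1' m2']] := near t tI; first by rewrite nt; lra.
exists (m + m'); split; last exact: qchain_cat m2 (qchain_rev (@std_distC R V K Y T) m2').
rewrite ns in m1; rewrite nt in m1'.
have : iv * (t0 - s) + iv * (t - t0) <= iv.
  rewrite -mulrDr ler_piMr//.
  move: sI tI; rewrite !in_itv /= => /andP[a1 a2] /andP[b1 b2]; lra.
lra.
Qed.

(* Near each time the paths c k shortcut through a single point, so by compactness of
   [0, 1] boundedly many segments suffice for all of them. *)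
Lemma bounded_chains (D : R) (l : nat -> R) (c : nat -> R -> B) : 0 <= D ->
  (forall k, D <= l k < D + k.+1%:R^-1) ->
  (forall k, {in `[0, 1] &, forall s t, dB (c k s) (c k t) <= l k * `|s - t|}) ->
  exists N, forall e, 0 < e -> \forall k \near U, exists m,
    m <= D + e /\ qch N (c k 0) (c k 1) m.
Proof.
move=> D0 hl hc.
pose good t := exists N, forall e, 0 < e -> \forall k \near U, exists m,
  m <= D * t + e /\ qch N (c k 0) (c k t) m.
pose S := [set t | t \in `[0, 1] /\ good t].
have S0 : S 0.
  split; first by rewrite in_itv /= lexx ler01.
  exists 0%N => e e0; apply: nearW => k; exists 0; split; last exact: qchain0.
  by rewrite mulr0 add0r ltW.
have supS : has_sup S.
  by split; [exists 0|exists 1 => t [+ _]; rewrite in_itv /= => /andP[]].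
have sI : sup S \in `[0, 1].
  rewrite in_itv /=; apply/andP; split.
    by apply: ub_le_sup => //; exact: supS.2.
  by apply: ge_sup; [exists 0|move=> t [+ _]; rewrite in_itv /= => /andP[]].
have [eta eta0 heta] := local_chains D0 hl hc sI.
have [s [sI' [N hN]] hs] := sup_adherent eta0 supS.
have ss : s <= sup S.
  by apply: ub_le_sup; [exact: supS.2|split=> //; exists N].
pose t := Num.min 1 (sup S + eta / 2).
move: (sI) (sI'); rewrite !in_itv /= => /andP[p1 p2] /andP[q1 q2].
have st : sup S <= t by rewrite le_min p2 /= lerDl divr_ge0// ltW.
have t1 : t <= 1 by rewrite ge_min lexx.
have t2 : t < sup S + eta.
  apply: le_lt_trans (_ : sup S + eta / 2 < _); last by lra.
  by rewrite ge_min lexx orbT.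
have tI : t \in `[0, 1] by rewrite in_itv /= t1 (le_trans p1 st).
have gt : good t.
  exists (N + 2)%N => e e0; have e2 : 0 < e / 2 by rewrite divr_gt0.
  have h2 := heta s t sI' tI _ _ _ e2.
  apply: filterS2 (hN _ e2) (h2 _ _); last first.
  - by rewrite st.
  - by rewrite hs.
  - move=> k [m [m1 m2]] [m' [m1' m2']]; exists (m + m'); split; last exact: qchain_cat m2 m2'.
    by rewrite mulrBr in m1'; lra.
have : t <= sup S by apply: ub_le_sup; [exact: supS.2|split].
rewrite {1}/t ge_min => /orP[h|h]; last by lra.
have t11 : t = 1.
  by apply: le_anti; rewrite t1 /=; apply: le_trans h st.
by move: gt => [M hM]; exists M => e e0; have := hM e e0; rewrite t11 mulr1.
Qed.

(** Let [f i] be the limit coordinates of the i-th vertices. One chain k close to the limit already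
    has carriers with points [y i] of coordinates [f i], and its simplices join consecutive ones.
    Lengths depend on coordinates only, so the chain y has the limit length although the simplices
    themselves have no limit. *)
Lemma limit_chain (a b : B) (D : R) N :
  (forall e, 0 < e -> exists m, m <= D + e /\ qch N a b m) ->
  exists m, m <= D /\ qch N a b m.
Proof.
move=> h.
have [k|z hz] := @choice nat (nat -> B) (fun k z => [/\ z 0%N = a, z N = b,
    forall i, (i < N)%N -> joined (z i) (z i.+1) &
    \sum_(i < N) eucl (bcoord (z i)) (bcoord (z i.+1)) <= D + k.+1%:R^-1]).
  have [|m [m1 m2]] := h k.+1%:R^-1; first by rewrite invr_gt0.
  have [z [w [z0 zn zi mE]]] := qchain_fun m2; exists z; split=> //.
    by move=> i /zi /adj_joined[].
  rewrite mE in m1; apply: le_trans m1; apply: ler_sum => i _.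
  by have /adj_joined[_ ->] := zi i (ltn_ord i).
have [f hf] := choice (fun i => coord_limit (fun k => z k i)).
have [eps eps0 heps] := @fin_pos_bound R ('I_N.+1 * V)%type (fun p => f p.1 p.2)
  (fun p => (hf p.1).1.1 p.2).
have near e : 0 < e -> \forall k \near U, forall i : 'I_N.+1, forall v,
    `|bcoord (z k i) v - f i v| < e.
  by move=> e0; apply: filter_forall => i; apply: (hf i).2.
have /filter_ex[k hk] := near eps eps0.
have sub i : (i <= N)%N -> subsupp (f i) (bcoord (z k i)).
  move=> iN; apply: (@retract_limit (fun k => z k i) (f i) eps) => //.
  - exact: (hf i).1.
  - by move=> v; have := heps (inord i, v); rewrite /= inordK.
  - by have := hk (inord i); rewrite inordK.
have [i|y hy] := @choice nat B (fun i y => (i <= N)%N -> bcoord y = f i /\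
    forall g s (x : std_simplex R (val s)), z k i = to_quot _ (@dev_pt _ _ _ _ T g s x) ->
    exists x' : std_simplex R (val s), val x' = f i /\ y = to_quot _ (@dev_pt _ _ _ _ T g s x')).
  case: (leqP i N) => iN; last by exists a.
  by have [w hw] := retract_ex (hf i).1 (sub i iN); exists w.
(* A vertex common to all chains is its own limit, so the ends are preserved. *)
have const i w : (i <= N)%N -> (forall k, z k i = w) -> y i = w.
  move=> iN zw; have [y1 y2] := hy i iN.
  have fw : f i = bcoord w.
    apply/ffunP => v; apply/eqP; rewrite -subr_eq0 -normr_le0 leNgt; apply/negP => h0.
    have /filter_ex[j /(_ v)] := (hf i).2 _ h0.
    by rewrite zw distrC ltxx.
  apply: joined_eq; last by rewrite y1.
  move: y2; rewrite zw; elim/development_ind: {zw fw} w => g s x y2.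
  by have [x' [_ ->]] := y2 _ _ _ erefl; exists g, s, x', x.
exists (\sum_(i < N) eucl (bcoord (y i)) (bcoord (y i.+1))); split; last first.
  have <- : y 0%N = a by apply: const => // j; have [] := hz j.
  have <- : y N = b by apply: const => // j; have [] := hz j.
  apply: (@fun_qchain _ _ _ _ _ N y (fun i => eucl (bcoord (y i)) (bcoord (y i.+1)))) => i iN.
  apply/adj_joined; split=> //.
  have [_ _ /(_ i iN)[g [s [x [x' [e1 e2]]]]] _] := hz k.
  have [w [_ ->]] := (hy i (ltnW iN)).2 _ _ _ e1.
  by have [w' [_ ->]] := (hy i.+1 iN).2 _ _ _ e2; exists g, s, w, w'.
rewrite leNgt; apply/negP; set S := \sum_(i < N) _ => hS.
(* Each of the N segments has two ends, each moved by at most [#|V| * e]; the summand 1 keeps C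
   positive. *)
pose C : R := N%:R * (2 * #|V|%:R) + 1.
have C0 : 0 < C by rewrite /C ltr_wpDl// mulr_ge0// mulr_ge0.
pose e := (S - D) / 2 / C.
have e0 : 0 < e by rewrite divr_gt0// divr_gt0//; lra.
have inv : \forall k \near U, k.+1%:R^-1 < (S - D) / 2.
  have SD : 0 < (S - D) / 2 by rewrite divr_gt0// subr_gt0.
  by apply: Uoo; exact: near_infty_natSinv_lt (PosNum SD).
have [j [hj1 hj2]] := @filter_ex _ U pU _ (@filterI _ U _ _ _ (near e e0) inv).
have [_ _ _ hj] := hz j; move: hj2 hj => /=; move: (j.+1%:R^-1 : R) => iv hj2 hj.
have : S <= \sum_(i < N) (eucl (bcoord (z j i)) (bcoord (z j i.+1)) + 2 * #|V|%:R * e).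
  apply: ler_sum => i _; have iN := ltn_ord i.
  rewrite (hy i (ltnW iN)).1 (hy i.+1 iN).1.
  have n1 : eucl (f i) (bcoord (z j i)) <= #|V|%:R * e.
    apply: eucl_le_sup => v; rewrite distrC ltW//.
    by have := hj1 (inord i) v; rewrite inordK// ltnW.
  have n2 : eucl (bcoord (z j i.+1)) (f i.+1) <= #|V|%:R * e.
    apply: eucl_le_sup => v; rewrite ltW//.
    by have := hj1 (inord i.+1) v; rewrite inordK.
  have := eucl_triangle (bcoord (z j i)) (f i) (f i.+1).
  by have := eucl_triangle (bcoord (z j i.+1)) (bcoord (z j i)) (f i.+1); lra.
rewrite big_split /= sumr_const card_ord -[_ *+ N]mulr_natl mulrA => h1.
have : C * e = (S - D) / 2 by rewrite /e mulrC mulfVK// gt_eqF.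
rewrite /C mulrDl mul1r => h2; lra.
Qed.

End Limits.

Hypothesis conn : forall a b : B, exists n l, qch n a b l.

Theorem development_geodesic : geodesic_space dB.
Proof.
move=> a b; have pm := dev_pm conn.
have [U [uU Uoo]] := ultraFilterLemma eventually_filter.
have [k|w hw] := @choice nat (R * (R -> B))%type (fun k w => [/\
    dB a b <= w.1 < dB a b + k.+1%:R^-1, w.2 0 = a, w.2 1 = b &
    {in `[0, 1] &, forall s t, dB (w.2 s) (w.2 t) <= w.1 * `|s - t|}]).
  have [|n [l [l1 l2]]] := dev_dist_lt conn (a := a) (b := b) (l := dB a b + k.+1%:R^-1).
    by rewrite ltrDl invr_gt0.
  have [A [l0 [c [c0 cl _ hc]]]] := qchain_lpath_dev conn l2.
  exists (l, fun t => c (l * t)); split=> //=.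
  - by rewrite l1 (dev_dist_le conn l2).
  - by rewrite mulr0.
  - by rewrite mulr1.
  - move=> s t; rewrite !in_itv /= => /andP[s0 s1] /andP[t0 t1].
    apply: le_trans (hc _ _ _ _) _; rewrite ?in_itv /= ?mulr_ge0 ?ler_piMr//.
    by rewrite -mulrBr normrM (ger0_norm l0).
have [||N hN] := @bounded_chains U uU Uoo conn (dB a b) (fun k => (w k).1)
  (fun k => (w k).2) (pm_ge0 pm a b).
- by move=> k; have [] := hw k.
- by move=> k; have [] := hw k.
have [|m [m1 m2]] := @limit_chain U uU Uoo a b (dB a b) N.
  move=> e /hN; have pU : ProperFilter U := @ultra_proper _ _ uU.
  move=> /filter_ex[k [m [m1 m2]]]; exists m; split=> //.
  by have [_ e1 e2 _] := hw k; rewrite e1 e2 in m2.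
have mE : m = dB a b by apply: le_anti; rewrite m1 (dev_dist_le conn m2).
rewrite mE in m2; have [A hA] := qchain_lpath_dev conn m2.
by exists A; exact: (lpath_segment pm hA).
Qed.

End Geodesics.

(** * The orbit map to the development *)

Section Orbit.
Variables (R : realType) (V : finType) (K : {set {set V}}) (Y : complex_of_groups K).
Variable T : {set {set V} * {set V}}.
Local Notation G := (pi1 Y T).
Local Notation B := (development R Y T).
Local Notation dB := (dev_dist R Y T).
Local Notation glue := (@dev_glue V R K Y T).
Local Notation piece := (@dev_piece V R K Y T).
Local Notation pdist := (fun i : G * simplex K => @std_dist V R (val i.2)).
Local Notation qch := (qchain pdist (r := glue)).
Local Notation bp g x := (to_quot glue (@dev_pt V R K Y T g _ x) : B).
Local Notation spt s := (std_simplex R (val s)).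
Local Notation loc s a := (pi1_loc Y T s a).
Local Notation ked e := (pi1_edge Y T e).

Hypothesis scK : simplicial_complex K.
Hypothesis mtT : maximal_tree K T.

Definition delta_pt (v : V) : {ffun V -> R} := [ffun w => (w == v)%:R].

Lemma delta_bary v : barycentric (delta_pt v).
Proof.
split=> [w|]; first by rewrite ffunE ler0n.
under eq_bigr do rewrite ffunE; rewrite (bigD1 v)//= eqxx big1 ?addr0// => w /negPf ->.
by [].
Qed.

Lemma delta_supp v w : delta_pt v w != 0 -> w = v.
Proof. by rewrite ffunE; case: (w =P v) => // _; rewrite eqxx. Qed.

Lemma delta_simplex v (s : {set V}) : v \in s -> in_simplex (delta_pt v) s.
Proof. by move=> vs; apply/in_simplexP; split=> [|w /delta_supp ->]//; exact: delta_bary. Qed.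

Definition vertex_pt (s : simplex K) v (vs : v \in val s) : spt s :=
  exist _ (delta_pt v) (delta_simplex vs).

Lemma simplex_vertex (s : simplex K) : exists v, v \in val s.
Proof.
apply/set0Pn; apply: contraNneq scK.1 => h; rewrite -h; exact: valP.
Qed.

Lemma edge_glue g s t (e : edge s t) v (vs : v \in val s) (vt : v \in val t) :
  bp g (vertex_pt vs) = bp (g / ked e)%g (vertex_pt vt).
Proof. by apply/to_quotP; apply: eqv_base; exact: dev_glue_face. Qed.

Lemma joined_chain g s (x y : spt s) : exists2 l, l <= #|V|%:R & qch 1 (bp g x) (bp g y) l.
Proof.
exists (eucl (bcoord (bp g x)) (bcoord (bp g y))).
  rewrite -[leRHS]mulr1; apply: eucl_le_sup => v; rewrite ler_distl.
  have /andP[a0 a1] := coord01 (bp g x) v; have /andP[b0 b1] := coord01 (bp g y) v.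
  by apply/andP; split; lra.
by apply: qchain1; apply/adj_joined; split => //; exists g, s, x, y.
Qed.

Let qrev n a b l (h : qch n a b l) : qch n b a l := qchain_rev (@std_distC R V K Y T) h.

Lemma tree_chain g (s t : simplex K) (x : spt s) (y : spt t) : tree_rel T (val s) (val t) ->
  exists l, l <= (2 * #|V|)%:R /\ qch 2 (bp g x) (bp g y) l.
Proof.
wlog st : s t x y / (val s, val t) \in T.
  move=> h /orP[st|ts]; first by apply: h => //; rewrite /tree_rel /= st.
  have [|l [l1 l2]] := h t s y x ts; first by rewrite /tree_rel /= ts.
  by exists l; split => //; exact: qrev.
move=> _; have [sT _ _] := mtT; have := fintype.subsetP sT _ st.
rewrite inE /= => /and3P[_ _ e]; have [v vt] := simplex_vertex t.
have vs : v \in val s := fintype.subsetP (proper_sub e) _ vt.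
have [l l1 l2] := joined_chain g x (vertex_pt vs).
have [m m1 m2] := joined_chain g (vertex_pt vt) y.
exists (l + m); split; first by rewrite natrM; lra.
have := edge_glue g (e : edge s t) vs vt; rewrite pi1_tree// divg1 => e'.
by rewrite e' in l2; exact: qchain_cat l2 m2.
Qed.

(** Edges of the maximal tree have trivial symbols, so one crosses from simplex to simplex without
    changing the group element; finiteness of the complex makes the cost uniform. *)
Lemma same_elt_chain : exists L : nat, forall g (s t : simplex K) (x : spt s) (y : spt t),
  exists n l, l <= L%:R /\ qch n (bp g x) (bp g y) l.
Proof.
have [| |L hL] := @fin_bound (simplex K * simplex K)%type (fun st L => forall g
  (x : spt st.1) (y : spt st.2), exists n l, l <= L%:R /\ qch n (bp g x) (bp g y) l).
- move=> i n m nm h g x y; have [k [l [l1 l2]]] := h g x y; exists k, l; split => //.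
  by apply: le_trans l1 _; rewrite ler_nat.
- move=> [s t] /=; have [_ cT _] := mtT.
  have /connectP[p] := cT _ _ (valP s) (valP t).
  elim: p s => [|u p IH] s /=.
    move=> _ ts; have {}ts : t = s by exact: val_inj.
    rewrite ts; exists #|V| => g x y.
    by have [l l1 l2] := joined_chain g x y; exists 1%N, l.
  move=> /andP[su pu] tE; have uK : u \in K.
    have [sT _ _] := mtT.
    by case/orP: su => /(fintype.subsetP sT); rewrite inE /= => /and3P[].
  have [n hn] := IH (exist _ u uK) pu tE; exists (2 * #|V| + n)%N => g x y.
  have [v vu] := simplex_vertex (exist _ u uK).
  have [l [l1 l2]] := @tree_chain g s (exist _ u uK) x (vertex_pt vu) su.
  have [k [m [m1 m2]]] := hn g (vertex_pt vu) y.
  exists (2 + k)%N, (l + m); split; last exact: qchain_cat l2 m2.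
  by rewrite natrD; exact: lerD.
- by exists L => g s t x y; exact: (hL (s, t)).
Qed.

Lemma step_chain : exists L : nat, forall g y (s t : simplex K) (x : spt s) (z : spt t),
  step_elt y -> exists n l, l <= L%:R /\ qch n (bp g x) (bp (g * y)%g z) l.
Proof.
have [L hL] := same_elt_chain; exists (2 * L)%N => g y s t x z hy.
have via g' (s' t' : simplex K) (x' : spt s') (z' : spt t') : bp g x' = bp g' z' ->
    exists n l, l <= (2 * L)%:R /\ qch n (bp g x) (bp g' z) l.
  move=> e; have [n [l [l1 l2]]] := hL g s s' x x'.
  have [m [k [k1 k2]]] := hL g' t' t z' z; rewrite e in l2.
  exists (n + m)%N, (l + k); split; last exact: qchain_cat l2 k2.
  by rewrite natrM; lra.
case: hy => [s' a|s' t' e|s' t' e].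
- have [v vs] := simplex_vertex s'.
  apply: (@via _ s' s' (vertex_pt vs) (vertex_pt vs)).
  by apply/esym/to_quotP; apply: eqv_base; exact: dev_glue_loc.
- have [v vt] := simplex_vertex t'.
  have vs : v \in val s' := fintype.subsetP (proper_sub e) _ vt.
  apply: (@via _ t' s' (vertex_pt vt) (vertex_pt vs)).
  by have := edge_glue (g * ked e)%g e vs vt; rewrite mulgK => ->.
- have [v vt] := simplex_vertex t'.
  have vs : v \in val s' := fintype.subsetP (proper_sub e) _ vt.
  by apply: (@via _ s' t' (vertex_pt vs) (vertex_pt vt)); exact: edge_glue.
Qed.

Lemma prod_chain : exists L : nat, forall n g y (s t : simplex K) (x : spt s) (z : spt t),
  prod_len n y -> exists m l, l <= (L * n.+1)%:R /\ qch m (bp g x) (bp (g * y)%g z) l.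
Proof.
have [L hL] := same_elt_chain; have [M hM] := step_chain.
exists (L + M)%N => n g y s t x z hy.
elim: hy t z => {n y} [|n y u _ IH uy] t z.
  rewrite mulg1 muln1; have [k [l [l1 l2]]] := hL g s t x z; exists k, l; split=> //.
  by apply: le_trans l1 _; rewrite ler_nat leq_addr.
have [m [l [l1 l2]]] := IH t z; have [k [l' [l1' l2']]] := hM (g * y)%g u t t z z uy.
exists (m + k)%N, (l + l'); rewrite mulgA; split; last exact: qchain_cat l2 l2'.
rewrite mulnS natrD addrC; apply: lerD => //; apply: le_trans l1' _.
by rewrite ler_nat leq_addl.
Qed.

Lemma dev_connected (a b : B) : exists n l, qch n a b l.
Proof.
elim/development_ind: a => g s x; elim/development_ind: b => h t y.
have [n hn] := prod_len_all (g^-1 * h)%g; have [L hL] := prod_chain.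
have [m [l [_ hl]]] := hL n g _ s t x y hn; rewrite mulVKg in hl.
by exists m, l.
Qed.

Let pm := dev_pm dev_connected.

(** g' labels the vertex w of the simplex that carries p: passing to this face divides by the edge
    symbol. The coset of g' modulo the local group of w names a vertex of [B]. *)
Definition over_vertex (p : {i & piece i}) (w : simplex K) (g' : G) : Prop :=
  let: existT (g, s) _ := p in (s = w /\ g' = g) \/ exists e : edge s w, g' = (g / ked e)%g.

Lemma edge_irrefl (s : simplex K) : ~ edge s s.
Proof. by rewrite /edge fintype.properxx. Qed.

Lemma over_vertex_ex p w v : val w = [set v] -> pt_coord p v != 0 ->
  exists g', over_vertex p w g'.
Proof.
case: p => -[g s] x wv xv; rewrite /over_vertex.
have vs : v \in val s by have /in_simplexP[_ h] := valP x; exact: h.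
have [sv|sv] := eqVneq (val s) [set v].
  by exists g; left; split => //; apply: val_inj; rewrite sv wv.
have e : edge s w.
  by rewrite /edge wv finset.properEneq eq_sym sv finset.sub1set.
by exists (g / ked e)%g; right; exists e.
Qed.

(** Gluing by a local element changes the label at w by its image under psi ([pi1_conj]), gluing
    along a face by a twist ([pi1_comp]), and both belong to the local group of w. *)
Lemma over_vertex_rel p q w v : eqv_gen glue p q -> val w = [set v] -> pt_coord p v != 0 ->
  forall g' h', over_vertex p w g' -> over_vertex q w h' ->
  exists a : Y w, h' = (g' * loc w a)%g.
Proof.
move=> h; elim: h => {p q}.
- move=> _ _ [g s a x|g s t e x x' xx'] wv pv g' h' /=.
  + case=> [[sw ->]|[e ->]] [[sw' ->]|[e' ->]].
    * by move: a x pv; rewrite sw => a x pv; exists a^-1%g; rewrite pi1_locV mulgK.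
    * by case: (@edge_irrefl w); rewrite -{1}sw.
    * by case: (@edge_irrefl w); rewrite -{1}sw'.
    * rewrite (edge_irr e' e); exists (psi Y e a^-1)%g; rewrite -pi1_conj pi1_locV.
      by rewrite !mulgA mulgVK mulgK.
  + have vt : v \in val t.
      by have /in_simplexP[_ h] := valP x'; apply: h; move: pv; rewrite /pt_coord /= xx'.
    case=> [[sw ->]|[e1 ->]].
      exfalso; have : val t \proper [set v] by rewrite -wv -sw; exact: e.
      by move=> /fintype.properP[_ [u]]; rewrite inE => /eqP ->; rewrite vt.
    case=> [[tw ->]|[e2 ->]].
      move: e {x' xx' vt}; rewrite tw => e; rewrite (edge_irr e e1).
      by exists 1%g; rewrite pi1_loc1 mulg1.
    exists (twist Y e e2)^-1%g; rewrite pi1_locV -!mulgA; congr (_ * _)%g.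
    by rewrite -!invgM (pi1_comp Y T e e2 e1).
- move=> [[g s] x] wv _ g' h' /= [[sw ->]|[e ->]] [[sw' ->]|[e' ->]].
  + by exists 1%g; rewrite pi1_loc1 mulg1.
  + by case: (@edge_irrefl w); rewrite -{1}sw.
  + by case: (@edge_irrefl w); rewrite -{1}sw'.
  + by exists 1%g; rewrite pi1_loc1 mulg1 (edge_irr e' e).
- move=> p q pq IH wv qv g' h' hg hh; have [e _] := recoord_eqv pq.
  rewrite -e in qv; have [a ->] := IH wv qv _ _ hh hg.
  by exists a^-1%g; rewrite pi1_locV mulgK.
- move=> p m q pm_ IH1 _ IH2 wv pv g' h' hg hh; have [e _] := recoord_eqv pm_.
  have mv : pt_coord m v != 0 by rewrite -e.
  have [m' hm] := over_vertex_ex wv mv.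
  have [a ->] := IH2 wv mv _ _ hm hh; have [b ->] := IH1 wv pv _ _ hg hm.
  by exists (b * a)%g; rewrite pi1_locM mulgA.
Qed.

Lemma over_vertex_step (s w : simplex K) g (x : spt s) g' :
  over_vertex (dev_pt g x) w g' -> exists2 u, step_elt u & g' = (g * u)%g.
Proof.
case=> [[_ ->]|[e ->]]; last by exists (ked e)^-1%g => //; exact: step_edgeV.
by exists 1%g; rewrite ?mulg1// -(pi1_loc1 Y T s); exact: step_loc.
Qed.

(** Some coordinate v of the first point is at least [1 / (#|V| + 1)], so both simplices share a
    vertex of [B] over v. Its labels seen from g and from h differ by a local element, and each is
    one letter away from g or h: three letters in all. *)
Lemma near_prod_len g h (s t : simplex K) (x : spt s) (y : spt t) :
  dB (bp g x) (bp h y) < (#|V|.+1)%:R^-1 -> prod_len 3 (g^-1 * h)%g.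
Proof.
set e : R := _^-1 => ab; have e0 : 0 < e by rewrite invr_gt0.
have [v hv] : exists v, e <= bcoord (bp g x) v.
  apply: contrapT => /forallNP no; have := (bary_coord (bp g x)).2.
  have : \sum_v bcoord (bp g x) v <= \sum_(v : V) e.
    by apply: ler_sum => v _; rewrite leNgt; apply/negP => /ltW; exact: no.
  rewrite sumr_const => h1 h2; rewrite h2 in h1.
  have n0 : #|V|.+1%:R != 0 :> R by rewrite pnatr_eq0.
  have : e *+ #|V|.+1 = 1 by rewrite /e -[RHS](mulVf n0) mulr_natr.
  by rewrite mulrS => h3; lra.
have xv : bcoord (bp g x) v != 0 by rewrite gt_eqF//; lra.
have yv : bcoord (bp h y) v != 0.
  have := eucl_coord (bcoord (bp g x)) (bcoord (bp h y)) v.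
  have := dev_dist_eucl dev_connected (bp g x) (bp h y).
  rewrite ler_distl => h1 /andP[h2 h3]; rewrite gt_eqF//; lra.
have vs : v \in val s.
  by have /in_simplexP[_ k] := valP x; apply: k; move: xv; rewrite bcoordE.
have vt : v \in val t.
  by have /in_simplexP[_ k] := valP y; apply: k; move: yv; rewrite bcoordE.
have jy : joined (bp g (vertex_pt vs)) (bp h y).
  apply: (dev_star dev_connected ab); first by exists g, s, (vertex_pt vs), x.
  by move=> w; rewrite bcoordE => /delta_supp ->.
have [h' [t' [z [z' [e1 e2]]]]] := jy.
have sub : subsupp (delta_pt v) (bcoord (bp h y)) by move=> w /delta_supp ->.
have [b' [_ hb]] := retract_ex (delta_bary v) sub.
have [w [w1 w2]] := hb _ _ _ erefl; have [w' [w1' w2']] := hb _ _ _ e2.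
have eqv : bp g (vertex_pt vs) = bp h w.
  rewrite -w2 w2' e1; congr (to_quot _ (dev_pt _ _)); apply: val_inj.
  by rewrite /= w1' -[LHS](bcoordE h' z) -e1 bcoordE.
have vK : [set v] \in K.
  apply: scK.2 (valP s) _ _; last by rewrite finset.sub1set.
  by apply/set0Pn; exists v; rewrite inE.
pose vv : simplex K := exist _ [set v] vK.
have pv : pt_coord (dev_pt g (vertex_pt vs)) v != 0.
  by rewrite /pt_coord /= ffunE eqxx oner_eq0.
have qv : pt_coord (dev_pt h w) v != 0 by rewrite /pt_coord /= w1 ffunE eqxx oner_eq0.
have [g1 hg1] := @over_vertex_ex _ vv v erefl pv.
have [h1 hh1] := @over_vertex_ex _ vv v erefl qv.
have /to_quotP eqv' := eqv.
have [a ha] := over_vertex_rel eqv' (erefl : val vv = [set v]) pv hg1 hh1.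
have [u u1 u2] := over_vertex_step hg1; have [u' u1' u2'] := over_vertex_step hh1.
have -> : (g^-1 * h)%g = (u * loc vv a * u'^-1)%g.
  have -> : h = (g * u * loc vv a / u')%g by rewrite -u2 -ha u2' mulgK.
  by rewrite !mulgA mulVg mul1g.
do 2?[apply: prod_lenS]; last exact: step_eltV; last exact: step_loc.
exact: prod_len1.
Qed.

Variables (s0 : simplex K) (x0 : spt s0).
Definition orbit_pt (g : G) : B := bp g x0.
Local Notation Q := orbit_pt.
Definition orbit_dist (g h : G) : R := dB (Q g) (Q h).
Local Notation rho := orbit_dist.

Lemma orbit_pm : pseudo_metric rho.
Proof.
split=> [x|x y|x y|y x z]; [exact: (pm0 pm)|exact: (pm_ge0 pm)|exact: (pmC pm)|exact: (pmT pm)].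
Qed.

Lemma orbit_dense : exists L : nat, forall b : B, exists g, dB b (Q g) <= L%:R.
Proof.
have [L hL] := same_elt_chain; exists L; elim/development_ind => g s x.
have [n [l [l1 l2]]] := hL g s s0 x x0; exists g.
exact: le_trans (dev_dist_le dev_connected l2) l1.
Qed.

Lemma orbit_dist_prod : exists L : nat, forall n g h, prod_len n (g^-1 * h)%g ->
  rho g h <= (L * n.+1)%:R.
Proof.
have [L hL] := prod_chain; exists L => n g h hn.
have [m [l [l1 l2]]] := hL n g _ s0 s0 x0 x0 hn; rewrite mulVKg in l2.
exact: le_trans (dev_dist_le dev_connected l2) l1.
Qed.

(** Cut a path of length below r + 1 into M pieces shorter than [1 / (#|V| + 1)]. By [near_prod_len]
    each costs three letters; three more pay for the choice of representative at the start. *)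
Lemma prod_of_orbit_dist (r : nat) : exists N, forall g h, rho g h <= r%:R ->
  prod_len N (g^-1 * h)%g.
Proof.
pose M := (r.+1 * #|V|.+1)%N; exists (3 * M + 3)%N => g h gh.
have [|n [l [l1 l2]]] := dev_dist_lt dev_connected (a := Q g) (b := Q h) (l := r.+1%:R).
  by apply: le_lt_trans gh _; rewrite ltr_nat.
have [A [l0 [c [c0 cl _ hc]]]] := qchain_lpath_dev dev_connected l2.
have M0 : (0 : R) < M%:R by rewrite ltr0n.
pose d := l / M%:R; have d0 : 0 <= d by rewrite divr_ge0// ltW.
have dM : d * M%:R = l by rewrite mulfVK// gt_eqF.
have dl : d < (#|V|.+1)%:R^-1.
  rewrite /d ltr_pdivrMr// /M natrM mulrCA mulVf ?mulr1// pnatr_eq0//.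
suff key i : (i <= M)%N -> forall k (t : simplex K) (y : spt t), c (d * i%:R) = bp k y ->
    prod_len (3 * i + 3) (g^-1 * k)%g.
  by apply: (key M (leqnn _) h s0 x0); rewrite dM.
elim: i => [|i IH] iM k t y cE.
  rewrite mulr0 c0 in cE; rewrite muln0 add0n; apply: (near_prod_len (x := x0) (y := y)).
  by rewrite -cE (pm0 pm) invr_gt0.
have [k' [t' [y' cE']]] : exists k' (t' : simplex K) (y' : spt t'), c (d * i%:R) = bp k' y'.
  by elim/development_ind: (c _) => k' t' y'; exists k', t', y'.
have h1 := IH (ltnW iM) _ _ _ cE'.
have h2 : prod_len 3 (k'^-1 * k)%g.
  apply: (near_prod_len (x := y') (y := y)); rewrite -cE -cE'.
  have inI j : (j <= M)%N -> d * j%:R \in `[0, l].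
    move=> jM; rewrite in_itv /= mulr_ge0//= -dM; apply: ler_wpM2l => //.
    by rewrite ler_nat.
  apply: le_lt_trans (hc _ _ (inI _ (ltnW iM)) (inI _ iM)) _.
  rewrite -mulrBr -[i.+1]addn1 natrD opprD addrA subrr sub0r mulrN1 normrN.
  by rewrite ger0_norm.
have -> : (3 * i.+1 + 3 = 3 * i + 3 + 3)%N by lia.
have -> : (g^-1 * k = g^-1 * k' * (k'^-1 * k))%g by rewrite mulgA mulgK.
exact: prod_len_cat.
Qed.

Variable S : seq G.
Hypothesis gen : generates S.
Variable c : nat.
Hypothesis H : hyp_graph (wd S) c.

Lemma orbit_lip : exists A : nat, forall x y, rho x y <= A%:R * (wd S x y)%:R.
Proof.
have [L hL] := orbit_dist_prod.
have [|s _|A hA] := @letters_bound _ S (fun s n => forall g, rho g (g * s)%g <= n%:R).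
- by move=> g n m nm h k; apply: le_trans (h k) _; rewrite ler_nat.
- have [n hn] := prod_len_all s; exists (L * n.+1)%N => g.
  by apply: hL; rewrite mulKg.
by exists A; apply: (word_lip gen orbit_pm) => g s sS; exact: hA.
Qed.

Hypothesis qcv : forall s : simplex K, exists K' : nat, forall (a : Y s) p,
  btw (wd S) 1%g (loc s a) p -> exists a' : Y s, (wd S p (loc s a') <= K')%N.

(** For one letter: an edge symbol has bounded word length, and for a local element the interval
    runs close to a coset of the local group, which is rho-bounded. Thin triangles extend this to n
    letters. *)
Lemma orbit_btw n : exists h : nat, forall x y p, prod_len n (x^-1 * y)%g ->
  btw (wd S) x y p -> rho x p <= h%:R.
Proof.
have [A hA] := orbit_lip; have [L hL] := orbit_dist_prod.
have rT := pmT orbit_pm.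
have [| |K' hK'] := @fin_bound (simplex K) (fun s n => forall (a : Y s) p,
    btw (wd S) 1%g (loc s a) p -> exists a' : Y s, (wd S p (loc s a') <= n)%N).
- move=> s k m km h a p /h[a' ha']; exists a'; exact: leq_trans ha' km.
- exact: qcv.
have [| |E hE] := @fin_bound (simplex K * simplex K)%type (fun st n =>
    forall e : edge st.1 st.2, (wlen S (ked e) <= n)%N).
- by move=> st k m km h e; apply: leq_trans (h e) km.
- move=> [s t] /=; case: (pselect (edge s t)) => [e|ne].
    by exists (wlen S (ked e)) => e'; rewrite (edge_irr e' e).
  by exists 0%N.
have one : exists h : nat, forall x y p, step_elt (x^-1 * y)%g -> btw (wd S) x y p ->
    rho x p <= h%:R.
  exists (L * 2 + A * K' + A * E)%N => x y p hs hp.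
  have short : (wd S x y <= E)%N -> rho x p <= (L * 2 + A * K' + A * E)%:R.
    move=> h1; apply: le_trans (hA _ _) _; rewrite -natrM ler_nat.
    apply: leq_trans (leq_addl _ _); rewrite leq_mul2l; apply/orP; right.
    by move: hp; rewrite /btw; lia.
  move: hs; move hu : (x^-1 * y)%g => u hs; case: hs hu => [s a|s t e|s t e] hu.
  - have hp' : btw (wd S) 1%g (loc s a) (x^-1 * p)%g.
      move: hp; rewrite /btw -(wd_mull S x^-1 x p) -(wd_mull S x^-1 p y) -(wd_mull S x^-1 x y).
      by rewrite mulVg hu.
    have [a' ha'] := hK' s a _ hp'.
    have h1 : rho x (x * loc s a')%g <= (L * 2)%:R.
      by apply: hL; rewrite mulKg; apply: prod_len1; exact: step_loc.
    have h2 : rho (x * loc s a')%g p <= (A * K')%:R.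
      rewrite (pmC orbit_pm); apply: le_trans (hA _ _) _; rewrite -natrM ler_nat leq_mul2l.
      by apply/orP; right; rewrite -(wd_mull S x^-1) mulKg.
    have := rT (x * loc s a')%g x p; rewrite !natrD; have := ler0n R (A * E); lra.
  - by apply: short; rewrite /wd hu; exact: (hE (s, t)).
  - by apply: short; rewrite /wd hu wlenV//; exact: (hE (s, t)).
have [h1 hh1] := one; elim: n => [|n [h IH]].
  exists 0%N => x y p hn; have -> : y = x.
    by rewrite -[y](mulVKg x) (prod_len_inv hn) mulg1.
  by move=> /(btw_xx H) ->; rewrite (pm0 orbit_pm).
exists (h + h1 + A * (c + c))%N => x y p /prod_len_inv[u [v [hu hv k2]]]; pose z := (x * u)%g.
have xz : prod_len n (x^-1 * z)%g by rewrite /z mulKg.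
have zy : step_elt (z^-1 * y)%g.
  by rewrite /z invgM -mulgA k2 mulKg.
have near q : (wd S p q <= c + c)%N -> rho x q <= (h + h1)%:R ->
    rho x p <= (h + h1 + A * (c + c))%:R.
  move=> pq xq; apply: le_trans (rT q _ _) _; rewrite natrD; apply: lerD => //.
  by rewrite (pmC orbit_pm); apply: le_trans (hA _ _) _; rewrite -natrM ler_nat leq_mul2l pq orbT.
move=> /(btw_thin H z)[[q q1 q2]|[q q1 q2]]; apply: near q2 _.
  by apply: le_trans (IH _ _ _ xz q1) _; rewrite ler_nat leq_addr.
rewrite natrD; apply: le_trans (rT z _ _) _; apply: lerD; last exact: hh1 zy q1.
exact: IH xz (btw_r H _ _).
Qed.

(** Rough geodesics come from a geodesic of [B], sampled at integer times and moved to nearby orbit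
    points. *)
Theorem orbit_model : model (wd S) rho.
Proof.
split.
- exact: orbit_pm.
- exact: orbit_lip.
- move=> r; have [N hN] := prod_of_orbit_dist r; have [h hh] := orbit_btw N.
  by exists h => x y p /hN; exact: hh.
- have [L hL] := orbit_dense; exists (2 * L + 1)%N => x y.
  have [A [c' [c0 cl _ hc]]] := development_geodesic dev_connected (Q x) (Q y).
  set l := dB (Q x) (Q y) in cl hc; have l0 : 0 <= l by exact: (pm_ge0 pm).
  have [n ln] : exists2 n : nat, (0 < n)%N & n%:R <= l + 1 /\ l <= n%:R.
    exists (Num.truncn l).+1 => //; have /andP[h1 h2] := truncn_itv l0.
    by rewrite -natr1 lerD2r h1 natr1 ltW.
  case=> n1 n2.
  (* The length l need not be an integer; the last step may be shorter, which the additive constant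
     absorbs. *)
  pose t (i : nat) : R := Num.min i%:R l.
  have tI i : t i \in `[0, l].
    by rewrite in_itv /= /t le_min ler0n l0 ge_min lexx orbT.
  have [i|z hz] := @choice nat G (fun i g => (i <= n)%N ->
      [/\ dB (c' (t i)) (Q g) <= L%:R, i = 0%N -> g = x & i = n -> g = y]).
    have [i0|i0] := eqVneq i 0%N.
      exists x => _; split=> //; last by move=> ni; rewrite -ni i0 in ln.
      by rewrite /t i0 (min_idPl l0) c0 (pm0 pm).
    have [ni|ni] := eqVneq i n.
      exists y => _; split=> //; last by move=> e; rewrite e eqxx in i0.
      by rewrite /t ni (min_idPr n2) cl (pm0 pm).
    have [g hg] := hL (c' (t i)); exists g => _; split=> // e.
      by rewrite e eqxx in i0.
    by rewrite e eqxx in ni.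
  exists n, z; split.
  + by have [_ h _] := hz 0%N (leq0n _); exact: h.
  + by have [_ _ h] := hz n (leqnn _); exact: h.
  + move=> i j /andP[ij jn]; have [i1 _ _] := hz i (leq_trans ij jn).
    have [j1 _ _] := hz j jn; have tij := hc _ _ (tI i) (tI j).
    have T1 := pmT pm (c' (t i)) (Q (z i)) (Q (z j)).
    have T2 := pmT pm (c' (t j)) (c' (t i)) (Q (z j)).
    have T3 := pmT pm (Q (z i)) (c' (t i)) (c' (t j)).
    have T4 := pmT pm (Q (z j)) (Q (z i)) (c' (t j)).
    rewrite (pmC pm (Q (z i)) (c' (t i))) in T1; rewrite (pmC pm (Q (z j)) (c' (t j))) in T4.
    have jn' : j%:R <= l + 1 by apply: le_trans n1; rewrite ler_nat.
    have ij' : i%:R <= j%:R :> R by rewrite ler_nat.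
    have : j%:R - i%:R - 1 <= `|t i - t j| <= j%:R - i%:R.
      rewrite distrC ger0_norm; last first.
        rewrite subr_ge0 /t le_min ge_min ij' /= ge_min lexx orbT//.
      by rewrite /t /Num.min; case: ifP => h1; case: ifP => h2; apply/andP; split; lra.
    move=> /andP[b1 b2]; rewrite /rho ler_distl natrB// natrD natrM; apply/andP; split; lra.
Qed.

End Orbit.

(** * Limits of geodesic rays *)

Section PairRays.
Variables (R : realType) (X1 X : Type) (d1 : X1 -> X1 -> nat) (d : X -> X -> nat).
Variables (c1 c : nat) (iota : X1 -> X) (L : nat).
Hypothesis H1 : hyp_graph d1 c1.
Hypothesis H : hyp_graph d c.
Hypothesis iota_lip : forall x y, (d (iota x) (iota y) <= L * d1 x y)%N.
Local Notation I1 := (btw d1).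
Local Notation I := (btw d).

(** By [btw_jump] some image [iota w] is about as far from [iota x] as p is. It is near a point q of
    the interval, and the four-point condition compares p with q. *)
Lemma btw_near_image (k : nat) x y p :
  (forall w, I1 x y w -> exists2 q, I (iota x) (iota y) q & (d (iota w) q <= k)%N) ->
  I (iota x) (iota y) p -> exists w, (d p (iota w) <= 2 * k + L + c)%N.
Proof.
move=> hk hp; case: (leqP (d (iota x) (iota y)) (d (iota x) p)) => [h|h].
  exists y; move: hp h; rewrite /btw; lia.
have [||w [w' [a1 a2 a3 a4 a5]]] := @btw_jump _ _ H1
  (fun w => d (iota x) (iota w) <= d (iota x) p)%N x y.
- by rewrite (geod0 H).
- by apply/negP; rewrite -ltnNge.
exists w; move/negP: a5; rewrite -ltnNge => a5; have [q q1 q2] := hk w a1.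
have e1 := iota_lip w w'; rewrite a3 muln1 in e1.
have t1 := geodT H (iota w) (iota x) (iota w'); have t2 := geodT H (iota w) (iota x) q.
have t3 := geodT H q (iota x) (iota w); have t4 := geodT H q p (iota w).
have t5 := hypd4 H p q (iota x) (iota y); rewrite (geodC H q (iota w)) in t3 t4.
move: hp q1 t5; rewrite /btw (geodC H p (iota x)) (geodC H q (iota x)); lia.
Qed.

Variables (rho1 : X1 -> X1 -> R) (rho : X -> X -> R) (A1 A B1 B : nat).
Hypothesis pm1 : pseudo_metric rho1.
Hypothesis pm : pseudo_metric rho.
Hypothesis lip : forall x y, rho x y <= A%:R * (d x y)%:R.
Hypothesis al1 : forall x y p, I1 x y p -> rho1 x p + rho1 p y <= rho1 x y + B1%:R.
Hypothesis al : forall x y p, I x y p -> rho x p + rho p y <= rho x y + B%:R.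
Hypothesis und : forall D : nat, exists C, forall x y, rho1 x y <= D%:R ->
  undistorted d1 d iota C x y.
Variable o : X1.
Hypothesis mitra : forall m : R, exists n, forall x y,
  n <= gromov_prod rho1 o x y -> m <= gromov_prod rho (iota o) (iota x) (iota y).
Hypothesis iota_short : forall x y, rho (iota x) (iota y) <= rho1 x y.

(** By alignment the distance rho1 from o, once large along the ray, drops later by at most a
    constant, and the product of two terms is about the distance of the earlier one. *)
Lemma ray_unbounded_cvg (u : nat -> X1) :
  (forall k l, (k <= l)%N -> I1 o (u l) (u k)) ->
  (forall D : nat, exists k, D%:R < rho1 o (u k)) ->
  forall D : R, exists N, forall i j, (N <= i)%N -> (N <= j)%N ->
    D <= gromov_prod rho1 o (u i) (u j).
Proof.
move=> hu unb D; have [D' hD'] := nat_bound (D + 2 * B1%:R).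
have [k hk] := unb D'; exists k => i j; wlog ij : i j / (i <= j)%N.
  move=> h ki kj; have [ij|/ltnW ji] := leqP i j; first exact: h.
  by rewrite (gromov_prodC pm1); exact: h.
move=> ki kj; have := al1 (hu _ _ ij); have := al1 (hu _ _ ki).
have := pm_ge0 pm1 (u k) (u i); have := ler0n R B1.
by rewrite /gromov_prod !(pmC pm1 _ o); lra.
Qed.

(* If the image of a bi-infinite geodesic leaves every ball, then neither of its ends is
   bounded for rho1: a bounded end is undistorted, hence stays close to the image. *)
Lemma rays_converge (u v : nat -> X1) :
  (forall k l, (k <= l)%N -> I1 o (u l) (u k)) ->
  (forall k l, (k <= l)%N -> I1 o (v l) (v k)) ->
  (forall i j, I1 (u i) (v j) o) ->
  (forall m : nat, exists N, forall i j, (N <= i)%N -> (N <= j)%N ->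
     forall p, I (iota (u i)) (iota (v j)) p -> (m < d (iota o) p)%N) ->
  forall D : R, exists N, forall i j, (N <= i)%N -> (N <= j)%N ->
    [/\ D <= gromov_prod rho1 o (u i) (u j), D <= gromov_prod rho1 o (v i) (v j) &
        D <= gromov_prod rho (iota o) (iota (u i)) (iota (v j))].
Proof.
move=> hu hv huv far.
have far' m : exists N, forall i j, (N <= i)%N -> (N <= j)%N ->
    forall p, I (iota (v i)) (iota (u j)) p -> (m < d (iota o) p)%N.
  have [N hN] := far m; exists N => i j iN jN p /(btwC H); exact: hN.
have img (w : nat -> X1) : (forall D : R, exists N, forall i j, (N <= i)%N -> (N <= j)%N ->
      D <= gromov_prod rho1 o (w i) (w j)) ->
    forall D : R, exists N, forall i j, (N <= i)%N -> (N <= j)%N ->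
      D <= gromov_prod rho (iota o) (iota (w i)) (iota (w j)).
  move=> h D; have [n hn] := mitra D; have [N hN] := h n.
  by exists N => i j iN jN; apply: hn; exact: hN.
(* If one end is rho1-unbounded, [aligned_limit] drives the image of the other end to infinity for
   rho; as iota shortens distances, the other end is not rho1-bounded. *)
have mixed (w z : nat -> X1) : (forall k l, (k <= l)%N -> I1 o (w l) (w k)) ->
    (forall m, exists N, forall i j, (N <= i)%N -> (N <= j)%N ->
      forall p, I (iota (w i)) (iota (z j)) p -> (m < d (iota o) p)%N) ->
    (forall D : nat, exists k, D%:R < rho1 o (w k)) ->
    forall D : nat, ~ (forall k, rho1 o (z k) <= D%:R).
  move=> hw hwz unb D bd.
  have [N hN] := aligned_limit H pm lip al (u := iota \o w) (v := iota \o z)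
    (img w (ray_unbounded_cvg hw unb)) hwz (D%:R + 1).
  have [h _] := hN N N (leqnn _) (leqnn _).
  by have := bd N; have := iota_short o (z N); move: h => /=; lra.
have bounded (w : nat -> X1) : ~ (forall D : nat, exists k, D%:R < rho1 o (w k)) ->
    exists D : nat, forall k, rho1 o (w k) <= D%:R.
  move=> /existsNP[D hD]; exists D => k; rewrite leNgt; apply/negP => h; apply: hD.
  by exists k.
have unbu : forall D : nat, exists k, D%:R < rho1 o (u k).
  apply: contrapT => /bounded[D hD].
  have [unbv|/bounded[D' hD']] := pselect (forall D : nat, exists k, D%:R < rho1 o (v k)).
    exact: (mixed v u hv far' unbv D hD).
  (* With both ends bounded the interval through o is undistorted, so [iota o] is near the interval
     of the images, which should leave every ball. *)
  have [C hC] := und (D + D'); have [K hK] := undistorted_stable R H1 H iota_lip C.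
  have [N hN] := far K.
  have uN : undistorted d1 d iota C (u N) (v N).
    apply: hC; have := pmT pm1 o (u N) (v N); rewrite (pmC pm1 (u N) o) natrD.
    by have := hD N; have := hD' N; lra.
  have [p p1 p2] := (hK _ _ uN).2 _ (huv N N).
  by have := hN N N (leqnn _) (leqnn _) p p1; lia.
have unbv : forall D : nat, exists k, D%:R < rho1 o (v k).
  by apply: contrapT => /bounded[D hD]; exact: (mixed u v hu far unbu D hD).
move=> D; have cu := ray_unbounded_cvg hu unbu.
have [N1 h1] := cu D; have [N2 h2] := ray_unbounded_cvg hv unbv D.
have [N3 h3] := aligned_limit H pm lip al (u := iota \o u) (v := iota \o v) (img u cu) far D.
exists (N1 + N2 + N3)%N => i j iN jN; split; [apply: h1; lia|apply: h2; lia|].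
by have [||_ hh] := h3 i j; [lia|lia|exact: hh].
Qed.

End PairRays.

(** Translates the condition on balls into products: a large product puts the interval far from o,
    and [d <= Lr * rho] lets the d-distance of the center of the image triangle bound its product
    from below. It is applied to word metrics of arbitrary generating sets. *)
Lemma gromov_proper_image (R : realType) (X1 X : Type) (d1 : X1 -> X1 -> nat)
    (d : X -> X -> nat) (c1 c : nat) (iota : X1 -> X) (rho1 : X1 -> X1 -> R)
    (rho : X -> X -> R) (Lr : nat) (o : X1) :
  hyp_graph d1 c1 -> hyp_graph d c -> model d1 rho1 -> model d rho ->
  (forall x y, (d x y)%:R <= Lr%:R * rho x y) ->
  (forall m, exists n, forall x y, (forall p, btw d1 x y p -> (n <= d1 o p)%N) ->
     forall p, btw d (iota x) (iota y) p -> (m < d (iota o) p)%N) ->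
  forall M, exists N, forall x y, N <= gromov_prod rho1 o x y ->
    M <= gromov_prod rho (iota o) (iota x) (iota y).
Proof.
move=> H1 H M1 M hLr far m.
have [B1 al1] := alignment H1 M1; have [B al] := alignment H M.
have [A1 lip1] := mod_lip M1; have [A lip] := mod_lip M.
have [K hK] := gp_center H (mod_pm M) lip al; have [m' hm'] := nat_bound (m + K%:R).
have [n hn] := far (Lr * m')%N; exists (A1%:R * n%:R + B1%:R + 1) => x y xy.
have [q [q1 q2 _ _]] := hK (iota o) (iota x) (iota y).
have := hn x y _ q q1; rewrite -(ltr_nat R) natrM => h.
have {}h : Lr%:R * m'%:R < (d (iota o) q)%:R :> R.
  apply: h => p hp; rewrite leqNgt; apply/negP => pn.
  have := gp_le_btw (mod_pm M1) al1 o hp; have := lip1 o p.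
  have : A1%:R * (d1 o p)%:R <= A1%:R * n%:R :> R by rewrite ler_wpM2l// ler_nat ltnW.
  lra.
have h2 := lt_le_trans h (hLr (iota o) q).
have : m'%:R <= rho (iota o) q.
  rewrite leNgt; apply/negP => h3; have : Lr%:R * rho (iota o) q <= Lr%:R * m'%:R.
    by rewrite ler_wpM2l// ltW.
  by lra.
lra.
Qed.

Lemma gromov_ineq_dense (R : realType) (X T : Type) (dT : T -> T -> R) (q : X -> T) (L K : R) :
  pseudo_metric dT -> (forall b, exists x, dT b (q x) <= L) ->
  gromov_ineq (fun x y => dT (q x) (q y)) K -> exists K', gromov_ineq dT K'.
Proof.
move=> pm dense hK; exists (K + 6 * L) => w x y z.
have [w' hw] := dense w; have [x' hx] := dense x; have [y' hy] := dense y.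
have [z' hz] := dense z; have := hK w' x' y' z'.
have C := pmC pm.
have := gromov_prod_diff pm w x z (q w') (q x') (q z').
have := gromov_prod_diff pm w z y (q w') (q z') (q y').
have := gromov_prod_diff pm (q w') (q x') (q y') w x y.
rewrite (C (q w') w) (C (q x') x) (C (q y') y) /gromov_prod => h1 h2 h3.
by rewrite !ge_min => /orP[h4|h4]; apply/orP; [left|right]; lra.
Qed.

(** The pigeonhole principle along an ultrafilter; it replaces a diagonal choice of subsequences. *)
Lemma ultra_finite (U : set_system nat) (T : eqType) (s : seq T) (u : nat -> T) :
  UltraFilter U -> (\forall n \near U, u n \in s) -> exists x, \forall n \near U, u n = x.
Proof.
move=> uU; have pU : ProperFilter U := @ultra_proper _ _ uU.
elim: s => [|x s IH] h; first by have [n] := @filter_ex _ U pU _ h.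
have [hx|hx] := in_ultra_setVsetC [set n | u n = x]%classic uU; first by exists x.
apply: IH; apply: (@filterS2 _ U _ _ _ _ _ h hx) => n /=.
by rewrite inE => /predU1P[].
Qed.

(** * Quasiconvex subgroups *)

Section GroupPair.
Variables (R : realType) (G1 G : groupType) (iota : G1 -> G) (S1 : seq G1) (S : seq G).
Variables (c1 c : nat).
Hypothesis iotaM : {morph iota : x y / (x * y)%g}.
Hypothesis iotaI : injective iota.
Hypotheses (gen1 : generates S1) (gen : generates S).
Hypotheses (Hg1 : hyp_graph (wd S1) c1) (Hg : hyp_graph (wd S) c).
Local Notation d1 := (wd S1).
Local Notation d := (wd S).
Local Notation und := (undistorted d1 d iota).

Lemma btw_mull (G' : groupType) (S' : seq G') g x y p :
  btw (wd S') (g * x)%g (g * y)%g (g * p)%g <-> btw (wd S') x y p.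
Proof. by rewrite /btw !wd_mull. Qed.

Lemma wd_iota_mull g x y : d (iota (g * x)%g) (iota (g * y)%g) = d (iota x) (iota y).
Proof. by rewrite !iotaM wd_mull. Qed.

Lemma undistorted_translate C g x y : und C x y -> und C (g * x)%g (g * y)%g.
Proof.
move=> h u v; rewrite -{1}(mulVKg g u) -{1}(mulVKg g v) !btw_mull => hu hv.
by have := h _ _ hu hv; rewrite wd_iota_mull wd_mull.
Qed.

Section Subgroup.
Variable H : set G1.
Hypothesis qc : quasiconvex R (iota @` H)%classic.

(** Consecutive terms of the sequence in the image are at bounded d-distance, so their preimages are
    at bounded d1-distance, because iota is proper. *)
Lemma quasiconvex_pullback : exists A : nat, forall x y, H x -> H y ->
  exists n (z : nat -> G1),
    [/\ z 0%N = x, z n = y, forall i, (i <= n)%N -> H (z i) &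
    forall i j, (i <= j <= n)%N -> (d1 (z i) (z j) <= A * (j - i))%N /\
      (j - i <= A * d (iota (z i)) (iota (z j)) + A)%N].
Proof.
have [A hA] := quasiconvex_sequences qc gen.
have [m hm] := wd_proper S1 iotaM gen iotaI (A * 1 + A).
exists (m + A)%N => x y Hx Hy.
have [||n [w [w0 wn wH hw]]] := hA (iota x) (iota y); [by exists x|by exists y|].
have [i|z hz] := @choice nat G1 (fun i g => (i <= n)%N -> H g /\ iota g = w i).
  case: (leqP i n) => [/wH[g Hg' gi]|ni]; first by exists g.
  by exists 1%g.
have step i : (i < n)%N -> (d1 (z i) (z i.+1) <= m)%N.
  move=> ni; apply: hm; rewrite (hz _ (ltnW ni)).2 (hz _ ni).2.
  by have := hw i i.+1; rewrite leqnSn ni subSnn => /(_ isT)[].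
exists n, z; split.
- by apply: iotaI; rewrite (hz 0%N (leq0n _)).2.
- by apply: iotaI; rewrite (hz n (leqnn _)).2.
- by move=> i /hz[].
- move=> i j /andP[ij jn]; split; last first.
    rewrite (hz i (leq_trans ij jn)).2 (hz j jn).2.
    have := hw i j; rewrite ij jn => /(_ isT)[_ h]; apply: leq_trans h _.
    by apply: leq_add; rewrite ?leq_mul2r ?leq_addl ?orbT.
  apply: (@leq_trans (m * (j - i))); last by rewrite leq_mul2r leq_addr orbT.
  elim: j ij jn => [|j IH] ij jn.
    by move: ij; rewrite leqn0 => /eqP ->; rewrite (geod0 Hg1).
  move: ij; rewrite leq_eqVlt ltnS => /predU1P[<-|ij]; first by rewrite (geod0 Hg1).
  rewrite subSn// mulnS; have := IH ij (ltnW jn); have := step j jn.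
  by have := geodT Hg1 (z j) (z i) (z j.+1); lia.
Qed.

(** As iota is Lipschitz, the pulled-back sequence is a quasi-geodesic of d1; thus quasiconvexity of
    the image in G passes to H in G1. *)
Lemma quasiconvex_btw : exists k : nat, forall x y p, H x -> H y -> btw d1 x y p ->
  exists2 h, H h & (d1 p h <= k)%N.
Proof.
have [A hA] := quasiconvex_pullback; have [L hL] := wd_lip iotaM gen1 gen.
have [k hk] := stability Hg1 (model_self Hg1 R) (A * L + A)%N.
exists k => x y p Hx Hy hp; have [n [z [z0 zn zH hz]]] := hA x y Hx Hy.
have [|fwd _] := hk n z.
  split=> [i ni|i j ij].
    have := hz i i.+1; rewrite leqnSn ni subSnn muln1 => /(_ isT)[h _].
    by rewrite ler_nat; apply: leq_trans h _; exact: leq_addl.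
  have [_ h] := hz i j ij; rewrite -natrM -natrD ler_nat; apply: leq_trans h _.
  apply: leq_add; last exact: leq_addl.
  apply: (@leq_trans (A * (L * d1 (z i) (z j)))); first by rewrite leq_mul2l hL orbT.
  by rewrite mulnA leq_mul2r leq_addr orbT.
rewrite z0 zn in fwd; have [i ni pi] := fwd p hp; exists (z i); first exact: zH.
by rewrite -(ler_nat R).
Qed.

(** Points of the interval are moved into H by [quasiconvex_btw]; between elements of H the
    pulled-back sequence compares d1 with the d-distance of the images. *)
Lemma quasiconvex_undistorted : exists C : nat, forall x y, H x -> H y -> und C x y.
Proof.
have [A hA] := quasiconvex_pullback; have [L hL] := wd_lip iotaM gen1 gen.
have [k hk] := quasiconvex_btw.
exists (A * A * (2 * (L * k)) + A * A + 2 * k)%N => x y Hx Hy u v hu hv.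
have [p Hp up] := hk x y u Hx Hy hu; have [q Hq vq] := hk x y v Hx Hy hv.
have pq : (d1 p q <= A * (A * d (iota p) (iota q) + A))%N.
  have [n [z [z0 zn zH hz]]] := hA p q Hp Hq.
  have := hz 0%N n; rewrite leq0n leqnn z0 zn subn0 => /(_ isT)[h1 h2].
  by apply: leq_trans h1 _; rewrite leq_mul2l h2 orbT.
have t1 := geodT Hg1 p u v; have t2 := geodT Hg1 q p v; rewrite (geodC Hg1 q v) in t2.
have t3 := geodT Hg (iota u) (iota p) (iota q); have t4 := geodT Hg (iota v) (iota u) (iota q).
have up' := leq_trans (hL u p) (leq_mul (leqnn L) up).
have vq' := leq_trans (hL v q) (leq_mul (leqnn L) vq).
rewrite (geodC Hg (iota p) (iota u)) in t3.
have h : (d (iota p) (iota q) <= d (iota u) (iota v) + 2 * (L * k))%N by lia.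
have h' := leq_mul (leqnn (A * A)%N) h; rewrite mulnDr mulnA in pq.
apply: (@leq_trans (A * A * (d (iota u) (iota v) + 2 * (L * k)) + A * A + 2 * k)); first by lia.
rewrite mulnDr; move: (A * A)%N (L * k)%N (d _ _) => a b e {t3 t4 up' vq' h h' pq}.
by rewrite !mulnDl; lia.
Qed.

End Subgroup.

(** Translate each bad point to 1. The two halves of the geodesics through 1 grow in length and
    converge along an ultrafilter, since balls are finite. The interval between the images of [u i]
    and [v j] is one side of a thin quadrilateral whose other sides are far from [iota 1]: one by
    badness, two by the first hypothesis. *)
Lemma escaping_rays :
  (forall m, exists n, forall x y, (forall p, btw d1 x y p -> (n <= d1 1%g p)%N) ->
     forall p, btw d (iota x) (iota y) p -> (m < d (iota 1%g) p)%N) ->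
  (forall k : nat, exists x y w, btw d1 x y w /\
     forall p, btw d (iota x) (iota y) p -> (k < d (iota w) p)%N) ->
  exists u v : nat -> G1, [/\ forall k l, (k <= l)%N -> btw d1 1%g (u l) (u k),
    forall k l, (k <= l)%N -> btw d1 1%g (v l) (v k),
    forall i j, btw d1 (u i) (v j) 1%g &
    forall m : nat, exists N, forall i j, (N <= i)%N -> (N <= j)%N ->
     forall p, btw d (iota (u i)) (iota (v j)) p -> (m < d (iota 1%g) p)%N].
Proof.
move=> far bad.
have [n|ab hab] := @choice nat (G1 * G1)%type (fun n ab => btw d1 ab.1 ab.2 1%g /\
    forall p, btw d (iota ab.1) (iota ab.2) p -> (n < d (iota 1%g) p)%N).
  have [x [y [w [h1 h2]]]] := bad n; exists (w^-1 * x, w^-1 * y)%g => /=; split.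
    by rewrite -(btw_mull S1 w) !mulVKg mulg1.
  move=> p; rewrite -(btw_mull S (iota w)) -!iotaM !mulVKg => /h2.
  by rewrite -(wd_mull S (iota w) (iota 1%g) p) -iotaM mulg1.
have [L hL] := wd_lip iotaM gen1 gen.
have [U [uU Uoo]] := ultraFilterLemma eventually_filter.
have pU : ProperFilter U := @ultra_proper _ _ uU.
have big (a : nat -> G1) (ha : forall n, (n < d (iota 1%g) (iota (a n)))%N) :
    exists u : nat -> G1, [/\ forall k l, (k <= l)%N -> btw d1 1%g (u l) (u k),
      forall k, d1 1%g (u k) = k & forall k, \forall n \near U, btw d1 1%g (a n) (u k)].
  have [z hz] := choice (fun n => geo_fun Hg1 1%g (a n)).
  have len k : \forall n \near U, (k <= d1 1%g (a n))%N.
    apply: Uoo; exists (L * k)%N => // n /= kn.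
    have := leq_trans (ha n) (hL 1%g (a n)); rewrite leqNgt => h; rewrite leqNgt.
    apply: contra h => h; apply: leq_ltn_trans (leq_mul (leqnn L) (ltnW h)) _.
    by rewrite ltnS.
  have [k|u hu] := @choice nat G1 (fun k x => \forall n \near U, z n k = x).
    have [s hs] := wd_ball gen1 k.
    apply: (@ultra_finite U _ s _ uU); apply: filterS (len k) => n kn.
    apply: hs; have [z0 zn zd] := hz n; have := zd 0%N k.
    by rewrite kn z0 /wd invg1 mul1g subn0 => /(_ isT) ->.
  have ukl k l : (k <= l)%N ->
      \forall n \near U, [/\ (l <= d1 1%g (a n))%N, z n k = u k & z n l = u l].
    move=> kl; apply: filterS3 (len l) (hu k) (hu l) => n h1 h2 h3; by split.
  have uk k : d1 1%g (u k) = k.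
    have [n [h1 h2 _]] := @filter_ex _ U pU _ (ukl k k (leqnn _)).
    by have [z0 _ zd] := hz n; rewrite -h2 -z0 zd ?subn0// leq0n.
  exists u; split=> //.
    move=> k l kl; have [n [h1 h2 h3]] := @filter_ex _ U pU _ (ukl k l kl).
    have [_ _ zd] := hz n; rewrite /btw !uk -h2 -h3 zd ?kl//; lia.
  move=> k; apply: filterS (ukl k k (leqnn _)) => n [h1 <- _].
  by have [z0 zn zd] := hz n; exact: geo_fun_btw z0 zn zd _ h1.
have [u [u1 u2 u3]] := big (fun n => (ab n).1) (fun n => (hab n).2 _ (btw_l Hg _ _)).
have [v [v1 v2 v3]] := big (fun n => (ab n).2) (fun n => (hab n).2 _ (btw_r Hg _ _)).
exists u, v; split=> //.
  move=> i j; have [n [h1 h2]] := @filter_ex _ U pU _ (@filterI _ U _ _ _ (u3 i) (v3 j)).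
  exact: (btw_mid Hg1 (hab n).1 (btwC Hg1 _)).
move=> m; have [N hN] := far (m + 4 * c)%N; exists N => i j iN jN p hp.
have inv : \forall n \near U, (m + 4 * c <= n)%N by apply: Uoo; exists (m + 4 * c)%N.
have [n [h1 h2 h3]] : exists n, [/\ btw d1 1%g (ab n).1 (u i), btw d1 1%g (ab n).2 (v j) &
    (m + 4 * c <= n)%N].
  apply: (@filter_ex _ U pU); apply: filterS3 (u3 i) (v3 j) inv => n ? ? ?; by split.
have side (a w : G1) k : (N <= k)%N -> d1 1%g w = k -> btw d1 1%g a w ->
    forall q, btw d (iota w) (iota a) q -> (m + 4 * c < d (iota 1%g) q)%N.
  move=> kN wk aw; apply: hN => q wq.
  have := btw_subr Hg1 aw wq; move: aw wq; rewrite /btw => e1 e2 e3; lia.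
case: (btw_thin Hg (iota (ab n).1) hp) => -[q q1 q2].
  have := side _ _ _ iN (u2 i) h1 q q1; have := geodT Hg p (iota 1%g) q; lia.
case: (btw_thin Hg (iota (ab n).2) q1) => -[t t1 t2].
  have := (hab n).2 t t1; have := geodT Hg p (iota 1%g) t; have := geodT Hg q p t; lia.
have := side _ _ _ jN (v2 j) h2 t (btwC Hg t1); have := geodT Hg p (iota 1%g) t.
by have := geodT Hg q p t; lia.
Qed.

End GroupPair.

(** * Distortion of local groups and of short products *)

Section LocalGroups.
Variables (R : realType) (V : finType) (K : {set {set V}}) (Y : complex_of_groups K).
Variable T : {set {set V} * {set V}}.
Local Notation G1 := (pi1 Y T).
Variables (G : groupType) (iota : G1 -> G) (S1 : seq G1) (S : seq G) (c1 c : nat).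
Hypothesis iotaM : {morph iota : x y / (x * y)%g}.
Hypothesis iotaI : injective iota.
Hypotheses (gen1 : generates S1) (gen : generates S).
Hypotheses (Hg1 : hyp_graph (wd S1) c1) (Hg : hyp_graph (wd S) c).
Hypothesis qc : forall s : simplex K,
  quasiconvex R (iota @` range (pi1_loc Y T s))%classic.

(** The target G is left free: the identity gives the hypothesis of [orbit_model] for the whole
    group, the inclusion gives it for the subgroup. *)
Lemma local_group_btw (s : simplex K) : exists k : nat, forall (a : Y s) p,
  btw (wd S1) 1%g (pi1_loc Y T s a) p -> exists a' : Y s, (wd S1 p (pi1_loc Y T s a') <= k)%N.
Proof.
have [k hk] := quasiconvex_btw iotaM iotaI gen1 gen Hg1 (qc s).
exists k => a p hp; have [||_ [a' _ <-] h] := hk _ _ p _ _ hp; last by exists a'.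
- by exists 1%g => //; rewrite pi1_loc1.
- by exists a.
Qed.

(** Local groups are undistorted by quasiconvexity, edge symbols are short, and [undistorted_comp]
    composes n such steps. *)
Lemma prod_len_undistorted n : exists C : nat, forall x y, prod_len n (x^-1 * y)%g ->
  undistorted (wd S1) (wd S) iota C x y.
Proof.
have [L hL] := wd_lip iotaM gen1 gen.
have [| |C hC] := @fin_bound (simplex K) (fun s C => forall a : Y s,
    undistorted (wd S1) (wd S) iota C 1%g (pi1_loc Y T s a)).
- by move=> s m k mk h a; exact: undistorted_le mk (h a).
- move=> s; have [C hC] := quasiconvex_undistorted iotaM iotaI gen1 gen Hg1 Hg (qc s).
  exists C => a; apply: hC; last by exists a.
  by exists 1%g => //; rewrite pi1_loc1.
have [| |E hE] := @fin_bound (simplex K * simplex K)%type (fun st n =>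
    forall e : edge st.1 st.2, (wlen S1 (pi1_edge Y T e) <= n)%N).
- by move=> st k m km h e; apply: leq_trans (h e) km.
- move=> [s t] /=; case: (pselect (edge s t)) => [e|ne].
    by exists (wlen S1 (pi1_edge Y T e)) => e'; rewrite (edge_irr e' e).
  by exists 0%N.
have one x y : step_elt (x^-1 * y)%g -> undistorted (wd S1) (wd S) iota (C + 2 * E) x y.
  move hu : (x^-1 * y)%g => u hs.
  have short : (wd S1 x y <= E)%N -> undistorted (wd S1) (wd S) iota (C + 2 * E) x y.
    by move=> h; apply: undistorted_le (leq_addl _ _) (undistorted_short (wd S) iota Hg1 h).
  case: hs hu => [s a|s t e|s t e] hu.
  - have -> : y = (x * pi1_loc Y T s a)%g by rewrite -hu mulVKg.
    rewrite -{1}[x]mulg1; apply: undistorted_translate => //.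
    exact: undistorted_le (leq_addr _ _) (hC s a).
  - by apply: short; rewrite /wd hu; exact: (hE (s, t)).
  - by apply: short; rewrite /wd hu wlenV//; exact: (hE (s, t)).
elim: n => [|n [C' IH]].
  exists 0%N => x y /prod_len_inv h; have -> : y = x by rewrite -[y](mulVKg x) h mulg1.
  apply: undistorted_le (leqnn _) (undistorted_short (n := 0) (wd S) iota Hg1 _) => //.
  by rewrite (geod0 Hg1).
have [C'' hC''] := undistorted_comp R Hg1 Hg hL (wd_proper S1 iotaM gen iotaI) (C' + (C + 2 * E)).
exists C'' => x y /prod_len_inv[u [v [hu hv e]]]; apply: (hC'' _ _ (x * u)%g).
  by apply: undistorted_le (leq_addr _ _) (IH _ _ _); rewrite mulKg.
apply: undistorted_le (leq_addl _ _) (one _ _ _).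
by rewrite invgM -mulgA e mulKg.
Qed.

End LocalGroups.

Lemma development_hyperbolic (R : realType) (V : finType) (K : {set {set V}})
    (Y : complex_of_groups K) (T : {set {set V} * {set V}}) (s0 : simplex K)
    (x0 : std_simplex R (val s0)) (S : seq (pi1 Y T)) (c : nat) :
  simplicial_complex K -> maximal_tree K T -> hyp_graph (wd S) c ->
  model (wd S) (orbit_dist (T := T) x0) -> hyperbolic (dev_dist R Y T).
Proof.
move=> scK mtT Hg M; have conn := @dev_connected R V K Y T scK mtT.
have pm := dev_pm conn.
split; [exact: dev_metric conn|exact: development_geodesic conn|].
have [A lip] := mod_lip M; have [B al] := alignment Hg M.
have [k hk] := aligned_gromov_ineq Hg (mod_pm M) lip al.
have [L hL] := orbit_dense Y scK mtT x0.
have [K' hK'] := gromov_ineq_dense pm hL hk.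
by exists (4 * K'); exact: (gromov_ineq_slim pm hK').
Qed.

(** * The map of developments *)

Section DevelopmentMap.
Variables (R : realType) (V : finType) (K K1 : {set {set V}}) (Y : complex_of_groups K).
Variables (sK : K1 \subset K) (T T1 : {set {set V} * {set V}}).
Local Notation Y1 := (restrict_cog sK Y).
Local Notation f := (development_map R sK Y T1 T).
Local Notation iota := (pi1_map sK Y T1 T).
Local Notation bp1 g x := (to_quot (@dev_glue V R K1 Y1 T1) (@dev_pt V R K1 Y1 T1 g _ x)).
Local Notation bp g s x := (to_quot (@dev_glue V R K Y T) (@dev_pt V R K Y T g s x)).

Hypothesis sT : T1 \subset T.

Lemma development_map_pt (g : pi1 Y1 T1) (s : simplex K1) (x : std_simplex R (val s)) :
  f (bp1 g x) = bp (iota g) (incl_simplex sK s) x.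
Proof. by rewrite development_mapE. Qed.

Lemma development_map_coord a : bcoord (f a) = bcoord a.
Proof. by elim/development_ind: a => g s x; rewrite development_map_pt !bcoordE. Qed.

Lemma development_map_joined a b : joined a b -> joined (f a) (f b).
Proof.
move=> [g [s [x [y [-> ->]]]]]; rewrite !development_map_pt.
by exists (iota g), (incl_simplex sK s), x, y.
Qed.

Hypotheses (scK : simplicial_complex K) (scK1 : simplicial_complex K1).
Hypotheses (mtT : maximal_tree K T) (mtT1 : maximal_tree K1 T1).

(** Coordinates and common simplices are preserved, so chains go to chains of the same length. *)
Lemma development_map_short a b : dev_dist R Y T (f a) (f b) <= dev_dist R Y1 T1 a b.
Proof.
apply: (le_glue_dist (@std_dist_ge0 R V K1 Y1 T1) (dev_connected (R := R) scK1 mtT1)) => n l h.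
apply: (dev_dist_le (dev_connected (R := R) scK mtT) (n := n)).
elim: h => {n a b l} [a|n a b l e m _ IH /adj_joined[be ->]]; first exact: qchain0.
apply: qchainS IH _; apply/adj_joined; split; first exact: development_map_joined.
by rewrite !development_map_coord.
Qed.

End DevelopmentMap.

Theorem theorem4p7 (R : realType) (V : finType) (K K1 : {set {set V}})
    (Y : complex_of_groups K) (sK : K1 \subset K)
    (T T1 : {set {set V} * {set V}}) :
  simplicial_complex K -> connected_complex K ->
  simplicial_complex K1 -> connected_complex K1 ->
  maximal_tree K T -> maximal_tree K1 T1 -> T1 \subset T ->
  let G := pi1 Y T in
  let G1 := pi1 (restrict_cog sK Y) T1 in
  let iota : G1 -> G := pi1_map sK Y T1 T in
  let dB := dev_dist R Y T in
  let dB1 := dev_dist R (restrict_cog sK Y) T1 in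
  let f := development_map R sK Y T1 T in
  developable Y T ->
  hyperbolic_group R G ->
  (forall s : simplex K, quasiconvex R (range (pi1_loc Y T s))) ->
  injective iota ->
  hyperbolic_group R G1 ->
  (hyperbolic dB /\ hyperbolic dB1) /\
  (mitra_criterion dB1 dB f ->
   group_admits_CT R iota /\
   exists df, is_CT_map dB1 dB f df /\
     (quasiconvex R (range iota) <-> injective df)).
Proof.
move=> scK _ scK1 [K10 _] mtT mtT1 sT G G1 iota dB dB1 f _ [S gen hypG] qc iotaI [S1 gen1 hypG1].
have [c Hg] := cayley_hyp_graph gen hypG.
have [c1 Hg1] := cayley_hyp_graph gen1 hypG1.
have iotaM : {morph iota : x y / (x * y)%g} by exact: pi1_mapM.
(* One base simplex in the smaller complex serves both developments, so that f carries orbit to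
   orbit. *)
have [s0] : exists s0 : simplex K1, True.
  by have /set0Pn[s sK1] := K10; exists (exist _ s sK1).
move=> _; have [v0 v0s] := simplex_vertex scK1 s0.
pose x1 : std_simplex R (val s0) := vertex_pt R v0s.
pose x0 : std_simplex R (val (incl_simplex sK s0)) := x1.
pose rho1 := @orbit_dist R V K1 (restrict_cog sK Y) T1 s0 x1.
pose rho := @orbit_dist R V K Y T (incl_simplex sK s0) x0.
have qc1 (s : simplex K1) :
    quasiconvex R (iota @` range (pi1_loc (restrict_cog sK Y) T1 s))%classic.
  have -> : (iota @` range (pi1_loc (restrict_cog sK Y) T1 s) =
      range (pi1_loc Y T (incl_simplex sK s)))%classic.
    have e (a : Y (incl_simplex sK s)) :
        iota (pi1_loc (restrict_cog sK Y) T1 s a) = pi1_loc Y T (incl_simplex sK s) a.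
      by rewrite /iota /pi1_loc /pgen pi1_mapE.
    apply/seteqP; split=> x.
      by move=> [_ [a _ <-] <-]; exists a.
    by move=> [a _ <-]; exists (pi1_loc (restrict_cog sK Y) T1 s a) => //; exists a.
  exact: qc.
have qcG (s : simplex K) : quasiconvex R (id @` range (pi1_loc Y T s))%classic.
  by rewrite image_id; exact: qc.
have M : model (wd S) rho.
  apply: (orbit_model scK mtT x0 gen Hg) => s.
  by apply: (local_group_btw _ _ gen gen Hg qcG) => // x y.
have M1 : model (wd S1) rho1.
  apply: (orbit_model scK1 mtT1 x1 gen1 Hg1) => s.
  exact: (local_group_btw iotaM iotaI gen1 gen Hg1 qc1).
have hypB : hyperbolic dB := development_hyperbolic scK mtT Hg M.
have hypB1 : hyperbolic dB1 := development_hyperbolic scK1 mtT1 Hg1 M1.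
split=> // mitra.
have conn := @dev_connected R V K Y T scK mtT.
have conn1 := @dev_connected R V K1 (restrict_cog sK Y) T1 scK1 mtT1.
have pB : pseudo_metric dB := dev_pm conn.
have pB1 : pseudo_metric dB1 := dev_pm conn1.
have gf : gromov_proper dB1 dB f := mitra_gromov_proper pB1 pB hypB hypB1 mitra.
have [L hL] := wd_lip iotaM gen1 gen.
have prop := wd_proper S1 iotaM gen iotaI.
have [A lip] := mod_lip M; have [A1 lip1] := mod_lip M1.
have [B al] := alignment Hg M; have [B1 al1] := alignment Hg1 M1.
have fQ g : f (orbit_pt x1 g) = orbit_pt x0 (iota g) by exact: development_map_pt.
have und (D : nat) : exists C, forall x y, rho1 x y <= D%:R ->
    undistorted (wd S1) (wd S) iota C x y.
  have [N hN] := prod_of_orbit_dist (restrict_cog sK Y) scK1 mtT1 x1 D.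
  have [C hC] := prod_len_undistorted iotaM iotaI gen1 gen Hg1 Hg qc1 N.
  by exists C => x y /hN; exact: hC.
have iota_short x y : rho (iota x) (iota y) <= rho1 x y.
  rewrite /rho /orbit_dist -!fQ; exact: development_map_short.
have gp m : exists n, forall x y, n <= gromov_prod rho1 1%g x y ->
    m <= gromov_prod rho (iota 1%g) (iota x) (iota y).
  have [n hn] := gf (orbit_pt x1 1%g) m; exists n => x y h.
  by have := hn _ _ h; rewrite !fQ.
have far := far_image Hg1 Hg hL prop (mod_pm M1) (mod_pm M) lip1 lip al1 al und gp.
split.
  (* The generating sets are arbitrary here, while [far] concerns S1 and S; the new word metrics are
     models over the old ones. *)
  move=> S1' S' fS gen1' gen'; apply: cayley_map_CT => // m.
  have [L' hL'] := wd_change gen' gen.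
  have [|n hn] := @gromov_proper_image R _ _ _ _ _ _ _ _ _ L' _ Hg1 Hg
    (model_wd R gen1 gen1') (model_wd R gen gen') _ far m.
    by move=> x y; rewrite -natrM ler_nat.
  exists n => x y h; have := hn x y; rewrite (morph1 iotaM) /gromov_prod.
  by move: h; rewrite /gromov_prod !cayley_dist_vertex//; move=> h; apply.
have [df hdf] := gromov_proper_CT pB gf (orbit_pt x1 1%g).
exists df; split=> //; have [df1 _] := hdf; split.
(* Quasiconvexity makes all intervals of G_1 undistorted, so products in [B] bound those in [B_1]
   from below. *)
- move=> qci xi eta e.
  have [C hC] := quasiconvex_undistorted iotaM iotaI gen1 gen Hg1 Hg (H := setT) qci.
  have [k hk] := undistorted_gromov_prod Hg1 Hg hL (mod_pm M1) (mod_pm M) lip1 lip al1 al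
    1%g iota_short (fun x y => hC x y I I).
  have [D hD] := orbit_dense (restrict_cog sK Y) scK1 mtT1 x1.
  have rep (z : boundary dB1) : exists x, val z x.
    by case: z => s sP; have [x cx xE] := set_mem sP; exists x; rewrite /= xE.
  have [x hx] := rep xi; have [y hy] := rep eta.
  apply: (boundary_eq pB1 hypB1 hx hy).
  have : equiv_at_infty dB (f \o x) (f \o y).
    apply: (boundary_val_equiv pB hypB (xi := df xi)); first exact: df1.
    by rewrite e; exact: df1.
  move=> xy; apply: (equiv_at_infty_base pB1 (p := orbit_pt x1 1%g)) => m.
  (* Moving both sequences to orbit points costs [2 * D] in each development. *)
  have /near2P[N hN] := xy (f (orbit_pt x1 1%g)) (m + k%:R + 4 * D%:R).
  exists N => i j iN jN; have := hN i j iN jN => /=.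
  have [g xg] := hD (x i); have [h yh] := hD (y j).
  have := gromov_prod_diff pB (f (orbit_pt x1 1%g)) (f (x i)) (f (y j))
    (f (orbit_pt x1 1%g)) (f (orbit_pt x1 g)) (f (orbit_pt x1 h)).
  have := gromov_prod_diff pB1 (orbit_pt x1 1%g) (orbit_pt x1 g) (orbit_pt x1 h)
    (orbit_pt x1 1%g) (x i) (y j).
  rewrite !(pm0 pB) !(pm0 pB1) (pmC pB1 _ (x i)) (pmC pB1 _ (y j)) !fQ.
  have := development_map_short sT scK scK1 mtT mtT1 (x i) (orbit_pt x1 g).
  have := development_map_short sT scK scK1 mtT mtT1 (y j) (orbit_pt x1 h).
  rewrite -/f !fQ; have := hk g h.
  have -> : gromov_prod rho1 1%g g h =
    gromov_prod dB1 (orbit_pt x1 1%g) (orbit_pt x1 g) (orbit_pt x1 h) by [].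
  have -> : gromov_prod rho (iota 1%g) (iota g) (iota h) =
    gromov_prod dB (orbit_pt x0 (iota 1%g)) (orbit_pt x0 (iota g)) (orbit_pt x0 (iota h)) by [].
  rewrite -/dB -/dB1; lra.
- move=> df_inj; exists S => //.
  (* Either the images of intervals of G_1 stay uniformly close to intervals of G, which gives
     quasiconvexity, or intervals with escaping images exist for every k. *)
  have [|/forallNP bad] := pselect (exists k : nat, forall x y w, btw (wd S1) x y w ->
      exists2 p, btw (wd S) (iota x) (iota y) p & (wd S (iota w) p <= k)%N).
    move=> [k hk]; apply: (quasiconvex_of_btw R gen Hg (K := (2 * k + L + c)%N)).
    move=> _ _ p [x _ <-] [y _ <-] hp.
    have [w hw] := btw_near_image Hg1 Hg hL (hk x y) hp.
    by exists (iota w) => //; exists w.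
  exfalso.
  have [|u [v [hu hv huv hfar]]] := escaping_rays iotaM gen1 gen Hg1 Hg far.
    move=> k; apply: contrapT => no; apply: (bad k) => x y w hw.
    apply: contrapT => no'; apply: no; exists x, y, w; split=> // p hp.
    by rewrite ltnNge; apply/negP => h; apply: no'; exists p.
  have rays := rays_converge Hg1 Hg hL (mod_pm M1) (mod_pm M) lip al1 al und gp iota_short
    hu hv huv hfar.
  pose qu : nat -> development R (restrict_cog sK Y) T1 := fun k => orbit_pt x1 (u k).
  pose qv : nat -> development R (restrict_cog sK Y) T1 := fun k => orbit_pt x1 (v k).
  have cu : cvg_to_infty dB1 qu.
    apply: (equiv_at_infty_base pB1 (p := orbit_pt x1 1%g)) => m.
    by have [N hN] := rays m; exists N => i j iN jN; have [] := hN i j iN jN.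
  have cv : cvg_to_infty dB1 qv.
    apply: (equiv_at_infty_base pB1 (p := orbit_pt x1 1%g)) => m.
    by have [N hN] := rays m; exists N => i j iN jN; have [] := hN i j iN jN.
  have [xi hxi] := boundary_of cu; have [eta heta] := boundary_of cv.
  have xe : xi = eta.
    apply: df_inj; apply: (boundary_eq pB hypB (df1 _ _ hxi) (df1 _ _ heta)).
    apply: (equiv_at_infty_base pB (p := orbit_pt x0 (iota 1%g))) => m.
    have [N hN] := rays m; exists N => i j iN jN; have [_ _ h] := hN i j iN jN.
    by rewrite /qu /qv /= !fQ.
  rewrite -xe in heta.
  (* As 1 is between [u N] and [v N], their product at 1 is at most B1, which contradicts
     convergence to a common point. *)
  have /near2P[N hN] := boundary_val_equiv pB1 hypB1 hxi heta (orbit_pt x1 1%g) (B1%:R + 1).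
  have := hN N N (leqnn _) (leqnn _).
  have := gp_le_btw (mod_pm M1) al1 1%g (huv N N); rewrite (pm0 (mod_pm M1)).
  rewrite -[gromov_prod rho1 1%g (u N) (v N)]/(gromov_prod dB1 (orbit_pt x1 1%g) (qu N) (qv N)).
  lra.
Qed.
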